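(* Let $(H,\xi_H)$ be a finite-dimensional monoidal Hom-Hopf algebra with bijective antipode $S$ over a field $k$, and let $G=\mathrm{Aut}_{mHH}(H)\times\mathrm{Aut}_{mHH}(H)$ with multiplication $(\alpha,\beta)*(\gamma,\delta)=(\alpha\gamma,\delta\gamma^{-1}\beta\gamma)$. Then the category $Rep(\mathcal{MHD}(H))$ of representations of the monoidal Hom-Hopf $T$-coalgebra $\mathcal{MHD}(H)$ and the category $\mathcal{MHYD}(H)$ are isomorphic as braided $T$-categories over $G$.
   Context: Everything is over a field $k$. The monoidal Hom-category $\widetilde{\mathcal H}(\mathcal M_k)$ has objects $(M,\xi_M)$ ($M$ a $k$-vector space, $\xi_M$ a linear automorphism), morphisms the linear maps commuting with the automorphisms, tensor product $(M\otimes N,\xi_M\otimes\xi_N)$, unit $(k,\mathrm{id})$, associativity constraint $(m\otimes n)\otimes l\mapsto\xi_M(m)\otimes(n\otimes\xi_L^{-1}(l))$ and unit constraints $1\otimes m\mapsto\xi_M(m)$, $m\otimes1\mapsto\xi_M(m)$. Monoidal Hom-algebra $(A,\xi_A)$: $\xi_A(ab)=\xi_A(a)\xi_A(b)$, $\xi_A(1_A)=1_A$, $\xi_A(a)(bc)=(ab)\xi_A(c)$, $a1_A=1_Aa=\xi_A(a)$. Monoidal Hom-coalgebra $(C,\xi_C)$: $\Delta\xi_C=(\xi_C\otimes\xi_C)\Delta$, $\varepsilon\xi_C=\varepsilon$, $\xi_C^{-1}(c_1)\otimes\Delta(c_2)=\Delta(c_1)\otimes\xi_C^{-1}(c_2)$,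 $c_1\varepsilon(c_2)=\xi_C^{-1}(c)=\varepsilon(c_1)c_2$. Monoidal Hom-Hopf algebra $(H,\xi_H)$: both, with $\Delta,\varepsilon$ multiplicative and unital and antipode $S$ (commuting with $\xi_H$), $S(h_1)h_2=\varepsilon(h)1_H=h_1S(h_2)$. $\mathrm{Aut}_{mHH}(H)$ is the group of monoidal Hom-Hopf algebra automorphisms of $H$ (commuting with $\xi_H$). In $G$, $(\alpha,\beta)^{-1}=(\alpha^{-1},\alpha\beta^{-1}\alpha^{-1})$. Left $(A,\xi_A)$-Hom-module $(M,\xi_M)$: $\xi_A(a)\cdot(b\cdot m)=(ab)\cdot\xi_M(m)$, $\xi_M(a\cdot m)=\xi_A(a)\cdot\xi_M(m)$, $1_A\cdot m=\xi_M(m)$. Right $H$-Hom-comodule $(M,\xi_M)$ with $\rho(m)=m_0\otimes m_1$: $\xi_M^{-1}(m_0)\otimes\Delta(m_1)=m_{00}\otimes m_{01}\otimes\xi_H^{-1}(m_1)$, $\rho\xi_M=(\xi_M\otimes\xi_H)\rho$, $m_0\varepsilon(m_1)=\xi_M^{-1}(m)$. Crossed category over a group $G$: a monoidal category $\mathcal C$ that is a disjoint union of subcategories $\mathcal C_\alpha$ ($\alpha\in G$), with $U\otimes V\in\mathcal C_{\alpha\beta}$ for $U\in\mathcal C_\alpha,V\in\mathcal C_\beta$, and a group homomorphism $\varphi:G\to\mathrm{Aut}(\mathcal C)$ into invertible strict tensor functors with $\varphi_\beta(\mathcal C_\alpha)=\mathcal C_{\beta\alpha\beta^{-1}}$. For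 $U\in\mathcal C_\alpha$ write ${}^U(\cdot)={}^\alpha(\cdot)=\varphi_\alpha$. A braiding is a family of isomorphisms $c_{U,V}:U\otimes V\to{}^UV\otimes U$ such that $({}^\alpha g\otimes f)c_{U,V}=c_{U',V'}(f\otimes g)$ for $f:U\to U'$ in $\mathcal C_\alpha$ and $g:V\to V'$; $c_{U\otimes V,W}=a_{{}^{U\otimes V}W,U,V}(c_{U,{}^VW}\otimes\mathrm{id}_V)a^{-1}_{U,{}^VW,V}(\mathrm{id}_U\otimes c_{V,W})a_{U,V,W}$; $c_{U,V\otimes W}=a^{-1}_{{}^UV,{}^UW,U}(\mathrm{id}\otimes c_{U,W})a_{{}^UV,U,W}(c_{U,V}\otimes\mathrm{id}_W)a^{-1}_{U,V,W}$; and $\varphi_\beta(c_{U,V})=c_{\varphi_\beta(U),\varphi_\beta(V)}$. A braided $T$-category is a crossed category with a braiding. An isomorphism of braided $T$-categories over $G$ is an isomorphism of categories preserving the grading, the monoidal structure, the conjugations and the braiding. The braided $T$-category $\mathcal{MHYD}(H)$ over $G$: its $(\alpha,\beta)$-component ${}_H\mathcal{MHYD}^H(\alpha,\beta)$ has as objects the left-right $(\alpha,\beta)$-Yetter-Drinfeld Hom-modules, i.e. $(M,\xi_M)$ that are left $H$-Hom-modules and right $H$-Hom-comodules with $$\rho(h\cdot m)=\xi_H(h_{21})\cdot m_0\otimes(\beta(h_{22})\xi_H^{-1}(m_1))\alpha(S^{-1}(h_1)),$$ and as morphisms the $H$-linear, $H$-colinear maps. For $M$ in component $(\alpha,\beta)$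 and $N$ in component $(\gamma,\delta)$, $(M\otimes N,\xi_M\otimes\xi_N)$ has $h\cdot(m\otimes n)=\gamma(h_1)\cdot m\otimes\gamma^{-1}\beta\gamma(h_2)\cdot n$ and coaction $m\otimes n\mapsto(m_0\otimes n_0)\otimes n_1m_1$; ${}^{(\alpha,\beta)}N=N$ with action $h\unrhd n=\gamma^{-1}\beta\gamma\alpha^{-1}(h)\cdot n$ and coaction $n\mapsto n_0\otimes\alpha\beta^{-1}(n_1)$; and $c_{M,N}(m\otimes n)=\xi_N(n_0)\otimes\beta^{-1}(n_1)\cdot\xi_M^{-1}(m)$. Unit object and associativity are those of $\widetilde{\mathcal H}(\mathcal M_k)$ ($k$ with trivial structures). $\mathcal{MHD}(H)$: write $\xi_H^*(f)=f\circ\xi_H$; $(H^*,\xi_H^{*-1})$ has product $\langle fg,h\rangle=\langle f,h_1\rangle\langle g,h_2\rangle$ and coproduct $\langle f_1,h\rangle\langle f_2,l\rangle=\langle f,hl\rangle$; put $h\rightharpoonup f=\langle f_2,\xi_H^{-1}(h)\rangle\xi_H^{*-2}(f_1)$, $f\leftharpoonup h=\langle f_1,\xi_H^{-1}(h)\rangle\xi_H^{*-2}(f_2)$. The component $\mathcal{MHD}(H)_{(\alpha,\beta)}=H^*\bowtie H(\alpha,\beta)$ is the monoidal Hom-algebra $H^*\otimes H$ with structure automorphism $\xi_H^{*-1}\otimes\xi_H$, unit $\varepsilon\bowtie1_H$ and product $(f\bowtie h)(g\bowtie l)=f(\alpha(h_1)\rightharpoonup(\xi_H^{*2}(g)\leftharpoonup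 S^{-1}(\beta(h_{22}))))\bowtie\xi_H^2(h_{21})l$. Further, $\Delta_{(\alpha,\beta),(\gamma,\delta)}(f\bowtie h)=(f_2\bowtie\gamma(h_1))\otimes(f_1\bowtie\gamma^{-1}\beta\gamma(h_2))$ on $\mathcal{MHD}(H)_{(\alpha,\beta)*(\gamma,\delta)}$, $\varepsilon(f\bowtie h)=\varepsilon(h)f(1_H)$, antipode $S_{(\alpha,\beta)}(f\bowtie h)=(\varepsilon\bowtie\alpha\beta S\xi_H^{-1}(h))(f\circ\xi_H\circ S^{-1}\bowtie1_H)\in\mathcal{MHD}(H)_{(\alpha,\beta)^{-1}}$, and conjugation $\varphi^{(\alpha,\beta)}_{(\gamma,\delta)}(f\bowtie h)=f\circ\beta\alpha^{-1}\bowtie\alpha\gamma^{-1}\beta^{-1}\gamma(h)$ from $\mathcal{MHD}(H)_{(\gamma,\delta)}$ to $\mathcal{MHD}(H)_{(\alpha,\beta)*(\gamma,\delta)*(\alpha,\beta)^{-1}}$. $Rep(\mathcal{MHD}(H))$: its $(\alpha,\beta)$-component is the category of left Hom-modules over $\mathcal{MHD}(H)_{(\alpha,\beta)}$ (action $\triangleright$). The tensor product of $U$ in component $(\alpha,\beta)$ and $V$ in component $(\gamma,\delta)$ is $(U\otimes V,\xi_U\otimes\xi_V)$ with action through $\Delta_{(\alpha,\beta),(\gamma,\delta)}$; the unit is $k$ with action through $\varepsilon$; ${}^{(\alpha,\beta)}V=V$ with action $x\triangleright' v=(\varphi^{(\alpha,\beta)}_{(\gamma,\delta)})^{-1}(x)\triangleright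 v$; and the braiding is $c_{U,V}(u\otimes v)=\sum_i(\xi_H^{*}(e^i)\bowtie1_H)\triangleright\xi_V^{-1}(v)\otimes(\varepsilon\bowtie\beta^{-1}\xi_H^{-1}(e_i))\triangleright\xi_U^{-1}(u)$, where $\{e_i\},\{e^i\}$ are dual bases of $H$ and $H^*$. *)

(* Defs.v *)
From HB Require Import structures.
From mathcomp Require Import all_boot all_order all_algebra.
From mathcomp Require Import boolp.

Set Implicit Arguments.
Unset Strict Implicit.
Unset Printing Implicit Defensive.

Import GRing.Theory.
Local Open Scope ring_scope.

Section Tensor.
Variables (k : fieldType) (M N : lmodType k).

Definition bilin (P : lmodType k) (f : M -> N -> P) : Prop :=
  (forall n, linear (f^~ n)) /\ (forall m, linear (f m)).

Definition sum_pairs (P : zmodType) (f : M -> N -> P) (s : seq (M * N)) : P :=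
  \sum_(p <- s) f p.1 p.2.

(* The list [:: (m1, n1); ...; (mr, nr)] stands for m1 (x) n1 + ... + mr (x) nr;
   two lists are identified when no bilinear map to a vector space separates
   them, so that the quotient is the algebraic tensor product. *)
Definition tensor_eq (s t : seq (M * N)) : bool :=
  `[< forall (P : lmodType k) (f : M -> N -> P), bilin f ->
        sum_pairs f s = sum_pairs f t >].

Lemma tensor_eq_refl : reflexive tensor_eq.
Proof. by move=> s; apply/asboolP. Qed.

Lemma tensor_eq_sym : symmetric tensor_eq.
Proof.
by move=> s t; apply/idP/idP => /asboolP e; apply/asboolP => P f bf;
  rewrite (e P f bf).
Qed.

Lemma tensor_eq_trans : transitive tensor_eq.
Proof.
move=> t s u /asboolP e1 /asboolP e2; apply/asboolP => P f bf.
by rewrite (e1 P f bf) (e2 P f bf).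
Qed.

Definition tensor_equiv :=
  EquivRel tensor_eq tensor_eq_refl tensor_eq_sym tensor_eq_trans.

Definition tensor := {eq_quot tensor_equiv}%qT.
HB.instance Definition _ := Choice.on tensor.
HB.instance Definition _ := EqQuotient.on tensor.

Local Open Scope quotient_scope.

(* \tsum_(m, n <- t) F m n : the Sweedler sum over a chosen decomposition of t,
   which does not depend on the decomposition when F is bilinear. *)
Definition tfold (P : zmodType) (f : M -> N -> P) (t : tensor) : P :=
  sum_pairs f (repr t).

Lemma tensor_eqP s t :
  (forall (P : lmodType k) (f : M -> N -> P), bilin f ->
     sum_pairs f s = sum_pairs f t) <-> \pi_tensor s = \pi_tensor t.
Proof.
split=> [e|/eqmodP/asboolP //].
by apply/eqmodP/asboolP.
Qed.

Lemma tfold_pi (P : lmodType k) (f : M -> N -> P) s :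
  bilin f -> tfold f (\pi_tensor s) = sum_pairs f s.
Proof. by rewrite /tfold; move: P f; apply/tensor_eqP; rewrite reprK. Qed.

Lemma tensor_ext (s t : tensor) :
  (forall (P : lmodType k) (f : M -> N -> P), bilin f ->
     tfold f s = tfold f t) -> s = t.
Proof. by move=> e; rewrite -[s]reprK -[t]reprK; apply/tensor_eqP. Qed.

Definition tens (m : M) (n : N) : tensor := \pi_tensor [:: (m, n)].
Definition tensor0 : tensor := \pi_tensor [::].
Definition tensor_add (s t : tensor) : tensor := \pi_tensor (repr s ++ repr t).
Definition tensor_scale (c : k) (s : tensor) : tensor :=
  \pi_tensor [seq (c *: p.1, p.2) | p <- repr s].
Definition tensor_opp (s : tensor) : tensor := tensor_scale (-1) s.

Section Fold.
Variables (P : lmodType k) (f : M -> N -> P).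
Hypothesis bf : bilin f.

Lemma tfold_tens m n : tfold f (tens m n) = f m n.
Proof. by rewrite tfold_pi // /sum_pairs big_seq1. Qed.

Lemma tfold0 : tfold f tensor0 = 0.
Proof. by rewrite tfold_pi // /sum_pairs big_nil. Qed.

Lemma tfold_add s t : tfold f (tensor_add s t) = tfold f s + tfold f t.
Proof. by rewrite tfold_pi // /sum_pairs big_cat. Qed.

Lemma tfold_scale c s : tfold f (tensor_scale c s) = c *: tfold f s.
Proof.
rewrite tfold_pi // /sum_pairs big_map scaler_sumr.
apply: eq_bigr => p _ /=.
have h := bf.1 p.2 c p.1 0; move: h; rewrite /= addr0 => ->.
have := bf.1 p.2 1 0 0; rewrite /= scaler0 addr0 scale1r.
by move=> e; rewrite (_ : f 0 p.2 = 0) ?addr0 //; apply: (addrI (f 0 p.2)); rewrite addr0 -e.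
Qed.
End Fold.

Lemma tensor_addA : associative tensor_add.
Proof. by move=> x y z; apply: tensor_ext => P f bf; rewrite !tfold_add // addrA. Qed.
Lemma tensor_addC : commutative tensor_add.
Proof. by move=> x y; apply: tensor_ext => P f bf; rewrite !tfold_add // addrC. Qed.
Lemma tensor_add0 : left_id tensor0 tensor_add.
Proof. by move=> x; apply: tensor_ext => P f bf; rewrite tfold_add // tfold0 // add0r. Qed.
Lemma tensor_addN : left_inverse tensor0 tensor_opp tensor_add.
Proof.
move=> x; apply: tensor_ext => P f bf.
by rewrite tfold_add // tfold0 // tfold_scale // scaleN1r addNr.
Qed.

HB.instance Definition _ := GRing.isZmodule.Build tensor
  tensor_addA tensor_addC tensor_add0 tensor_addN.

Lemma tensor_scaleA a b v : tensor_scale a (tensor_scale b v) = tensor_scale (a * b) v.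
Proof. by apply: tensor_ext => P f bf; rewrite !tfold_scale // scalerA. Qed.
Lemma tensor_scale1 : left_id 1 tensor_scale.
Proof. by move=> x; apply: tensor_ext => P f bf; rewrite tfold_scale // scale1r. Qed.
Lemma tensor_scaleDr : right_distributive tensor_scale +%R.
Proof.
move=> c x y; apply: tensor_ext => P f bf.
by rewrite tfold_scale // !tfold_add // !tfold_scale // scalerDr.
Qed.
Lemma tensor_scaleDl v : {morph tensor_scale^~ v : a b / a + b}.
Proof.
move=> a b; apply: tensor_ext => P f bf.
by rewrite tfold_add // !tfold_scale // scalerDl.
Qed.

HB.instance Definition _ := GRing.Zmodule_isLmodule.Build k tensor
  tensor_scaleA tensor_scale1 tensor_scaleDr tensor_scaleDl.

Lemma tfold_linear (P : lmodType k) (f : M -> N -> P) : bilin f -> linear (tfold f).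
Proof. by move=> bf c x y; rewrite tfold_add // tfold_scale. Qed.

Lemma tens_bilin : bilin tens.
Proof.
split=> [n c x y | m c x y]; apply: tensor_ext => P f bf;
  rewrite tfold_add // tfold_scale // !tfold_tens //.
- exact: bf.1.
- exact: bf.2.
Qed.

Lemma tensorE (t : tensor) : t = tfold tens t.
Proof.
apply: tensor_ext => P f bf; rewrite {1}/tfold {2}/tfold.
elim: (repr t) => [|p s IH]; rewrite /sum_pairs ?big_nil ?big_cons.
  exact/esym/(tfold0 bf).
have -> : \sum_(q <- s) f q.1 q.2 = tfold f (sum_pairs tens s) by [].
by rewrite -[f _ _](tfold_tens bf); exact/esym/(tfold_add bf).
Qed.

End Tensor.

Arguments tfold {k M N P} f t.
Arguments tens {k M N} m n.

Notation "\tsum_ ( m , n <- t ) F" := (tfold (fun m n => F) t)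
  (at level 41, m name, n name, t at level 60, F at level 41, right associativity,
   format "'[' \tsum_ ( m ,  n  <-  t ) '/  '  F ']'") : ring_scope.

Section TensorMaps.
Variable k : fieldType.
Implicit Types M N P : lmodType k.

Definition tmap M M' N N' (f : M -> M') (g : N -> N') (t : tensor M N) : tensor M' N' :=
  \tsum_(m, n <- t) tens (f m) (g n).

Lemma tmap_bilin M M' N N' (f : M -> M') (g : N -> N') :
  linear f -> linear g -> bilin (fun m n => tens (f m) (g n)).
Proof.
have [tl tr] := tens_bilin M' N'.
by move=> lf lg; split=> [n c x y | m c x y]; rewrite ?lf ?lg; [apply: tl | apply: tr].
Qed.

Lemma tmap_tens M M' N N' (f : M -> M') (g : N -> N') m n :
  linear f -> linear g -> tmap f g (tens m n) = tens (f m) (g n).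
Proof. by move=> lf lg; rewrite /tmap tfold_tens //; apply: tmap_bilin. Qed.

Lemma tmap_linear M M' N N' (f : M -> M') (g : N -> N') :
  linear f -> linear g -> linear (tmap f g).
Proof. by move=> lf lg; apply/tfold_linear/tmap_bilin. Qed.

Lemma linear_eq_tens M N P (f g : tensor M N -> P) : linear f -> linear g ->
  (forall m n, f (tens m n) = g (tens m n)) -> f =1 g.
Proof.
move=> lf lg e t; rewrite [t]tensorE /tfold /sum_pairs.
have lin0 (h : tensor M N -> P) : linear h -> h 0 = 0.
  move=> lh; have := lh 1 0 0; rewrite scaler0 addr0 scale1r => e0.
  by apply: (addrI (h 0)); rewrite addr0 -e0.
have linD (h : tensor M N -> P) x y : linear h -> h (x + y) = h x + h y.
  by move=> lh; have := lh 1 x y; rewrite !scale1r.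
elim: (repr t) => [|p s IH]; first by rewrite !big_nil !lin0.
by rewrite !big_cons !linD // e IH.
Qed.

Lemma tmap_comp M M' M'' N N' N'' (f : M -> M') (f' : M' -> M'')
    (g : N -> N') (g' : N' -> N'') :
  linear f -> linear f' -> linear g -> linear g' ->
  forall t, tmap f' g' (tmap f g t) = tmap (f' \o f) (g' \o g) t.
Proof.
move=> lf lf' lg lg'.
have lff : linear (f' \o f) by move=> c x y /=; rewrite lf lf'.
have lgg : linear (g' \o g) by move=> c x y /=; rewrite lg lg'.
apply: linear_eq_tens; last by move=> m n; rewrite !tmap_tens.
- by move=> c x y; rewrite !tmap_linear.
- exact: tmap_linear.
Qed.

Lemma tmap_id M N (f : M -> M) (g : N -> N) (t : tensor M N) :
  f =1 id -> g =1 id -> tmap f g t = t.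
Proof.
move=> /funext -> /funext ->; have lid (V : lmodType k) : linear (@id V) by [].
apply: (linear_eq_tens (g := id)) => //; first exact: tmap_linear.
by move=> m n; rewrite tmap_tens.
Qed.

End TensorMaps.

Section HomSpace.
Variable k : fieldType.
Implicit Types V W : lmodType k.

Record homAut V := HomAut {
  xi : V -> V;
  xiV : V -> V;
  xi_lin : linear xi;
  xiK : cancel xi xiV;
  xiVK : cancel xiV xi }.

Lemma xiV_lin V (a : homAut V) : linear (xiV a).
Proof. by move=> c x y; apply: (can_inj (xiK a)); rewrite (xi_lin a) !xiVK. Qed.

Definition idAut V : homAut V :=
  @HomAut V id id (fun _ _ _ => erefl) (fun _ => erefl) (fun _ => erefl).

Lemma tmapK V W (a : homAut V) (b : homAut W) :
  cancel (tmap (xi a) (xi b)) (tmap (xiV a) (xiV b)).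
Proof.
move=> t; rewrite tmap_comp ?tmap_id //; try exact: xi_lin; try exact: xiV_lin.
- exact: xiK.
- exact: xiK.
Qed.

Lemma tmapVK V W (a : homAut V) (b : homAut W) :
  cancel (tmap (xiV a) (xiV b)) (tmap (xi a) (xi b)).
Proof.
move=> t; rewrite tmap_comp ?tmap_id //; try exact: xi_lin; try exact: xiV_lin.
- exact: xiVK.
- exact: xiVK.
Qed.

Definition tensorAut V W (a : homAut V) (b : homAut W) : homAut (tensor V W) :=
  HomAut (tmap_linear (xi_lin a) (xi_lin b)) (tmapK a b) (tmapVK a b).

Record homSpace := HomSpace {
  hs_car :> lmodType k;
  hs_aut :> homAut hs_car }.

Implicit Types M N L : homSpace.

Definition hunit : homSpace := HomSpace (idAut k^o).
Definition htens M N : homSpace := HomSpace (tensorAut M N).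

Definition hassoc M N L : htens (htens M N) L -> htens M (htens N L) :=
  fun t => \tsum_(s, l <- t) \tsum_(m, n <- s) tens (xi M m) (tens n (xiV L l)).
Definition hassocV M N L : htens M (htens N L) -> htens (htens M N) L :=
  fun t => \tsum_(m, s <- t) \tsum_(n, l <- s) tens (tens (xiV M m) n) (xi L l).
Definition hlunit M : htens hunit M -> M :=
  tfold (fun (c : k^o) m => (c : k) *: xi M m).
Definition hrunit M : htens M hunit -> M :=
  tfold (fun m (c : k^o) => (c : k) *: xi M m).

End HomSpace.

Section HomAlgebra.
Variable k : fieldType.

Record homAlg (A : lmodType k) := HomAlg {
  alg_aut :> homAut A;
  amul : A -> A -> A;
  aone : A }.

Record is_homAlg (A : lmodType k) (R : homAlg A) : Prop := IsHomAlg {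
  amul_bilin : bilin (amul R);
  amul_xi : forall a b, xi R (amul R a b) = amul R (xi R a) (xi R b);
  aone_xi : xi R (aone R) = aone R;
  amul_assoc : forall a b c,
    amul R (xi R a) (amul R b c) = amul R (amul R a b) (xi R c);
  amul_1r : forall a, amul R a (aone R) = xi R a;
  amul_1l : forall a, amul R (aone R) a = xi R a }.

Record is_homModule (A : lmodType k) (R : homAlg A) (M : homSpace k)
    (act : A -> M -> M) : Prop := IsHomModule {
  act_bilin : bilin act;
  act_assoc : forall a b m, act (xi R a) (act b m) = act (amul R a b) (xi M m);
  act_xi : forall a m, xi M (act a m) = act (xi R a) (xi M m);
  act_1 : forall m, act (aone R) m = xi M m }.

Record homHopf (H : lmodType k) := HomHopf {
  hopf_alg :> homAlg H;
  delta : H -> tensor H H;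
  eps : H -> k;
  apode : H -> H;
  hopf_algP : is_homAlg hopf_alg;
  delta_lin : linear delta;
  eps_lin : scalar eps;
  delta_xi : forall h, delta (xi hopf_alg h) =
    tmap (xi hopf_alg) (xi hopf_alg) (delta h);
  eps_xi : forall h, eps (xi hopf_alg h) = eps h;
  delta_coassoc : forall h,
    \tsum_(h1, h2 <- delta h) tens (xiV hopf_alg h1) (delta h2) =
    \tsum_(h1, h2 <- delta h) \tsum_(h11, h12 <- delta h1)
      tens h11 (tens h12 (xiV hopf_alg h2));
  delta_epsr : forall h, \tsum_(h1, h2 <- delta h) (eps h2 *: h1) = xiV hopf_alg h;
  delta_epsl : forall h, \tsum_(h1, h2 <- delta h) (eps h1 *: h2) = xiV hopf_alg h;
  delta_mul : forall h l, delta (amul hopf_alg h l) =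
    \tsum_(h1, h2 <- delta h) \tsum_(l1, l2 <- delta l)
      tens (amul hopf_alg h1 l1) (amul hopf_alg h2 l2);
  delta_1 : delta (aone hopf_alg) = tens (aone hopf_alg) (aone hopf_alg);
  eps_mul : forall h l, eps (amul hopf_alg h l) = eps h * eps l;
  eps_1 : eps (aone hopf_alg) = 1;
  apode_lin : linear apode;
  apode_xi : forall h, apode (xi hopf_alg h) = xi hopf_alg (apode h);
  apode_l : forall h, \tsum_(h1, h2 <- delta h) amul hopf_alg (apode h1) h2 =
    eps h *: aone hopf_alg;
  apode_r : forall h, \tsum_(h1, h2 <- delta h) amul hopf_alg h1 (apode h2) =
    eps h *: aone hopf_alg }.

Record is_homComodule (H : lmodType k) (A : homHopf H) (M : homSpace k)
    (rho : M -> tensor M H) : Prop := IsHomComodule {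
  rho_lin : linear rho;
  rho_coassoc : forall m,
    \tsum_(m0, m1 <- rho m) tens (xiV M m0) (delta A m1) =
    \tsum_(m0, m1 <- rho m) \tsum_(m00, m01 <- rho m0)
      tens m00 (tens m01 (xiV A m1));
  rho_xi : forall m, rho (xi M m) = tmap (xi M) (xi A) (rho m);
  rho_eps : forall m, \tsum_(m0, m1 <- rho m) (eps A m1 *: m0) = xiV M m }.

End HomAlgebra.

Section Automorphisms.
Variables (k : fieldType) (V : lmodType k) (H : homHopf V).

Record is_hopfAut (f : V -> V) : Prop := IsHopfAut {
  aut_lin : linear f;
  aut_xi : forall h, f (xi H h) = xi H (f h);
  aut_mul : forall h l, f (amul H h l) = amul H (f h) (f l);
  aut_one : f (aone H) = aone H;
  aut_delta : forall h, delta H (f h) = tmap f f (delta H h);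
  aut_eps : forall h, eps H (f h) = eps H h;
  aut_apode : forall h, f (apode H h) = apode H (f h) }.

Record hopfAut := HopfAut {
  autf :> V -> V;
  autV : V -> V;
  autP : is_hopfAut autf;
  autK : cancel autf autV;
  autVK : cancel autV autf }.

Lemma hopfAut_eq (a b : hopfAut) : a =1 b -> a = b.
Proof.
move=> /funext; case: a b => [a aV aP aK aVK] [b bV bP bK bVK] /= e.
subst b; have e : aV = bV by apply: funext => x; rewrite -[x in RHS]aVK bK.
subst bV; congr HopfAut; exact: Prop_irrelevance.
Qed.

HB.instance Definition _ := gen_eqMixin hopfAut.
HB.instance Definition _ := gen_choiceMixin hopfAut.

Lemma is_hopfAut_id : is_hopfAut id.
Proof. by split=> // h; rewrite tmap_id. Qed.

Lemma is_hopfAut_comp f g : is_hopfAut f -> is_hopfAut g -> is_hopfAut (f \o g).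
Proof.
case=> fl fx fm f1 fd fe fs [gl gx gm g1 gd ge gs]; split=> /=.
- by move=> c x y /=; rewrite gl fl.
- by move=> h; rewrite gx fx.
- by move=> h l; rewrite gm fm.
- by rewrite g1.
- by move=> h; rewrite fd gd tmap_comp.
- by move=> h; rewrite fe.
- by move=> h; rewrite gs fs.
Qed.

Lemma is_hopfAut_inv f g : is_hopfAut f -> cancel f g -> cancel g f -> is_hopfAut g.
Proof.
case=> fl fx fm f1 fd fe fs fK gK; have fI := can_inj fK.
have gl : linear g by move=> c x y; apply: fI; rewrite fl !gK.
split=> //.
- by move=> h; apply: fI; rewrite fx !gK.
- by move=> h l; apply: fI; rewrite fm !gK.
- by rewrite -f1 fK.
- by move=> h; rewrite -{2}[h]gK fd tmap_comp // tmap_id.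
- by move=> h; rewrite -{2}[h]gK fe.
- by move=> h; apply: fI; rewrite fs !gK.
Qed.

Definition hopfAut1 := HopfAut is_hopfAut_id (fun _ => erefl) (fun _ => erefl).
Definition hopfAutM (a b : hopfAut) :=
  HopfAut (is_hopfAut_comp (autP a) (autP b))
    (can_comp (autK a) (autK b)) (can_comp (autVK b) (autVK a)).
Definition hopfAutV (a : hopfAut) :=
  HopfAut (is_hopfAut_inv (autP a) (autK a) (autVK a)) (autVK a) (autK a).

Fact hopfAut_mulA : associative hopfAutM.
Proof. by move=> a b c; apply: hopfAut_eq. Qed.
Fact hopfAut_mul1 : left_id hopfAut1 hopfAutM.
Proof. by move=> a; apply: hopfAut_eq. Qed.
Fact hopfAut_mulr1 : right_id hopfAut1 hopfAutM.
Proof. by move=> a; apply: hopfAut_eq. Qed.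
Fact hopfAut_mulV : left_inverse hopfAut1 hopfAutV hopfAutM.
Proof. by move=> a; apply: hopfAut_eq => x /=; rewrite autK. Qed.
Fact hopfAut_mulrV : right_inverse hopfAut1 hopfAutV hopfAutM.
Proof. by move=> a; apply: hopfAut_eq => x /=; rewrite autVK. Qed.

HB.instance Definition _ := isGroup.Build hopfAut
  hopfAut_mulA hopfAut_mul1 hopfAut_mulr1 hopfAut_mulV hopfAut_mulrV.

Record autPair := AutPair { al : hopfAut; be : hopfAut }.

HB.instance Definition _ := gen_eqMixin autPair.
HB.instance Definition _ := gen_choiceMixin autPair.

Local Open Scope group_scope.

Definition autPair1 := AutPair 1 1.
Definition autPairM (p q : autPair) :=
  AutPair (al p * al q) (be q * (al q)^-1 * be p * al q).
Definition autPairV (p : autPair) :=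
  AutPair (al p)^-1 (al p * (be p)^-1 * (al p)^-1).

Fact autPair_mulA : associative autPairM.
Proof.
move=> [a b] [c d] [e f]; rewrite /autPairM /=; congr AutPair; first exact: mulgA.
by rewrite invgM !mulgA mulgK.
Qed.
Fact autPair_mul1 : left_id autPair1 autPairM.
Proof. by move=> [a b]; rewrite /autPairM /= mul1g mulg1 mulgVK. Qed.
Fact autPair_mulr1 : right_id autPair1 autPairM.
Proof. by move=> [a b]; rewrite /autPairM /= invg1 !mulg1 !mul1g. Qed.
Fact autPair_mulV : left_inverse autPair1 autPairV autPairM.
Proof.
move=> [a b]; rewrite /autPairM /autPairV /autPair1 /=; congr AutPair.
  exact: mulVg.
by rewrite !mulgA !mulgVK mulgV.
Qed.
Fact autPair_mulrV : right_inverse autPair1 autPairV autPairM.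
Proof.
move=> [a b]; rewrite /autPairM /autPairV /autPair1 /=; congr AutPair.
  exact: mulgV.
by rewrite invgK !mulgVK mulgV.
Qed.

HB.instance Definition _ := isGroup.Build autPair
  autPair_mulA autPair_mul1 autPair_mulr1 autPair_mulV autPair_mulrV.

End Automorphisms.

Section BraidedT.
Variable G : groupType.

Record tcatData := TCatData {
  ob : Type;
  hom : ob -> ob -> Type;
  idm : forall U, hom U U;
  comp : forall U V W, hom V W -> hom U V -> hom U W;
  tob : ob -> ob -> ob;
  thom : forall U U' V V', hom U U' -> hom V V' -> hom (tob U V) (tob U' V');
  unit_ob : ob;
  assoc : forall U V W, hom (tob (tob U V) W) (tob U (tob V W));
  assocV : forall U V W, hom (tob U (tob V W)) (tob (tob U V) W);
  lunit : forall U, hom (tob unit_ob U) U;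
  runit : forall U, hom (tob U unit_ob) U;
  grade : ob -> G;
  cob : G -> ob -> ob;
  chom : forall (g : G) U V, hom U V -> hom (cob g U) (cob g V);
  braid : forall U V, hom (tob U V) (tob (cob (grade U) V) U) }.

Arguments idm {t} U.
Arguments comp {t U V W} f g.
Arguments thom {t U U' V V'} f g.
Arguments chom {t} g {U V} f.
Local Notation "f \; g" := (comp g f).

(* Morphisms as elements of the disjoint union of all hom-sets: the equality
   [arr f = arr g] includes the equality of sources and targets. *)
Definition arr (C : tcatData) (U V : ob C) (f : hom U V) :
    {p : ob C * ob C & hom p.1 p.2} :=
  existT (fun p : ob C * ob C => hom p.1 p.2) (U, V) f.

Definition is_iso (C : tcatData) (U V : ob C) (f : hom U V) : Prop :=
  exists g : hom V U, f \; g = idm U /\ g \; f = idm V.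

Record is_monoidal (C : tcatData) : Prop := IsMonoidal {
  comp_idl : forall (U V : ob C) (f : hom U V), f \; idm V = f;
  comp_idr : forall (U V : ob C) (f : hom U V), idm U \; f = f;
  comp_assoc : forall (U V W X : ob C) (f : hom U V) (g : hom V W) (h : hom W X),
    (f \; g) \; h = f \; (g \; h);
  thom_id : forall U V : ob C, thom (idm U) (idm V) = idm (tob U V);
  thom_comp : forall (U U' U'' V V' V'' : ob C)
    (f : hom U U') (f' : hom U' U'') (g : hom V V') (g' : hom V' V''),
    thom (f \; f') (g \; g') = thom f g \; thom f' g';
  assocK : forall U V W : ob C, assoc U V W \; assocV U V W = idm _;
  assocVK : forall U V W : ob C, assocV U V W \; assoc U V W = idm _;
  assoc_nat : forall (U U' V V' W W' : ob C)
    (f : hom U U') (g : hom V V') (h : hom W W'),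
    thom (thom f g) h \; assoc U' V' W' = assoc U V W \; thom f (thom g h);
  lunit_iso : forall U : ob C, is_iso (lunit U);
  runit_iso : forall U : ob C, is_iso (runit U);
  lunit_nat : forall (U V : ob C) (f : hom U V),
    thom (idm _) f \; lunit V = lunit U \; f;
  runit_nat : forall (U V : ob C) (f : hom U V),
    thom f (idm _) \; runit V = runit U \; f;
  pentagon : forall U V W X : ob C,
    assoc (tob U V) W X \; assoc U V (tob W X) =
    thom (assoc U V W) (idm X) \; (assoc U (tob V W) X \; thom (idm U) (assoc V W X));
  triangle : forall U V : ob C,
    assoc U (unit_ob C) V \; thom (idm U) (lunit V) = thom (runit U) (idm V) }.

Local Open Scope group_scope.

Record is_crossed (C : tcatData) : Prop := IsCrossed {
  grade_hom : forall (U V : ob C) (f : hom U V), grade U = grade V;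
  grade_tob : forall U V : ob C, grade (tob U V) = grade U * grade V;
  grade_cob : forall (g : G) (U : ob C), grade (cob g U) = g * grade U * g^-1;
  chom_id : forall (g : G) (U : ob C), chom g (idm U) = idm (cob g U);
  chom_comp : forall (g : G) (U V W : ob C) (f : hom U V) (f' : hom V W),
    chom g (f \; f') = chom g f \; chom g f';
  cob_tob : forall (g : G) (U V : ob C), cob g (tob U V) = tob (cob g U) (cob g V);
  chom_thom : forall (g : G) (U U' V V' : ob C) (f : hom U U') (f' : hom V V'),
    arr (chom g (thom f f')) = arr (thom (chom g f) (chom g f'));
  cob_unit : forall g : G, cob g (unit_ob C) = unit_ob C;
  chom_assoc : forall (g : G) (U V W : ob C),
    arr (chom g (assoc U V W)) = arr (assoc (cob g U) (cob g V) (cob g W));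
  chom_lunit : forall (g : G) (U : ob C), arr (chom g (lunit U)) = arr (lunit (cob g U));
  chom_runit : forall (g : G) (U : ob C), arr (chom g (runit U)) = arr (runit (cob g U));
  cob_1 : forall U : ob C, cob 1 U = U;
  chom_1 : forall (U V : ob C) (f : hom U V), arr (chom 1 f) = arr f;
  cob_M : forall (g h : G) (U : ob C), cob (g * h) U = cob g (cob h U);
  chom_M : forall (g h : G) (U V : ob C) (f : hom U V),
    arr (chom (g * h) f) = arr (chom g (chom h f)) }.

(* In [braid_tobl], the object ^(U (x) V) W of the first hexagon is written
   ^U(^V W), to which it is equal by [cob_M] and [grade_tob]. *)
Record is_braided (C : tcatData) : Prop := IsBraided {
  braid_iso : forall U V : ob C, is_iso (braid U V);
  braid_nat : forall (U U' V V' : ob C) (f : hom U U') (g : hom V V'),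
    arr (braid U V \; thom (chom (grade U) g) f) = arr (thom f g \; braid U' V');
  braid_tobl : forall U V W : ob C,
    arr (braid (tob U V) W) =
    arr (assoc U V W \;
         (thom (idm U) (braid V W) \;
          (assocV U (cob (grade V) W) V \;
           (thom (braid U (cob (grade V) W)) (idm V) \;
            assoc (cob (grade U) (cob (grade V) W)) U V))));
  braid_tobr : forall U V W : ob C,
    arr (braid U (tob V W)) =
    arr (assocV U V W \;
         (thom (braid U V) (idm W) \;
          (assoc (cob (grade U) V) U W \;
           (thom (idm (cob (grade U) V)) (braid U W) \;
            assocV (cob (grade U) V) (cob (grade U) W) U))));
  chom_braid : forall (g : G) (U V : ob C),
    arr (chom g (braid U V)) = arr (braid (cob g U) (cob g V)) }.

Record is_braidedT (C : tcatData) : Prop := IsBraidedT {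
  braidedT_monoidal : is_monoidal C;
  braidedT_crossed : is_crossed C;
  braidedT_braided : is_braided C }.

Record tfunctor (C D : tcatData) := TFunctor {
  fob :> ob C -> ob D;
  fhom : forall U V : ob C, hom U V -> hom (fob U) (fob V);
  fhom_id : forall U : ob C, fhom (idm U) = idm (fob U);
  fhom_comp : forall (U V W : ob C) (f : hom U V) (g : hom V W),
    fhom (f \; g) = fhom f \; fhom g }.

Arguments fhom {C D} t {U V} f.

Definition mutually_inverse (C D : tcatData) (F : tfunctor C D) (E : tfunctor D C) : Prop :=
  [/\ cancel F E, cancel E F,
      forall (U V : ob C) (f : hom U V), arr (fhom E (fhom F f)) = arr f
    & forall (U V : ob D) (f : hom U V), arr (fhom F (fhom E f)) = arr f].

Record preserves_braidedT (C D : tcatData) (F : tfunctor C D) : Prop := PreservesBraidedT {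
  fob_grade : forall U : ob C, grade (F U) = grade U;
  fob_tob : forall U V : ob C, F (tob U V) = tob (F U) (F V);
  fhom_thom : forall (U U' V V' : ob C) (f : hom U U') (g : hom V V'),
    arr (fhom F (thom f g)) = arr (thom (fhom F f) (fhom F g));
  fob_unit : F (unit_ob C) = unit_ob D;
  fhom_assoc : forall U V W : ob C,
    arr (fhom F (assoc U V W)) = arr (assoc (F U) (F V) (F W));
  fhom_lunit : forall U : ob C, arr (fhom F (lunit U)) = arr (lunit (F U));
  fhom_runit : forall U : ob C, arr (fhom F (runit U)) = arr (runit (F U));
  fob_cob : forall (g : G) (U : ob C), F (cob g U) = cob g (F U);
  fhom_chom : forall (g : G) (U V : ob C) (f : hom U V),
    arr (fhom F (chom g f)) = arr (chom g (fhom F f));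
  fhom_braid : forall U V : ob C, arr (fhom F (braid U V)) = arr (braid (F U) (F V)) }.

Definition braidedT_isomorphic (C D : tcatData) : Prop :=
  exists (F : tfunctor C D) (E : tfunctor D C),
    mutually_inverse F E /\ preserves_braidedT F.

End BraidedT.

(* Both categories of the theorem have as objects spaces of the monoidal
   Hom-category with a grade and extra structure, their tensor product, unit and
   constraints are those of the monoidal Hom-category, and conjugation does not
   change the underlying space and maps. [structured] collects the remaining
   data; [well_defined] says that these formulas do give objects and morphisms,
   and [tcat_of] is the resulting category. *)
Section Structured.
Variables (k : fieldType) (G : groupType).

Record object (str : homSpace k -> Type) := Object {
  ograde : G;
  ospace :> homSpace k;
  ostr : str ospace }.

Record structured := Structured {
  str : homSpace k -> Type;
  good : object str -> Prop;
  smorph : forall U V : object str, (U -> V) -> Prop;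
  sunit : str (hunit k);
  stens : forall U V : object str, str (htens U V);
  sconj : G -> forall U : object str, str U;
  sbraid : forall U V : object str, htens U V -> htens V U }.

Variable C : structured.
Local Notation obj := (object (str C)).
Local Open Scope group_scope.

Definition unit_obj : obj := Object 1 (sunit C).
Definition tens_obj (U V : obj) : obj := Object (ograde U * ograde V) (stens U V).
Definition conj_obj (g : G) (U : obj) : obj :=
  Object (g * ograde U * g^-1) (sconj g U).

Definition is_hom (U V : obj) (f : U -> V) : Prop :=
  [/\ ograde U = ograde V, linear f, forall u, f (xi U u) = xi V (f u) & smorph f].

Record well_defined : Prop := WellDefined {
  wd_id : forall U, good U -> is_hom (U := U) (V := U) id;
  wd_comp : forall (U V W : obj) (g : V -> W) (f : U -> V),
    good U -> good V -> good W -> is_hom g -> is_hom f ->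
    is_hom (U := U) (V := W) (g \o f);
  wd_unit : good unit_obj;
  wd_tens : forall U V, good U -> good V -> good (tens_obj U V);
  wd_tmap : forall (U U' V V' : obj) (f : U -> U') (g : V -> V'),
    good U -> good U' -> good V -> good V' -> is_hom f -> is_hom g ->
    is_hom (U := tens_obj U V) (V := tens_obj U' V') (tmap f g);
  wd_assoc : forall U V W, good U -> good V -> good W ->
    is_hom (U := tens_obj (tens_obj U V) W) (V := tens_obj U (tens_obj V W))
      (@hassoc k U V W);
  wd_assocV : forall U V W, good U -> good V -> good W ->
    is_hom (U := tens_obj U (tens_obj V W)) (V := tens_obj (tens_obj U V) W)
      (@hassocV k U V W);
  wd_lunit : forall U, good U ->
    is_hom (U := tens_obj unit_obj U) (V := U) (@hlunit k U);
  wd_runit : forall U, good U ->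
    is_hom (U := tens_obj U unit_obj) (V := U) (@hrunit k U);
  wd_conj : forall g U, good U -> good (conj_obj g U);
  wd_conj_hom : forall g (U V : obj) (f : U -> V), good U -> good V -> is_hom f ->
    is_hom (U := conj_obj g U) (V := conj_obj g V) f;
  wd_braid : forall U V, good U -> good V ->
    is_hom (U := tens_obj U V) (V := tens_obj (conj_obj (ograde U) V) U)
      (@sbraid C U V) }.

Hypothesis wd : well_defined.

Definition sob := {U : obj | good U}.
Definition shom (U V : sob) := {f : sval U -> sval V | is_hom f}.

Definition tcat_of : tcatData G := @TCatData G sob shom
  (fun U => exist _ _ (wd_id wd (svalP U)))
  (fun U V W g f =>
     exist _ _ (wd_comp wd (svalP U) (svalP V) (svalP W) (svalP g) (svalP f)))
  (fun U V => exist _ _ (wd_tens wd (svalP U) (svalP V)))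
  (fun U U' V V' f g => exist _ _
     (wd_tmap wd (svalP U) (svalP U') (svalP V) (svalP V') (svalP f) (svalP g)))
  (exist _ _ (wd_unit wd))
  (fun U V W => exist _ _ (wd_assoc wd (svalP U) (svalP V) (svalP W)))
  (fun U V W => exist _ _ (wd_assocV wd (svalP U) (svalP V) (svalP W)))
  (fun U => exist _ _ (wd_lunit wd (svalP U)))
  (fun U => exist _ _ (wd_runit wd (svalP U)))
  (fun U => ograde (sval U))
  (fun g U => exist _ _ (wd_conj wd g (svalP U)))
  (fun g U V f => exist _ _ (wd_conj_hom wd g (svalP U) (svalP V) (svalP f)))
  (fun U V => exist _ _ (wd_braid wd (svalP U) (svalP V))).

End Structured.

Section YetterDrinfeld.
Variables (k : fieldType) (V : lmodType k) (H : homHopf V) (Sinv : V -> V).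
Local Notation G := (autPair H).

Record ydStr (M : homSpace k) := YDStr {
  yact : V -> M -> M;
  yrho : M -> tensor M V }.

Definition is_YD (M : object G ydStr) : Prop :=
  let a := al (ograde M) in let b := be (ograde M) in
  let act := yact (ostr M) in let rho := yrho (ostr M) in
  [/\ is_homModule H act, is_homComodule H rho
    & forall h m, rho (act h m) =
        \tsum_(h1, h2 <- delta H h) \tsum_(h21, h22 <- delta H h2)
        \tsum_(m0, m1 <- rho m)
          tens (act (xi H h21) m0)
               (amul H (amul H (b h22) (xiV H m1)) (a (Sinv h1)))].

Definition is_YDmorph (M N : object G ydStr) (f : M -> N) : Prop :=
  (forall h m, f (yact (ostr M) h m) = yact (ostr N) h (f m)) /\
  (forall m, yrho (ostr N) (f m) = \tsum_(m0, m1 <- yrho (ostr M) m) tens (f m0) m1).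

Definition yd_unit : ydStr (hunit k) :=
  @YDStr (hunit k) (fun h c => eps H h *: c) (fun c => tens c (aone H)).

Definition yd_tens (M N : object G ydStr) : ydStr (htens M N) :=
  let b := be (ograde M) in let c := al (ograde N) in
  @YDStr (htens M N)
    (fun h t => \tsum_(m, n <- t) \tsum_(h1, h2 <- delta H h)
       tens (yact (ostr M) (c h1) m) (yact (ostr N) ((c^-1 * b * c)%g h2) n))
    (fun t => \tsum_(m, n <- t)
       \tsum_(m0, m1 <- yrho (ostr M) m) \tsum_(n0, n1 <- yrho (ostr N) n)
         tens (tens m0 n0) (amul H n1 m1)).

Definition yd_conj (g : G) (N : object G ydStr) : ydStr N :=
  let a := al g in let b := be g in let c := al (ograde N) in
  @YDStr N
    (fun h n => yact (ostr N) ((c^-1 * b * c * a^-1)%g h) n)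
    (fun n => \tsum_(n0, n1 <- yrho (ostr N) n) tens n0 ((a * b^-1)%g n1)).

Definition yd_braid (M N : object G ydStr) : htens M N -> htens N M :=
  fun t => \tsum_(m, n <- t) \tsum_(n0, n1 <- yrho (ostr N) n)
    tens (xi N n0) (yact (ostr M) ((be (ograde M))^-1%g n1) (xiV M m)).

Definition MHYD : structured k G :=
  @Structured k G ydStr is_YD is_YDmorph yd_unit yd_tens yd_conj yd_braid.

End YetterDrinfeld.

Section Double.
Variables (k : fieldType) (V : vectType k) (H : homHopf V) (Sinv : V -> V).
Local Notation G := (autPair H).
Local Notation dual := 'Hom(V, k^o).

(* f o u in the dual of V; [linfun] returns the given function when it is linear. *)
Definition dcomp (f : dual) (u : V -> V) : dual := linfun (fun h => f (u h)).

Lemma dcompE (f : dual) (u : V -> V) : linear u -> dcomp f u =1 f \o u.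
Proof.
move=> lu h; pose m := GRing.isLinear.Build k V k^o *:%R (fun h => f (u h))
  (fun c x y => etrans (congr1 f (lu c x y)) (linearP f c (u x) (u y))).
pose F : {linear V -> k^o} := HB.pack (fun h => f (u h)) m.
exact: (lfunE F).
Qed.

Lemma dcomp_linear (u : V -> V) : linear u -> linear (dcomp^~ u).
Proof.
move=> lu c f g; apply/lfunP => h.
by rewrite dcompE //= !add_lfunE !scale_lfunE !dcompE.
Qed.

Lemma dcompK (u v : V -> V) : linear u -> linear v -> cancel u v ->
  cancel (dcomp^~ v) (dcomp^~ u).
Proof. by move=> lu lv uK f; apply/lfunP => h; rewrite !dcompE //= dcompE //= uK. Qed.

Definition dualAut : homAut dual :=
  HomAut (dcomp_linear (xiV_lin H))
    (dcompK (xi_lin H) (xiV_lin H) (xiK H))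
    (dcompK (xiV_lin H) (xi_lin H) (xiVK H)).

Lemma linfunE (u : V -> k^o) : linear u -> (linfun u : dual) =1 u.
Proof.
move=> lu; pose m := GRing.isLinear.Build k V k^o *:%R u lu.
pose F : {linear V -> k^o} := HB.pack u m.
exact: (lfunE F).
Qed.

Definition deps : dual := linfun (eps H : V -> k^o).
Definition dual_mul (f g : dual) : dual :=
  linfun (fun h => (\tsum_(h1, h2 <- delta H h) (f h1 * g h2 : k^o)) : k^o).

Definition ebase (i : 'I_(\dim {:V})) : V := (vbasis {:V})`_i.
Definition edual (i : 'I_(\dim {:V})) : dual := linfun (coord (vbasis {:V}) i : V -> k^o).

Definition dual_delta (f : dual) : tensor dual dual :=
  \sum_i \sum_j (f (amul H (ebase i) (ebase j)) : k) *: tens (edual i) (edual j).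

Lemma dual_mulE (f g : dual) h :
  dual_mul f g h = \tsum_(h1, h2 <- delta H h) (f h1 * g h2 : k^o).
Proof.
rewrite linfunE // => c x y; rewrite delta_lin tfold_linear //.
split=> [n a u v | n a u v]; rewrite linearP.
  by rewrite mulrDl -scalerAl.
by rewrite mulrDr -scalerAr.
Qed.

Lemma dual_deltaE (f : dual) h l :
  \tsum_(f1, f2 <- dual_delta f) ((f1 : dual) h * (f2 : dual) l : k^o) =
  f (amul H h l).
Proof.
have [ml mr] := amul_bilin (hopf_algP H).
pose F := fun f1 f2 : dual => (f1 h * f2 l : k^o).
have bF : bilin F.
  split=> [n a u v | n a u v]; rewrite /F add_lfunE scale_lfunE.
    by rewrite mulrDl -scalerAl.
  by rewrite mulrDr -scalerAr.
pose TF : {linear tensor dual dual -> k^o} :=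
  HB.pack (tfold F) (GRing.isLinear.Build k _ k^o *:%R _ (tfold_linear bF)).
have coordE (v : V) i : edual i v = coord (vbasis {:V}) i v.
  by rewrite linfunE // => c x y; rewrite linearD linearZ.
pose Ml (b : V) : {linear V -> V} :=
  HB.pack ((amul H)^~ b) (GRing.isLinear.Build k V V *:%R _ (ml b)).
pose Mr (a : V) : {linear V -> V} :=
  HB.pack (amul H a) (GRing.isLinear.Build k V V *:%R _ (mr a)).
have TFE t : tfold F t = TF t by [].
have MlE a b : amul H a b = Ml b a by [].
have MrE a b : amul H a b = Mr a b by [].
clearbody TF Ml Mr; rewrite TFE linear_sum {1}(coord_vbasis (memvf h)) MlE !linear_sum.
apply: eq_bigr => i _; rewrite !linearZ -MlE MrE.
rewrite {1}(coord_vbasis (memvf l)) !linear_sum /= scaler_sumr.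
apply: eq_bigr => j _; rewrite !linearZ /=.
rewrite -TFE -MrE tfold_tens // /F !coordE.
by rewrite /GRing.scale /= mulrC -mulrA mulrCA.
Qed.

Definition harpl (h : V) (f : dual) : dual :=
  \tsum_(f1, f2 <- dual_delta f)
    (((f2 : dual) (xiV H h) : k) *: dcomp f1 (fun l => xiV H (xiV H l))).
Definition harpr (f : dual) (h : V) : dual :=
  \tsum_(f1, f2 <- dual_delta f)
    (((f1 : dual) (xiV H h) : k) *: dcomp f2 (fun l => xiV H (xiV H l))).

Definition mhd : lmodType k := tensor dual V.

Definition mhd_mul (g : G) (x y : mhd) : mhd :=
  \tsum_(f, h <- x) \tsum_(f', l <- y)
  \tsum_(h1, h2 <- delta H h) \tsum_(h21, h22 <- delta H h2)
    tens (dual_mul f (harpl (al g h1)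
            (harpr (dcomp f' (fun z => xi H (xi H z))) (Sinv (be g h22)))))
         (amul H (xi H (xi H h21)) l).

Definition MHD (g : G) : homAlg mhd :=
  HomAlg (tensorAut dualAut H) (mhd_mul g) (tens deps (aone H)).


Definition mhd_delta (g g' : G) (x : mhd) : tensor mhd mhd :=
  let b := be g in let c := al g' in
  \tsum_(f, h <- x) \tsum_(f1, f2 <- dual_delta f) \tsum_(h1, h2 <- delta H h)
    tens (tens f2 (c h1)) (tens f1 ((c^-1 * b * c)%g h2)).

Definition mhd_eps (x : mhd) : k :=
  (\tsum_(f, h <- x) (eps H h * (f : dual) (aone H) : k^o)) : k^o.

Definition mhd_conj (g g' : G) (x : mhd) : mhd :=
  let a := al g in let b := be g in let c := al g' in
  tmap (dcomp^~ (b * a^-1)%g) (a * c^-1 * b^-1 * c)%g x.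
Definition mhd_conjV (g g' : G) (x : mhd) : mhd :=
  let a := al g in let b := be g in let c := al g' in
  tmap (dcomp^~ (a * b^-1)%g) (c^-1 * b * c * a^-1)%g x.

Lemma mhd_conjVK (g g' : G) : cancel (mhd_conjV g g') (mhd_conj g g').
Proof.
move=> x; rewrite /mhd_conj /mhd_conjV.
rewrite tmap_comp; try exact/dcomp_linear/aut_lin/autP; try exact/aut_lin/autP.
apply: tmap_id; last by move=> h; rewrite /= !(autK, autVK).
by apply: dcompK; try exact/aut_lin/autP; move=> h; rewrite /= !(autK, autVK).
Qed.

Lemma mhd_conjK (g g' : G) : cancel (mhd_conj g g') (mhd_conjV g g').
Proof.
move=> x; rewrite /mhd_conj /mhd_conjV.
rewrite tmap_comp; try exact/dcomp_linear/aut_lin/autP; try exact/aut_lin/autP.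
apply: tmap_id; last by move=> h; rewrite /= !(autK, autVK).
by apply: dcompK; try exact/aut_lin/autP; move=> h; rewrite /= !(autK, autVK).
Qed.

Definition repStr (M : homSpace k) : Type := mhd -> M -> M.

Definition is_rep (U : object G repStr) : Prop :=
  is_homModule (MHD (ograde U)) (ostr U).

Definition is_repmorph (U W : object G repStr) (f : U -> W) : Prop :=
  forall x u, f (ostr U x u) = ostr W x (f u).

Definition rep_unit : repStr (hunit k) := fun x c => mhd_eps x *: c.

Definition rep_tens (U W : object G repStr) : repStr (htens U W) :=
  fun x t => \tsum_(u, w <- t) \tsum_(x1, x2 <- mhd_delta (ograde U) (ograde W) x)
    tens (ostr U x1 u) (ostr W x2 w).

Definition rep_conj (g : G) (W : object G repStr) : repStr W :=
  fun x w => ostr W (mhd_conjV g (ograde W) x) w.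

Definition rep_braid (U W : object G repStr) : htens U W -> htens W U :=
  fun t => \tsum_(u, w <- t) (\sum_i
    tens (ostr W (tens (dcomp (edual i) (xi H)) (aone H)) (xiV W w))
         (ostr U (tens deps ((be (ograde U))^-1%g (xiV H (ebase i)))) (xiV U u))).

Definition RepMHD : structured k G :=
  @Structured k G repStr is_rep is_repmorph rep_unit rep_tens rep_conj rep_braid.

End Double.

(* Main.v *)
Require Import Defs.
From mathcomp Require Import all_boot all_algebra.
From mathcomp Require Import boolp.

(** The category of representations of the double and the category of
    Yetter-Drinfeld Hom-modules are identified without changing spaces or maps:
    a Yetter-Drinfeld module carries the action (f >< h) . u = f((h u)_1) (h u)_0
    of H* >< H, and conversely an action of H* >< H restricts to H and gives the
    coaction u |-> sum_i (e^i . u) (x) e_i.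

    Untwisting.  The automorphism xi enters all axioms of the Hom-world, but it
    can be absorbed.  Put a ** b = xi^-1 (a b), replace the coproduct by
    (xi (x) xi) Delta, an action by xi^-1 (h . m), a coaction by (xi (x) xi) rho.
    Then H becomes an ordinary Hopf algebra of which xi is one more Hopf
    automorphism ([xiAut]), Hom-modules become ordinary modules ([homModuleP])
    and Hom-comodules ordinary comodules ([homComoduleP]), each with a compatible
    automorphism.  The compatibility condition of action and coaction becomes,
    after the antipode has been moved to the other side,
      (h_2 m)_0 (x) (h_2 m)_1 alpha(h_1) = h_1 m_0 (x) beta(h_2) m_1   ([ydP]).
    In this form no antipode occurs, so that the tensor product of two modules
    ([yd_tens_oyd]) and the colinearity of the braiding ([ohom_braid]) are
    handled by coassociativity and by the condition applied to h twisted by an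
    automorphism ([oyd_cond_aut]); for the braiding the antipode is needed only
    to find the inverse ([braidK], [braid_invK]).

    Categories.  All objects are spaces with a structure, and tensor products,
    constraints and conjugation act on the underlying spaces and maps in a fixed
    way.  The axioms of a braided T-category therefore reduce to the short list
    [is_braided_structure] of identities between structures and between linear
    maps ([tcat_braidedT]).

    Comparison.  The condition has a third form, solved for h m_0 (x) m_1
    ([yd_cond_mul_comm]), and this is exactly the commutation rule between H* and H
    that the product of the double expresses ([rep_of_omod], [yd_of_oyd]); that the
    two passages are mutually inverse and match tensor product, conjugation and
    braiding is a computation with dual bases.  An isomorphism of structures of
    this kind carries the braided T-structure from one side to the other and is
    itself an isomorphism of braided T-categories ([transport_braided_structure],
    [transport_isomorphic]), so that the axioms have to be verified directly only
    for Yetter-Drinfeld modules.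

    Identities between Sweedler sums are stated after applying an arbitrary
    multilinear map to them; they can then be used for rewriting inside larger
    sums, all of whose summands are shown multilinear by the tactic [lin]. *)

Set Implicit Arguments.
Unset Strict Implicit.
Unset Printing Implicit Defensive.

Import GRing.Theory.
Local Open Scope ring_scope.

(** * Multilinear Sweedler calculus *)

Section Calculus.
Variable k : fieldType.
Implicit Types M N P Q : lmodType k.

Lemma linear0E M N (f : M -> N) : linear f -> f 0 = 0.
Proof.
move=> lf; have := lf 1 0 0; rewrite scaler0 addr0 scale1r => e.
by apply: (addrI (f 0)); rewrite addr0 -e.
Qed.

Lemma linearDE M N (f : M -> N) x y : linear f -> f (x + y) = f x + f y.
Proof. by move=> lf; have := lf 1 x y; rewrite !scale1r. Qed.

Lemma linearZE M N (f : M -> N) c x : linear f -> f (c *: x) = c *: f x.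
Proof. by move=> lf; have := lf c x 0; rewrite !addr0 (linear0E lf) addr0. Qed.

Lemma linear_sumE M N (f : M -> N) I (r : seq I) (p : pred I) (F : I -> M) :
  linear f -> f (\sum_(i <- r | p i) F i) = \sum_(i <- r | p i) f (F i).
Proof.
move=> lf; apply: (big_morph f) => [x y|]; [exact: linearDE | exact: linear0E].
Qed.

Lemma eq_tfold M N P (f g : M -> N -> P) t :
  (forall m n, f m n = g m n) -> tfold f t = tfold g t.
Proof. by move=> e; rewrite /tfold /sum_pairs; apply: eq_bigr => p _. Qed.

(** A Sweedler sum is literally a finite sum over a chosen decomposition of the
    tensor, so that linear maps pass through it whatever the summand is;
    bilinearity of the summand matters only where the decomposition changes. *)
Lemma linear_tfold M N P Q (f : P -> Q) (F : M -> N -> P) t : linear f ->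
  f (tfold F t) = \tsum_(m, n <- t) f (F m n).
Proof. by move=> lf; rewrite /tfold /sum_pairs linear_sumE. Qed.

Lemma tfold_tfold M N M' N' P (F : M -> N -> P) (G : M' -> N' -> tensor M N) t :
  bilin F -> tfold F (tfold G t) = \tsum_(m, n <- t) tfold F (G m n).
Proof. by move=> bF; apply: linear_tfold; apply: tfold_linear. Qed.

Lemma exchange_tfold M N M' N' P (F : M -> N -> M' -> N' -> P) s t :
  \tsum_(m, n <- s) \tsum_(m', n' <- t) F m n m' n' =
  \tsum_(m', n' <- t) \tsum_(m, n <- s) F m n m' n'.
Proof. exact: exchange_big. Qed.

Lemma tfold_tmap M N M' N' P (F : M' -> N' -> P) (f : M -> M') (g : N -> N') t :
  bilin F -> linear f -> linear g ->
  tfold F (tmap f g t) = \tsum_(m, n <- t) F (f m) (g n).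
Proof.
move=> bF lf lg; rewrite /tmap tfold_tfold //.
by apply: eq_tfold => m n; rewrite tfold_tens.
Qed.

Definition trilin M N P Q (F : M -> N -> P -> Q) : Prop :=
  (forall n p, linear (fun m => F m n p)) /\
  (forall m p, linear (fun n => F m n p)) /\
  (forall m n, linear (F m n)).

(** The lemmas named [lin_] are stated for functions of one variable with the
    variable inside an inner linear expression [E], the shape in which the
    tactic [lin] below meets them. *)
Lemma lin_id M : linear (fun x : M => x). Proof. by []. Qed.

Lemma linear_id M : linear (@id M). Proof. by []. Qed.

Lemma lin_comp M N P (f : N -> P) (E : M -> N) :
  linear f -> linear E -> linear (fun x => f (E x)).
Proof. by move=> lf lE c x y; rewrite lE lf. Qed.

Lemma lin_bil_l M N P Q (f : M -> N -> P) (E : Q -> M) c :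
  bilin f -> linear E -> linear (fun x => f (E x) c).
Proof. by move=> bf; apply: lin_comp (bf.1 c). Qed.

Lemma lin_bil_r M N P Q (f : M -> N -> P) (E : Q -> N) c :
  bilin f -> linear E -> linear (fun x => f c (E x)).
Proof. by move=> bf; apply: lin_comp (bf.2 c). Qed.

Lemma lin_tri1 M N P Q Q' (f : M -> N -> P -> Q) (E : Q' -> M) b c :
  trilin f -> linear E -> linear (fun x => f (E x) b c).
Proof. by case=> f1 _; apply: (lin_comp (f := fun y => f y b c)). Qed.

Lemma lin_tri2 M N P Q Q' (f : M -> N -> P -> Q) (E : Q' -> N) a c :
  trilin f -> linear E -> linear (fun x => f a (E x) c).
Proof. by case=> _ [f2 _]; apply: (lin_comp (f := fun y => f a y c)). Qed.

Lemma lin_tri3 M N P Q Q' (f : M -> N -> P -> Q) (E : Q' -> P) a b :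
  trilin f -> linear E -> linear (fun x => f a b (E x)).
Proof. by case=> _ [_ f3]; apply: lin_comp. Qed.

Lemma lin_tens_l M N Q (E : Q -> M) (c : N) :
  linear E -> linear (fun x => tens (E x) c).
Proof. by apply: lin_bil_l; apply: tens_bilin. Qed.

Lemma lin_tens_r M N Q (E : Q -> N) (c : M) :
  linear E -> linear (fun x => tens c (E x)).
Proof. by apply: lin_bil_r; apply: tens_bilin. Qed.

Lemma lin_tfold_l M N P Q (F : Q -> M -> N -> P) t :
  (forall m n, linear (fun x => F x m n)) -> linear (fun x => tfold (F x) t).
Proof.
move=> lF c x y; rewrite /tfold /sum_pairs scaler_sumr -big_split /=.
by apply: eq_bigr => p _; rewrite lF.
Qed.

Lemma lin_tfold_r M N P Q (F : M -> N -> P) (T : Q -> tensor M N) :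
  bilin F -> linear T -> linear (fun x => tfold F (T x)).
Proof. by move=> bF; apply: lin_comp; apply: tfold_linear. Qed.

Lemma lin_tmap M N M' N' Q (f : M -> M') (g : N -> N') (T : Q -> tensor M N) :
  linear f -> linear g -> linear T -> linear (fun x => tmap f g (T x)).
Proof. by move=> lf lg; apply: lin_comp; apply: tmap_linear. Qed.

Lemma lin_scale_r M Q (E : Q -> M) (c : k) :
  linear E -> linear (fun x => c *: E x).
Proof. by move=> lE a x y; rewrite lE scalerDr !scalerA mulrC. Qed.

Lemma lin_scale_l M Q (E : Q -> k^o) (m : M) :
  linear E -> linear (fun x => (E x : k) *: m).
Proof. by move=> lE a x y; rewrite lE scalerDl -scalerA. Qed.

Lemma lin_mul_l Q (E : Q -> k^o) (c : k) :
  linear E -> linear (fun x => (E x * c : k^o)).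
Proof. by move=> lE a x y; rewrite lE mulrDl -scalerAl. Qed.

Lemma lin_mul_r Q (E : Q -> k^o) (c : k) :
  linear E -> linear (fun x => (c * E x : k^o)).
Proof. by move=> lE a x y; rewrite lE mulrDr /GRing.scale /= mulrCA. Qed.

Lemma lin_sum M Q I (r : seq I) (p : pred I) (E : I -> Q -> M) :
  (forall i, linear (E i)) -> linear (fun x => \sum_(i <- r | p i) E i x).
Proof.
move=> lE a x y; rewrite scaler_sumr -big_split /=.
by apply: eq_bigr => i _; rewrite lE.
Qed.

End Calculus.

Create HintDb lindb.
#[export] Hint Resolve lin_id linear_id tens_bilin tfold_linear tmap_linear : lindb.
#[export] Hint Resolve xi_lin xiV_lin : lindb.

(** Redefined below to let [lin] descend into further operations. *)
Ltac lin_ext := fail.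

(** In a pattern such as [?f (@?E lin_var)] the head may mention the bound
    variable; it is then ill-scoped outside the binder and its elaboration
    fails. *)
Ltac closed_term t := let t' := constr:(t) in idtac.

Ltac lin_atom := solve [assumption | auto 3 with lindb nocore].

(** Proves linearity, bilinearity and trilinearity of Sweedler expressions by
    recursion on the expression. The outermost operation is found by matching
    under the binder; if the variable occurs in one argument, the matching lemma
    continues with that argument, and a curried function is peeled from its last
    argument. *)
Ltac lin :=
  cbv beta delta [ssrfun.comp];
  lazymatch goal with
  | |- bilin _ => first [lin_atom | split; [intro; lin | intro; lin]]
  | |- trilin _ => split; [lin | split; lin]
  | |- forall _, _ => intro; lin
  | |- GRing.linear_for _ (fun lin_var => lin_var) => exact: lin_id
  | |- GRing.linear_for _ (fun lin_var => tfold _ (@?T lin_var)) =>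
      lazymatch T with
      | (fun _ => ?T') => apply: lin_tfold_l; intros; lin
      | _ => refine (lin_tfold_r (T := T) _ _); lin
      end
  | |- GRing.linear_for _ (fun lin_var => tens (@?E lin_var) (@?F lin_var)) =>
      lazymatch F with
      | (fun _ => ?c) => refine (lin_tens_l (E := E) c _); lin
      | _ => refine (lin_tens_r (E := F) _ _); lin
      end
  | |- GRing.linear_for _ (fun lin_var => tmap _ _ (@?T lin_var)) =>
      refine (lin_tmap (T := T) _ _ _); lin
  | |- GRing.linear_for _ (fun lin_var => @?E lin_var *: @?F lin_var) =>
      lazymatch F with
      | (fun _ => ?c) => refine (lin_scale_l (E := E) c _); lin
      | _ => refine (lin_scale_r (E := F) _ _); lin
      end
  | |- GRing.linear_for _ (fun lin_var => @?E lin_var * @?F lin_var) =>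
      lazymatch F with
      | (fun _ => ?c) => refine (lin_mul_l (E := E) c _); lin
      | _ => refine (lin_mul_r (E := F) _ _); lin
      end
  | |- GRing.linear_for _ (fun lin_var => \sum_(i <- _ | _) _) =>
      apply: lin_sum; intros; lin
  | |- GRing.linear_for _ (fun lin_var => ?f (@?E lin_var)) =>
      tryif closed_term f then
        first [lin_ext
          | refine (lin_comp (f := f) (E := E) _ _); [lin_atom | lin]
          | lazymatch f with ?g ?c =>
              refine (lin_bil_r (f := g) (E := E) c _ _); [lin_atom | lin] end
          | lazymatch f with ?g ?a ?b =>
              refine (lin_tri3 (f := g) (E := E) a b _ _); [lin_atom | lin] end]
      else
        first [lin_ext
          | lazymatch goal with
            | |- GRing.linear_for _ (fun lin_var => ?g (@?E' lin_var) (@?c lin_var)) =>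
              lazymatch c with (fun _ => ?c') =>
                first [refine (lin_bil_l (f := g) (E := E') c' _ _); [lin_atom | lin]
                  | lazymatch g with ?h ?a =>
                      refine (lin_tri2 (f := h) (E := E') a c' _ _);
                      [lin_atom | lin] end] end
            end
          | lazymatch goal with
            | |- GRing.linear_for _
                   (fun lin_var => ?g (@?E' lin_var) (@?b lin_var) (@?c lin_var)) =>
              lazymatch b with (fun _ => ?b') =>
              lazymatch c with (fun _ => ?c') =>
                refine (lin_tri1 (f := g) (E := E') b' c' _ _);
                [lin_atom | lin] end end
            end]
  | |- GRing.linear_for _ (fun lin_var => _) => first [lin_ext | lin_atom]
  | |- GRing.linear_for ?s ?f =>
      first [lin_atom
        | let E := eval cbv beta in (fun lin_var => f lin_var) in
          change (GRing.linear_for s E); lin]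
  end.

(** * The underlying ordinary Hopf algebra *)

Lemma lin_eps (k : fieldType) (V Q : lmodType k) (H : homHopf V) (E : Q -> V) :
  linear E -> linear (fun x => eps H (E x) : k^o).
Proof. by move=> lE c x y; rewrite lE eps_lin. Qed.

Ltac lin_ext ::=
  lazymatch goal with
  | |- GRing.linear_for _ (fun lin_var => eps _ _) =>
      apply: lin_eps; lin
  end.

Section Ordinary.
Variables (k : fieldType) (V : lmodType k) (H : homHopf V).

Definition omul (a b : V) : V := xiV H (amul H a b).
(** Locked, since it would otherwise be unfolded as a [tmap] by rewriting. *)
Definition ocop (h : V) : tensor V V := locked (tmap (xi H) (xi H) (delta H h)).
Local Notation "a ** b" := (omul a b) (at level 40, left associativity).
Local Notation one := (aone H).

Lemma xi_inj : injective (xi H). Proof. exact: can_inj (xiK H). Qed.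

Lemma amulE a b : amul H a b = xi H (a ** b).
Proof. by rewrite /omul xiVK. Qed.

Lemma deltaE h : delta H h = tmap (xiV H) (xiV H) (ocop h).
Proof. by rewrite /ocop -lock tmapK. Qed.

Lemma amul_bil : bilin (amul H).
Proof. exact: amul_bilin (hopf_algP H). Qed.

Lemma omul_bilin : bilin omul.
Proof.
have b := amul_bil; rewrite /omul; lin.
Qed.

Lemma ocop_linear : linear ocop.
Proof. have l := delta_lin H; have e : ocop = fun h => tmap (xi H) (xi H) (delta H h).
  by apply: funext => h; rewrite /ocop -lock.
by rewrite e; lin. Qed.

Lemma autf_linear (f : hopfAut H) : linear f.
Proof. exact: aut_lin (autP f). Qed.

Lemma autV_linear (f : hopfAut H) : linear (autV f).
Proof. exact: (autf_linear f^-1%g). Qed.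

#[local] Hint Resolve omul_bilin ocop_linear autf_linear : lindb.

Lemma tfold_ocop (P : lmodType k) (F : V -> V -> P) h : bilin F ->
  tfold F (ocop h) = \tsum_(a, b <- delta H h) F (xi H a) (xi H b).
Proof. by move=> bF; rewrite /ocop -lock tfold_tmap //; apply: xi_lin. Qed.

Lemma tfold_delta (P : lmodType k) (F : V -> V -> P) h : bilin F ->
  tfold F (delta H h) = \tsum_(a, b <- ocop h) F (xiV H a) (xiV H b).
Proof.
move=> bF; rewrite tfold_ocop; last lin.
by apply: eq_tfold => a b; rewrite !xiK.
Qed.

Lemma is_hopfAut_xi : is_hopfAut H (xi H).
Proof.
split=> //.
- exact: xi_lin.
- exact: amul_xi (hopf_algP H).
- exact: aone_xi (hopf_algP H).
- exact: delta_xi.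
- exact: eps_xi.
- by move=> h; rewrite apode_xi.
Qed.

(** As a Hopf automorphism of the untwisted algebra, [xi] can be multiplied with
    the automorphisms of the grading group; this is how powers of [xi] are
    absorbed later. *)
Definition xiAut : hopfAut H := HopfAut is_hopfAut_xi (xiK H) (xiVK H).

Section Aut.
Variable f : hopfAut H.

Lemma autf_xi h : f (xi H h) = xi H (f h). Proof. exact: aut_xi (autP f) h. Qed.
Lemma autf_xiV h : f (xiV H h) = xiV H (f h).
Proof. by apply: xi_inj; rewrite -autf_xi !xiVK. Qed.
Lemma autf_mul a b : f (a ** b) = f a ** f b.
Proof. by rewrite /omul autf_xiV (aut_mul (autP f)). Qed.
Lemma autf_1 : f one = one. Proof. exact: aut_one (autP f). Qed.
Lemma autf_eps h : eps H (f h) = eps H h. Proof. exact: aut_eps (autP f) h. Qed.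
Lemma autf_apode h : f (apode H h) = apode H (f h).
Proof. exact: aut_apode (autP f) h. Qed.

Lemma ocop_aut (P : lmodType k) (F : V -> V -> P) h : bilin F ->
  tfold F (ocop (f h)) = \tsum_(a, b <- ocop h) F (f a) (f b).
Proof.
move=> bF; rewrite !tfold_ocop ?(aut_delta (autP f)) ?tfold_tmap //; try lin.
by apply: eq_tfold => a b; rewrite !autf_xi.
Qed.
End Aut.

Lemma ocop_autV (P : lmodType k) (F : V -> V -> P) (f : hopfAut H) h : bilin F ->
  tfold F (ocop (autV f h)) = \tsum_(a, b <- ocop h) F (autV f a) (autV f b).
Proof. exact: (@ocop_aut f^-1%g). Qed.
Lemma autV_mul (f : hopfAut H) a b : autV f (a ** b) = autV f a ** autV f b.
Proof. exact: (autf_mul f^-1%g). Qed.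
Lemma autV_1 (f : hopfAut H) : autV f one = one.
Proof. exact: (autf_1 f^-1%g). Qed.
Lemma autV_eps (f : hopfAut H) h : eps H (autV f h) = eps H h.
Proof. exact: (autf_eps f^-1%g). Qed.
Lemma autV_xi (f : hopfAut H) h : autV f (xi H h) = xi H (autV f h).
Proof. exact: (autf_xi f^-1%g). Qed.
Lemma autV_xiV (f : hopfAut H) h : autV f (xiV H h) = xiV H (autV f h).
Proof. exact: (autf_xiV f^-1%g). Qed.

Lemma xi_mul a b : xi H (a ** b) = xi H a ** xi H b.
Proof. exact: (autf_mul xiAut). Qed.
Lemma xiV_mul a b : xiV H (a ** b) = xiV H a ** xiV H b.
Proof. exact: (autf_mul xiAut^-1%g). Qed.
Lemma xi_1 : xi H one = one. Proof. exact: (autf_1 xiAut). Qed.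
Lemma xiV_1 : xiV H one = one. Proof. exact: (autf_1 xiAut^-1%g). Qed.
Lemma xiV_eps h : eps H (xiV H h) = eps H h. Proof. exact: (autf_eps xiAut^-1%g). Qed.

Lemma ocop_xi (P : lmodType k) (F : V -> V -> P) h : bilin F ->
  tfold F (ocop (xi H h)) = \tsum_(a, b <- ocop h) F (xi H a) (xi H b).
Proof. exact: (@ocop_aut xiAut). Qed.
Lemma ocop_xiV (P : lmodType k) (F : V -> V -> P) h : bilin F ->
  tfold F (ocop (xiV H h)) = \tsum_(a, b <- ocop h) F (xiV H a) (xiV H b).
Proof. exact: (@ocop_aut xiAut^-1%g). Qed.

Lemma omulA a b c : a ** (b ** c) = a ** b ** c.
Proof.
have := amul_assoc (hopf_algP H) (xiV H a) (xiV H b) (xiV H c).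
by rewrite !amulE => /xi_inj; rewrite !xi_mul !xiVK.
Qed.

Lemma omul1r a : a ** one = a.
Proof. by rewrite /omul (amul_1r (hopf_algP H)) xiK. Qed.
Lemma omul1l a : one ** a = a.
Proof. by rewrite /omul (amul_1l (hopf_algP H)) xiK. Qed.

(** An equality of iterated coproducts would live in a threefold tensor product;
    tested against a trilinear map it can be rewritten under any sums. *)
Lemma ocoassoc (P : lmodType k) (F : V -> V -> V -> P) h : trilin F ->
  \tsum_(a, b <- ocop h) \tsum_(b1, b2 <- ocop b) F a b1 b2 =
  \tsum_(a, b <- ocop h) \tsum_(a1, a2 <- ocop a) F a1 a2 b.
Proof.
move=> tF; have ld := delta_lin H.
pose x2 a := xi H (xi H a); have x2l : linear x2 by rewrite /x2; lin.
have := congr1 (tfold (fun a => tfold (fun b c => F (x2 a) (x2 b) (x2 c))))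
  (delta_coassoc H h).
rewrite !tfold_tfold //; try lin.
move=> e; rewrite !tfold_ocop; try lin.
apply: (etrans _ (etrans e _)); apply: eq_tfold => a b.
- by rewrite tfold_tens ?ocop_xi ?tfold_ocop; try lin; rewrite /x2 ?xiVK.
- rewrite tfold_tfold ?ocop_xi ?tfold_ocop; try lin; apply: eq_tfold => c d.
  by rewrite !tfold_tens; try lin; rewrite /x2 ?xiVK.
Qed.

Lemma ocounit_l (P : lmodType k) (F : V -> P) h : linear F ->
  \tsum_(a, b <- ocop h) (eps H a *: F b) = F h.
Proof.
move=> lF; rewrite tfold_ocop; try lin.
rewrite -[h in RHS](xiVK H) -(delta_epsl H) linear_tfold ?linear_tfold; try lin.
apply: eq_tfold => a b.
by rewrite (linearZE _ _ (xi_lin H)) (linearZE _ _ lF) eps_xi.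
Qed.

Lemma ocounit_r (P : lmodType k) (F : V -> P) h : linear F ->
  \tsum_(a, b <- ocop h) (eps H b *: F a) = F h.
Proof.
move=> lF; rewrite tfold_ocop; try lin.
rewrite -[h in RHS](xiVK H) -(delta_epsr H) linear_tfold ?linear_tfold; try lin.
apply: eq_tfold => a b.
by rewrite (linearZE _ _ (xi_lin H)) (linearZE _ _ lF) eps_xi.
Qed.

Lemma ocop_mul (P : lmodType k) (F : V -> V -> P) h l : bilin F ->
  tfold F (ocop (h ** l)) = \tsum_(a, b <- ocop h) \tsum_(c, d <- ocop l)
    F (a ** c) (b ** d).
Proof.
move=> bF; have ba := amul_bil.
rewrite /omul ocop_xiV // tfold_ocop; try lin.
rewrite delta_mul tfold_tfold; try lin.
rewrite tfold_ocop; try lin.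
apply: eq_tfold => a b; rewrite tfold_tfold ?tfold_ocop; try lin.
apply: eq_tfold => c d; rewrite tfold_tens; try lin.
by rewrite !xiK -!(amul_xi (hopf_algP H)) !xiK.
Qed.

Lemma ocop_1 (P : lmodType k) (F : V -> V -> P) : bilin F ->
  tfold F (ocop one) = F one one.
Proof.
by move=> bF; rewrite tfold_ocop ?delta_1 ?tfold_tens ?xi_1 //; lin.
Qed.

Lemma eps_omul a b : eps H (a ** b) = eps H a * eps H b.
Proof. by rewrite /omul xiV_eps eps_mul. Qed.

Lemma apode_mull (P : lmodType k) (F : V -> P) h : linear F ->
  \tsum_(a, b <- ocop h) F (apode H a ** b) = eps H h *: F one.
Proof.
move=> lF; have lS := apode_lin H; rewrite tfold_ocop; try lin.
rewrite -(linearZE _ _ lF) -(apode_l H) linear_tfold //.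
by apply: eq_tfold => a b; rewrite apode_xi -xi_mul /omul xiVK.
Qed.

Lemma apode_mulr (P : lmodType k) (F : V -> P) h : linear F ->
  \tsum_(a, b <- ocop h) F (a ** apode H b) = eps H h *: F one.
Proof.
move=> lF; have lS := apode_lin H; rewrite tfold_ocop; try lin.
rewrite -(linearZE _ _ lF) -(apode_r H) linear_tfold //.
by apply: eq_tfold => a b; rewrite apode_xi -xi_mul /omul xiVK.
Qed.

Lemma apode_1 : apode H one = one.
Proof.
have := apode_mulr one (@lin_id k V); rewrite ocop_1; last first.
  by have lS := apode_lin H; lin.
by rewrite omul1l eps_1 scale1r.
Qed.

(** Uniqueness of convolution inverses: the sum of
    [S (a1 ** b1) ** (a2 ** b2) ** (S b3 ** S a3)] collapses to the left-hand
    side when its last two factors are contracted, and to the right-hand side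
    when its first two are. *)
Lemma apode_mul a b : apode H (a ** b) = apode H b ** apode H a.
Proof.
have lS := apode_lin H; set S := apode H in lS *.
(* a2 b2 S(b3) S(a3) contracts from the inside, b first. *)
have right W a' b' : \tsum_(a2, a3 <- ocop a') \tsum_(b2, b3 <- ocop b')
    (W ** (a2 ** b2) ** (S b3 ** S a3)) = eps H a' *: (eps H b' *: W).
  rewrite -[in RHS](omul1r W) -(@apode_mulr _ (fun x => eps H b' *: (W ** x))); last lin.
  apply: eq_tfold => a2 a3.
  rewrite -[a2 in RHS]omul1r omulA.
  rewrite -(@apode_mulr _ (fun x => W ** (a2 ** x) ** S a3)); last lin.
  by apply: eq_tfold => b2 b3; rewrite !omulA.
have left Z a' b' : \tsum_(a1, a2 <- ocop a') \tsum_(b1, b2 <- ocop b')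
    (S (a1 ** b1) ** (a2 ** b2) ** Z) = eps H a' *: (eps H b' *: Z).
  rewrite -(@ocop_mul _ (fun u v => S u ** v ** Z)); last lin.
  by rewrite (@apode_mull _ (fun x => x ** Z)) ?omul1l ?eps_omul ?scalerA; last lin.
transitivity (\tsum_(a1, a' <- ocop a) \tsum_(b1, b' <- ocop b)
  \tsum_(a2, a3 <- ocop a') \tsum_(b2, b3 <- ocop b')
    (S (a1 ** b1) ** (a2 ** b2) ** (S b3 ** S a3))).
- rewrite -(@ocounit_r _ (fun a => S (a ** b))); last lin.
  apply: eq_tfold => a1 a'.
  rewrite -(@ocounit_r _ (fun b => S (a1 ** b))) ?linear_tfold; try lin.
  by apply: eq_tfold => b1 b'; rewrite right.
- under eq_tfold => a1 a' do rewrite exchange_tfold.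
  rewrite ocoassoc; last lin.
  rewrite -[in RHS](@ocounit_l _ (fun a => S b ** S a)); last lin.
  apply: eq_tfold => a' a3.
  transitivity (\tsum_(b', b3 <- ocop b) \tsum_(a1, a2 <- ocop a')
     \tsum_(b1, b2 <- ocop b') (S (a1 ** b1) ** (a2 ** b2) ** (S b3 ** S a3))).
    rewrite [RHS]exchange_tfold; apply: eq_tfold => a1 a2.
    by rewrite ocoassoc; last lin.
  rewrite -[in RHS](@ocounit_l _ (fun b => S b ** S a3)) ?linear_tfold; try lin.
  by apply: eq_tfold => b' b3; rewrite left.
Qed.

Section SkewAntipode.
Variables (Sinv : V -> V) (SK : cancel (apode H) Sinv) (SinvK : cancel Sinv (apode H)).

Lemma skew_linear : linear Sinv.
Proof. by move=> c x y; apply: (can_inj SK); rewrite apode_lin !SinvK. Qed.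
#[local] Hint Resolve skew_linear : lindb.

Lemma skew_aut (f : hopfAut H) h : f (Sinv h) = Sinv (f h).
Proof. by apply: (can_inj SK); rewrite -autf_apode !SinvK. Qed.

(** The inverse of [S] is the antipode of the co-opposite Hopf algebra, because
    [S] reverses products. *)
Lemma skew_mull (P : lmodType k) (F : V -> P) h : linear F ->
  \tsum_(a, b <- ocop h) F (Sinv b ** a) = eps H h *: F one.
Proof.
move=> lF; have lS := apode_lin H.
have e : \tsum_(a, b <- ocop h) (Sinv b ** a) = eps H h *: one.
  apply: (can_inj SK); rewrite linear_tfold; last lin.
  rewrite (linearZE _ _ lS) apode_1 -(apode_mull _ (@lin_id k V)).
  by apply: eq_tfold => a b; rewrite apode_mul SinvK.
by rewrite -(linearZE _ _ lF) -e linear_tfold.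
Qed.

Lemma skew_mulr (P : lmodType k) (F : V -> P) h : linear F ->
  \tsum_(a, b <- ocop h) F (b ** Sinv a) = eps H h *: F one.
Proof.
move=> lF; have lS := apode_lin H.
have e : \tsum_(a, b <- ocop h) (b ** Sinv a) = eps H h *: one.
  apply: (can_inj SK); rewrite linear_tfold; last lin.
  rewrite (linearZE _ _ lS) apode_1 -(apode_mulr _ (@lin_id k V)).
  by apply: eq_tfold => a b; rewrite apode_mul SinvK.
by rewrite -(linearZE _ _ lF) -e linear_tfold.
Qed.

End SkewAntipode.
End Ordinary.

#[export] Hint Resolve omul_bilin ocop_linear autf_linear autV_linear apode_lin delta_lin : lindb.

(** * The monoidal Hom-category *)

Lemma xi_injM (k : fieldType) (M : homSpace k) : injective (xi M).
Proof. exact: can_inj (xiK M). Qed.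

Section Constraints.
Variable k : fieldType.
Implicit Types M N L : homSpace k.

Lemma xi_tens M N m n : xi (htens M N) (tens m n) = tens (xi M m) (xi N n).
Proof. by apply: tmap_tens; apply: xi_lin. Qed.

Lemma xiV_tens M N m n : xiV (htens M N) (tens m n) = tens (xiV M m) (xiV N n).
Proof. by apply: tmap_tens; apply: xiV_lin. Qed.

Lemma linear_eq_tens3 (A B C P : lmodType k) (f g : tensor (tensor A B) C -> P) :
  linear f -> linear g ->
  (forall a b c, f (tens (tens a b) c) = g (tens (tens a b) c)) -> f =1 g.
Proof.
move=> lf lg e; apply: linear_eq_tens => // s c; move: s.
by apply: linear_eq_tens => //; lin.
Qed.

Lemma linear_eq_tens3r (A B C P : lmodType k) (f g : tensor A (tensor B C) -> P) :
  linear f -> linear g ->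
  (forall a b c, f (tens a (tens b c)) = g (tens a (tens b c))) -> f =1 g.
Proof.
move=> lf lg e; apply: linear_eq_tens => // a s; move: s.
by apply: linear_eq_tens => //; lin.
Qed.

Lemma linear_eq_tens4 (A B C D P : lmodType k)
    (f g : tensor (tensor (tensor A B) C) D -> P) :
  linear f -> linear g ->
  (forall a b c d, f (tens (tens (tens a b) c) d) = g (tens (tens (tens a b) c) d)) ->
  f =1 g.
Proof.
move=> lf lg e; apply: linear_eq_tens => // s d; move: s.
by apply: linear_eq_tens3 => //; lin.
Qed.

Lemma hassoc_linear M N L : linear (@hassoc k M N L).
Proof. by rewrite /hassoc; lin. Qed.

Lemma hassocV_linear M N L : linear (@hassocV k M N L).
Proof. by rewrite /hassocV; lin. Qed.

Lemma hassocE M N L m n l :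
  @hassoc k M N L (tens (tens m n) l) = tens (xi M m) (tens n (xiV L l)).
Proof. by rewrite /hassoc !tfold_tens //; lin. Qed.

Lemma hassocVE M N L m n l :
  @hassocV k M N L (tens m (tens n l)) = tens (tens (xiV M m) n) (xi L l).
Proof. by rewrite /hassocV !tfold_tens //; lin. Qed.

Lemma hlunit_linear M : linear (@hlunit k M).
Proof. by rewrite /hlunit; lin. Qed.

Lemma hrunit_linear M : linear (@hrunit k M).
Proof. by rewrite /hrunit; lin. Qed.

Lemma hlunitE M (c : k^o) m : @hlunit k M (tens c m) = (c : k) *: xi M m.
Proof. by rewrite /hlunit tfold_tens //; lin. Qed.

Lemma hrunitE M (c : k^o) m : @hrunit k M (tens m c) = (c : k) *: xi M m.
Proof. by rewrite /hrunit tfold_tens //; lin. Qed.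

End Constraints.

#[export] Hint Resolve hassoc_linear hassocV_linear hlunit_linear hrunit_linear : lindb.

Section ConstraintInverses.
Variable k : fieldType.
Implicit Types M N L : homSpace k.

Lemma hassocK M N L : cancel (@hassoc k M N L) (@hassocV k M N L).
Proof.
apply: linear_eq_tens3; try lin.
by move=> m n l; rewrite hassocE hassocVE xiK xiVK.
Qed.

Lemma hassocVK M N L : cancel (@hassocV k M N L) (@hassoc k M N L).
Proof.
apply: linear_eq_tens3r; try lin.
by move=> m n l; rewrite hassocVE hassocE xiK xiVK.
Qed.

Lemma hlunitK M : cancel (@hlunit k M) (fun m => tens (1 : k^o) (xiV M m)).
Proof.
apply: linear_eq_tens; try lin.
move=> c m; rewrite hlunitE (linearZE _ _ (xiV_lin M)) xiK.
have [tl tr] := tens_bilin k^o M.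
rewrite (linearZE _ _ (tr _)) -(linearZE _ _ (tl _)).
by rewrite /GRing.scale /= mulr1.
Qed.

Lemma hlunitVK M : cancel (fun m => tens (1 : k^o) (xiV M m)) (@hlunit k M).
Proof. by move=> m; rewrite hlunitE xiVK scale1r. Qed.

Lemma hrunitK M : cancel (@hrunit k M) (fun m => tens (xiV M m) (1 : k^o)).
Proof.
apply: linear_eq_tens; try lin.
move=> m c; rewrite hrunitE (linearZE _ _ (xiV_lin M)) xiK.
have [tl tr] := tens_bilin M k^o.
rewrite (linearZE _ _ (tl _)) -(linearZE _ _ (tr _)).
by rewrite /GRing.scale /= mulr1.
Qed.

Lemma hrunitVK M : cancel (fun m => tens (xiV M m) (1 : k^o)) (@hrunit k M).
Proof. by move=> m; rewrite hrunitE xiVK scale1r. Qed.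

End ConstraintInverses.

(** * Braided T-categories of structured spaces *)

Section StructuredSpaces.
Variables (k : fieldType) (G : groupType) (C : structured k G).
Local Notation obj := (object G (str C)).
Local Open Scope group_scope.

Local Notation br U V := (@sbraid k G C U V).

(** What the axioms of a braided T-category ask for beyond [well_defined]. The
    axioms on composition, tensor products of maps and the constraints are
    identities of linear maps which hold in the monoidal Hom-category, so none
    of them appears here. *)
Record is_braided_structure : Prop := IsBraidedStructure {
  bs_conj_tens : forall g (U V : obj), good U -> good V ->
    sconj g (tens_obj U V) = stens (conj_obj g U) (conj_obj g V);
  bs_conj_unit : forall g, sconj g (unit_obj C) = sunit C;
  bs_conj_1 : forall U : obj, good U -> sconj 1 U = ostr U;
  bs_conj_M : forall g h (U : obj), good U ->
    sconj (g * h) U = sconj g (conj_obj h U);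
  bs_hom_inv : forall (U V : obj) (f : U -> V) (g : V -> U), good U -> good V ->
    is_hom f -> cancel f g -> cancel g f -> is_hom g;
  bs_braid_inv : forall U V : obj, good U -> good V ->
    exists2 c : htens V U -> htens U V, cancel (br U V) c & cancel c (br U V);
  bs_braid_nat : forall (U U' V V' : obj) (f : U -> U') (g : V -> V') t,
    good U -> good U' -> good V -> good V' -> is_hom f -> is_hom g ->
    tmap g f (br U V t) = br U' V' (tmap f g t);
  bs_braid_tobl : forall (U V W : obj) t, good U -> good V -> good W ->
    br (tens_obj U V) W t =
    @hassoc k W U V (tmap (br U (conj_obj (ograde V) W)) id
      (@hassocV k U W V (tmap id (br V W) (@hassoc k U V W t))));
  bs_braid_tobr : forall (U V W : obj) t, good U -> good V -> good W ->
    br U (tens_obj V W) t =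
    @hassocV k V W U (tmap id (br U W)
      (@hassoc k V U W (tmap (br U V) id (@hassocV k U V W t))));
  bs_conj_braid : forall g (U V : obj) t, good U -> good V ->
    br (conj_obj g U) (conj_obj g V) t = br U V t }.

Variable wd : well_defined C.

(** An arrow is determined by the grades and structures of its ends and by its
    underlying map, the proofs being irrelevant. The underlying spaces are taken
    to be the same on both sides, which avoids all casts; this suffices because
    conjugation and the comparison of categories preserve them. *)
Lemma arr_eq (M N : homSpace k) (g g' h h' : G) (s s' : str C M) (t t' : str C N)
    (p : good (Object g s)) (p' : good (Object g' s'))
    (q : good (Object h t)) (q' : good (Object h' t'))
    (f f' : M -> N) (Hf : is_hom (U := Object g s) (V := Object h t) f)
    (Hf' : is_hom (U := Object g' s') (V := Object h' t') f') :
  g = g' -> h = h' -> s = s' -> t = t' -> f =1 f' ->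
  arr (C := tcat_of wd) (U := exist _ _ p) (V := exist _ _ q) (exist _ f Hf) =
  arr (C := tcat_of wd) (U := exist _ _ p') (V := exist _ _ q') (exist _ f' Hf').
Proof.
move=> e1 e2 e3 e4 /funext e5; subst.
by rewrite (Prop_irrelevance p p') (Prop_irrelevance q q') (Prop_irrelevance Hf Hf').
Qed.

Lemma sob_eq (M : homSpace k) (g g' : G) (s s' : str C M)
    (p : good (Object g s)) (p' : good (Object g' s')) :
  g = g' -> s = s' -> exist (@good k G C) _ p = exist (@good k G C) _ p' :> sob C.
Proof. by move=> e1 e2; subst; rewrite (Prop_irrelevance p p'). Qed.

Lemma shom_eq (U V : sob C) (f g : shom U V) : sval f =1 sval g -> f = g.
Proof.
case: f g => f Hf [g Hg] /= /funext e; subst g.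
by rewrite (Prop_irrelevance Hf Hg).
Qed.

(** A structure on a tensor product depends on the whole factors, over which
    rewriting with an equation between structures is not well typed; replacing
    grade and structure over a fixed space is. *)
Lemma stens_congl (M : homSpace k) (g g' : G) (s s' : str C M) (V : obj) :
  g = g' -> s = s' -> stens (Object g s) V = stens (Object g' s') V.
Proof. by move=> -> ->. Qed.

Lemma stens_congr (M : homSpace k) (g g' : G) (s s' : str C M) (U : obj) :
  g = g' -> s = s' -> stens U (Object g s) = stens U (Object g' s').
Proof. by move=> -> ->. Qed.

Lemma homs_linear (U V : sob C) (f : shom U V) : linear (sval f).
Proof. by case: f => f []. Qed.

Lemma homs_xi (U V : sob C) (f : shom U V) m :
  sval f (xi (sval U) m) = xi (sval V) (sval f m).
Proof. by case: f => f []. Qed.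

Lemma homs_xiV (U V : sob C) (f : shom U V) m :
  sval f (xiV (sval U) m) = xiV (sval V) (sval f m).
Proof. by apply: xi_injM; rewrite -homs_xi !xiVK. Qed.

Hypothesis bs : is_braided_structure.

Lemma shom_iso (U V : sob C) (f : shom U V) (g : sval V -> sval U) :
  cancel (sval f) g -> cancel g (sval f) -> is_iso (C := tcat_of wd) f.
Proof.
move=> fK gK; have hg := bs_hom_inv bs (svalP U) (svalP V) (svalP f) fK gK.
by exists (exist _ g hg); split; apply: shom_eq.
Qed.

(** Everything is evaluated on pure tensors, where the powers of [xi] in the
    constraints cancel. *)
Lemma tcat_monoidal : is_monoidal (tcat_of wd).
Proof.
split.
- by move=> U V f; apply: shom_eq.
- by move=> U V f; apply: shom_eq.
- by move=> U V W X f g h; apply: shom_eq.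
- by move=> U V; apply: shom_eq => t /=; apply: tmap_id.
- move=> U U' U'' V V' V'' f f' g g'; apply: shom_eq => t /=.
  by rewrite tmap_comp //; apply: homs_linear.
- by move=> U V W; apply: shom_eq => t /=; apply: hassocK.
- by move=> U V W; apply: shom_eq => t /=; apply: hassocVK.
- move=> U U' V V' W W' f g h; apply: shom_eq => /=.
  have lf := homs_linear f; have lg := homs_linear g; have lh := homs_linear h.
  apply: linear_eq_tens3 => /=; try lin.
  move=> a b c; rewrite !(tmap_tens, hassocE) //; try lin.
  by rewrite homs_xi homs_xiV.
- by move=> U; apply: shom_iso; [apply: hlunitK | apply: hlunitVK].
- by move=> U; apply: shom_iso; [apply: hrunitK | apply: hrunitVK].
- move=> U V f; apply: shom_eq => /=; have lf := homs_linear f.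
  apply: linear_eq_tens => /=; try lin.
  by move=> c m; rewrite !(tmap_tens, hlunitE) // (linearZE _ _ lf) homs_xi.
- move=> U V f; apply: shom_eq => /=; have lf := homs_linear f.
  apply: linear_eq_tens => /=; try lin.
  by move=> m c; rewrite !(tmap_tens, hrunitE) // (linearZE _ _ lf) homs_xi.
- move=> U V W X; apply: shom_eq => /=.
  apply: linear_eq_tens4 => /=; try lin.
  move=> a b c d; rewrite !(hassocE, xi_tens, xiV_tens, tmap_tens); try lin.
  by rewrite ?xiK.
- move=> U V; apply: shom_eq => /=.
  apply: linear_eq_tens3 => /=; try lin.
  move=> a c b; rewrite !(tmap_tens, hassocE); try lin.
  rewrite hlunitE hrunitE xiVK.
  have [tl tr] := tens_bilin (sval U) (sval V).
  by rewrite (linearZE _ _ (tr _)) -(linearZE _ _ (tl _)).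
Qed.

Local Notation congl A B X :=
  (@stens_congl (ospace A) (ograde A) (ograde B) (ostr A) (ostr B) X _ _).
Local Notation congr A B X :=
  (@stens_congr (ospace A) (ograde A) (ograde B) (ostr A) (ostr B) X _ _).

Lemma conj_gradeM (g x y : G) : g * (x * y) * g^-1 = g * x * g^-1 * (g * y * g^-1).
Proof. by rewrite !mulgA mulgVK. Qed.

Lemma conj_tens3l g (U V W : obj) : good U -> good V -> good W ->
  sconj g (tens_obj (tens_obj U V) W) =
  stens (tens_obj (conj_obj g U) (conj_obj g V)) (conj_obj g W).
Proof.
move=> gU gV gW; rewrite bs_conj_tens //; last exact: wd_tens.
by refine (congl (conj_obj g (tens_obj U V)) (tens_obj (conj_obj g U) (conj_obj g V))
    (conj_obj g W)); [apply: conj_gradeM | apply: bs_conj_tens].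
Qed.

Lemma conj_tens3r g (U V W : obj) : good U -> good V -> good W ->
  sconj g (tens_obj U (tens_obj V W)) =
  stens (conj_obj g U) (tens_obj (conj_obj g V) (conj_obj g W)).
Proof.
move=> gU gV gW; rewrite bs_conj_tens //; last exact: wd_tens.
by refine (congr (conj_obj g (tens_obj V W)) (tens_obj (conj_obj g V) (conj_obj g W))
    (conj_obj g U)); [apply: conj_gradeM | apply: bs_conj_tens].
Qed.

Lemma conj_tens_unitl g (U : obj) : good U ->
  sconj g (tens_obj (unit_obj C) U) = stens (unit_obj C) (conj_obj g U).
Proof.
move=> gU; rewrite bs_conj_tens //; last exact: wd_unit.
by refine (congl (conj_obj g (unit_obj C)) (unit_obj C) (conj_obj g U));
  [rewrite /= mulg1 mulgV | apply: bs_conj_unit].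
Qed.

Lemma conj_tens_unitr g (U : obj) : good U ->
  sconj g (tens_obj U (unit_obj C)) = stens (conj_obj g U) (unit_obj C).
Proof.
move=> gU; rewrite bs_conj_tens //; last exact: wd_unit.
by refine (congr (conj_obj g (unit_obj C)) (unit_obj C) (conj_obj g U));
  [rewrite /= mulg1 mulgV | apply: bs_conj_unit].
Qed.

Lemma tcat_crossed : is_crossed (tcat_of wd).
Proof.
split.
- by move=> U V [f []].
- by [].
- by [].
- by move=> g U; apply: shom_eq.
- by move=> g U V W f f'; apply: shom_eq.
- move=> g U V; apply: sob_eq; first exact: conj_gradeM.
  exact: bs_conj_tens (svalP U) (svalP V).
- move=> g U U' V V' f f'; apply: arr_eq; try exact: conj_gradeM.
  + exact: bs_conj_tens (svalP U) (svalP V).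
  + exact: bs_conj_tens (svalP U') (svalP V').
  + by [].
- move=> g; apply: sob_eq; first by rewrite /= mulg1 mulgV.
  exact: bs_conj_unit.
- move=> g U V W; apply: arr_eq.
  + by rewrite /= !conj_gradeM.
  + by rewrite /= !conj_gradeM.
  + exact: conj_tens3l (svalP U) (svalP V) (svalP W).
  + exact: conj_tens3r (svalP U) (svalP V) (svalP W).
  + by [].
- move=> g U; apply: arr_eq => //.
  + by rewrite /= !mul1g.
  + exact: conj_tens_unitl (svalP U).
- move=> g U; apply: arr_eq => //.
  + by rewrite /= !mulg1.
  + exact: conj_tens_unitr (svalP U).
- move=> [[a M s] p]; apply: sob_eq; first by rewrite /= mul1g invg1 mulg1.
  exact: (bs_conj_1 bs p).
- move=> [[a M s] p] [[b N t] q] [f Hf].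
  apply: arr_eq; rewrite /= ?mul1g ?invg1 ?mulg1 //.
  + exact: (bs_conj_1 bs p).
  + exact: (bs_conj_1 bs q).
- move=> g h U; apply: sob_eq; first by rewrite /= invgM !mulgA.
  exact: bs_conj_M (svalP U).
- move=> g h U V f; apply: arr_eq; rewrite /= ?invgM ?mulgA //.
  + exact: bs_conj_M (svalP U).
  + exact: bs_conj_M (svalP V).
Qed.

Lemma tcat_braided : is_braided (tcat_of wd).
Proof.
split.
- move=> U V; have [c cK Kc] := bs_braid_inv bs (svalP U) (svalP V).
  by apply: (@shom_iso _ _ (braid U V : shom _ _) c).
- move=> U U' V V' f g.
  have eg : ograde (sval U) = ograde (sval U') by case: f => f [].
  apply: arr_eq => //.
  + by rewrite /= eg.
  + by rewrite /= eg.
  + by move=> t; apply: (bs_braid_nat bs t (svalP U) (svalP U') (svalP V) (svalP V')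
      (svalP f) (svalP g)).
- move=> U V W; apply: arr_eq => //.
  + by rewrite /= invgM !mulgA.
  + refine (congl (conj_obj (ograde (sval U) * ograde (sval V)) (sval W))
      (conj_obj (ograde (sval U)) (conj_obj (ograde (sval V)) (sval W)))
      (tens_obj (sval U) (sval V))); first by rewrite /= invgM !mulgA.
    exact: bs_conj_M (svalP W).
  + move=> t; exact: (bs_braid_tobl bs t (svalP U) (svalP V) (svalP W)).
- move=> U V W; apply: arr_eq => //.
  + by rewrite /= conj_gradeM.
  + refine (congl (conj_obj (ograde (sval U)) (tens_obj (sval V) (sval W)))
      (tens_obj (conj_obj (ograde (sval U)) (sval V))
        (conj_obj (ograde (sval U)) (sval W))) (sval U)); first exact: conj_gradeM.
    exact: bs_conj_tens (svalP V) (svalP W).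
  + move=> t; exact: (bs_braid_tobr bs t (svalP U) (svalP V) (svalP W)).
- move=> g U V; apply: arr_eq.
  + exact: conj_gradeM.
  + by rewrite /= !invgM invgK !mulgA !mulgVK.
  + exact: bs_conj_tens (svalP U) (svalP V).
  + have gV := wd_conj wd (ograde (sval U)) (svalP V).
    rewrite bs_conj_tens //; last exact: svalP U.
    refine (congl (conj_obj g (conj_obj (ograde (sval U)) (sval V)))
      (conj_obj (g * ograde (sval U) * g^-1) (conj_obj g (sval V)))
      (conj_obj g (sval U))); first by rewrite /= !invgM invgK !mulgA !mulgVK.
    apply: (etrans (esym (bs_conj_M bs _ _ (svalP V)))).
    by apply: (etrans _ (bs_conj_M bs _ _ (svalP V))); rewrite mulgVK.
  + by move=> t; rewrite [RHS](bs_conj_braid bs) //; [exact: svalP U | exact: svalP V].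
Qed.

Theorem tcat_braidedT : is_braidedT (tcat_of wd).
Proof. by split; [apply: tcat_monoidal | apply: tcat_crossed | apply: tcat_braided]. Qed.

End StructuredSpaces.

(** * Untwisted modules, comodules and Yetter-Drinfeld modules *)

Section Module.
Variables (k : fieldType) (A : lmodType k) (R : homAlg A) (M : homSpace k).

Definition oact (act : A -> M -> M) (x : A) (m : M) : M := xiV M (act x m).

Lemma actE act x m : act x m = xi M (oact act x m).
Proof. by rewrite /oact xiVK. Qed.

(** An ordinary module over the untwisted algebra with an automorphism
    compatible with that of the algebra. *)
Record is_omodule (act : A -> M -> M) : Prop := IsOModule {
  oact_bil : bilin (oact act);
  oact_mul : forall x y m,
    oact act (xiV R (amul R x y)) m = oact act x (oact act y m);
  oact_xi : forall x m, xi M (oact act x m) = oact act (xi R x) (xi M m);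
  oact_1 : forall m, oact act (aone R) m = m }.

Lemma homModuleP act : is_homModule R act <-> is_omodule act.
Proof.
split=> [[b ass ax a1]|[b mu ax a1]]; split.
- by rewrite /oact; lin.
- move=> x y m; rewrite /oact; congr (xiV M _); apply: xi_injM.
  by rewrite !ax !xiVK ass.
- by move=> x m; rewrite /oact -ax xiK xiVK.
- by move=> m; rewrite /oact a1 xiK.
- have e : act = fun x m => xi M (oact act x m).
    by apply: funext => x; apply: funext => m; rewrite -actE.
  by rewrite e; lin.
- move=> x y m; rewrite !(actE act) -ax; congr (xi M _).
  by rewrite -[amul R x y](xiVK R) -ax mu.
- by move=> x m; rewrite (actE act x) (actE act (xi R x)) ax.
- by move=> m; rewrite (actE act) a1.
Qed.

Lemma oact_xiV act x m : is_omodule act ->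
  xiV M (oact act x m) = oact act (xiV R x) (xiV M m).
Proof. by move=> mM; apply: xi_injM; rewrite (oact_xi mM) !xiVK. Qed.
End Module.

Section Comodule.
Variables (k : fieldType) (V : lmodType k) (H : homHopf V) (M : homSpace k).
Local Notation "a ** b" := (omul H a b) (at level 40, left associativity).

Definition oco (rho : M -> tensor M V) (m : M) : tensor M V :=
  locked (tmap (xi M) (xi H) (rho m)).

Section Convert.
Variables (P : lmodType k) (rho : M -> tensor M V) (F : M -> V -> P) (bF : bilin F).

Lemma tfold_oco m :
  tfold F (oco rho m) = \tsum_(m0, m1 <- rho m) F (xi M m0) (xi H m1).
Proof. by rewrite /oco -lock tfold_tmap //; apply: xi_lin. Qed.

Lemma tfold_rho m :
  tfold F (rho m) = \tsum_(m0, m1 <- oco rho m) F (xiV M m0) (xiV H m1).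
Proof.
rewrite /oco -lock tfold_tmap; try lin.
by apply: eq_tfold => a b; rewrite !xiK.
Qed.
End Convert.

(** Coassociativity and counit in the tested form of [ocoassoc]. *)
Record is_ocomodule (rho : M -> tensor M V) : Prop := IsOComodule {
  oco_linear : linear (oco rho);
  oco_coassoc : forall (P : lmodType k) (F : M -> V -> V -> P) m, trilin F ->
    \tsum_(m0, m1 <- oco rho m) \tsum_(a, b <- ocop H m1) F m0 a b =
    \tsum_(m0, m1 <- oco rho m) \tsum_(m00, m01 <- oco rho m0) F m00 m01 m1;
  oco_counit : forall (P : lmodType k) (F : M -> P) m, linear F ->
    \tsum_(m0, m1 <- oco rho m) (eps H m1 *: F m0) = F m;
  oco_xi : forall (P : lmodType k) (F : M -> V -> P) m, bilin F ->
    tfold F (oco rho (xi M m)) = \tsum_(m0, m1 <- oco rho m) F (xi M m0) (xi H m1) }.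

Lemma oco_xiV (P : lmodType k) (F : M -> V -> P) rho m :
  is_ocomodule rho -> bilin F ->
  tfold F (oco rho (xiV M m)) = \tsum_(m0, m1 <- oco rho m) F (xiV M m0) (xiV H m1).
Proof.
move=> cM bF; rewrite -[m in RHS](xiVK M) (oco_xi cM); try lin.
by apply: eq_tfold => a b; rewrite !xiK.
Qed.

Lemma homComoduleP rho : is_homComodule H rho <-> is_ocomodule rho.
Proof.
split=> [[lr ra rx re]|c]; split.
- have e : oco rho = fun m => tmap (xi M) (xi H) (rho m).
    by apply: funext => m; rewrite /oco -lock.
  by rewrite e; lin.
- move=> P F m tF; have ld := delta_lin H.
  pose x2 a := xi H (xi H a); have x2l : linear x2 by rewrite /x2; lin.
  pose y2 a := xi M (xi M a); have y2l : linear y2 by rewrite /y2; lin.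
  have lo : linear (oco rho).
    have e : oco rho = fun m => tmap (xi M) (xi H) (rho m).
      by apply: funext => n; rewrite /oco -lock.
    by rewrite e; lin.
  have := congr1 (tfold (fun a => tfold (fun b c => F (y2 a) (x2 b) (x2 c)))) (ra m).
  rewrite !tfold_tfold //; try lin.
  move=> e; rewrite !tfold_oco; try lin.
  apply: (etrans _ (etrans e _)); apply: eq_tfold => a b.
  + by rewrite tfold_tens ?ocop_xi ?tfold_ocop; try lin; rewrite /y2 ?xiVK.
  + rewrite tfold_tfold ?tfold_oco ?rx ?tfold_tmap; try lin; apply: eq_tfold => c d.
    by rewrite !tfold_tens; try lin; rewrite /x2 ?xiVK.
- move=> P F m lF; rewrite tfold_oco; try lin.
  rewrite -[m in RHS](xiVK M) -re linear_tfold ?linear_tfold; try lin.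
  apply: eq_tfold => a b.
  by rewrite (linearZE _ _ (xi_lin M)) (linearZE _ _ lF) eps_xi.
- move=> P F m bF; rewrite !tfold_oco; try lin.
  by rewrite rx tfold_tmap; try lin.
- have e : rho = fun m => tmap (xiV M) (xiV H) (oco rho m).
    by apply: funext => m; rewrite /oco -lock tmapK.
  by have lo := oco_linear c; rewrite e; lin.
- move=> m; have lo := oco_linear c; have ld := delta_lin H.
  have dE h : delta H h = \tsum_(a, b <- ocop H h) tens (xiV H a) (xiV H b).
    by rewrite [LHS]deltaE.
  have lr : linear rho.
    have e : rho = fun m => tmap (xiV M) (xiV H) (oco rho m).
      by apply: funext => n; rewrite /oco -lock tmapK.
    by rewrite e; lin.
  rewrite !(tfold_rho rho); try lin.
  transitivity (\tsum_(m0, m1 <- oco rho m) \tsum_(a, b <- ocop H m1)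
    tens (xiV M (xiV M m0)) (tens (xiV H (xiV H a)) (xiV H (xiV H b)))).
    apply: eq_tfold => m0 m1; rewrite dE ocop_xiV ?linear_tfold //; lin.
  rewrite (oco_coassoc c); last lin.
  apply: eq_tfold => m0 m1; rewrite (tfold_rho rho) ?(oco_xiV _ c) //; lin.
- move=> m; have lo := oco_linear c.
  rewrite [LHS]tensorE /tmap !(tfold_rho rho) ?(oco_xi c); try lin.
  by apply: eq_tfold => a b; rewrite !xiK !xiVK.
- move=> m; rewrite (tfold_rho rho); try lin.
  rewrite -[RHS](oco_counit c _ (xiV_lin M)).
  by apply: eq_tfold => a b; rewrite xiV_eps.
Qed.
End Comodule.

Section Compatibility.
Variables (k : fieldType) (V : lmodType k) (H : homHopf V) (Sinv : V -> V).
Hypotheses (SK : cancel (apode H) Sinv) (SinvK : cancel Sinv (apode H)).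
Local Notation "a ** b" := (omul H a b) (at level 40, left associativity).
Local Notation G := (autPair H).
Local Notation object := (object G (ydStr V)).

(** The antipode-free form of the condition is the one that passes to tensor
    products and conjugates by coassociativity alone. *)
Record is_oyd (a b : hopfAut H) (M : homSpace k) (s : ydStr V M) : Prop := IsOYD {
  oyd_mod : is_omodule H (yact s);
  oyd_comod : is_ocomodule H (yrho s);
  oyd_cond : forall (P : lmodType k) (F : M -> V -> P) h m, bilin F ->
    \tsum_(h1, h2 <- ocop H h) \tsum_(m0, m1 <- oco H (yrho s) (oact (yact s) h2 m))
      F m0 (m1 ** a h1) =
    \tsum_(h1, h2 <- ocop H h) \tsum_(m0, m1 <- oco H (yrho s) m)
      F (oact (yact s) h1 m0) (b h2 ** m1) }.

Section Equivalence.
Variables (a b : hopfAut H) (M : homSpace k) (s : ydStr V M).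
Local Notation act := (oact (yact s)).
Local Notation rho := (oco H (yrho s)).
Hypotheses (mM : is_omodule H (yact s)) (cM : is_ocomodule H (yrho s)).

Let lS := skew_linear SK SinvK.
Let bact := oact_bil mM.
Let lrho := oco_linear cM.

(** The powers of [xi] in the definition of a Yetter-Drinfeld Hom-module are
    those that untwisting removes. *)
Lemma yd_rhsE (P : lmodType k) (F : M -> V -> P) h m : bilin F ->
  \tsum_(h1, h2 <- delta H h) \tsum_(h21, h22 <- delta H h2)
  \tsum_(m0, m1 <- yrho s m)
    F (yact s (xi H h21) m0)
      (amul H (amul H (b h22) (xiV H m1)) (a (Sinv h1))) =
  \tsum_(h1, h2 <- ocop H h) \tsum_(h21, h22 <- ocop H h2)
  \tsum_(m0, m1 <- rho m) F (act h21 m0) (b h22 ** m1 ** a (Sinv h1)).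
Proof.
move=> bF; have ld := delta_lin H; have by0 : bilin (yact s).
  have e : yact s = fun x m => xi M (act x m).
    by apply: funext => x; apply: funext => n; rewrite /oact xiVK.
  by rewrite e; lin.
have ba := amul_bilin (hopf_algP H).
rewrite [RHS]tfold_ocop; try lin; apply: eq_tfold => h1 h2.
rewrite ocop_xi ?tfold_ocop; try lin; apply: eq_tfold => h21 h22.
rewrite tfold_oco; try lin; apply: eq_tfold => m0 m1.
rewrite -(oact_xi mM) xiVK !amulE !xi_mul xiVK !autf_xi.
by rewrite -(skew_aut SK SinvK (xiAut H)) autf_xi.
Qed.

Lemma tfold_rho_act (P : lmodType k) (F : M -> V -> P) h m : bilin F ->
  tfold F (yrho s (yact s h m)) = tfold F (rho (act h m)).
Proof.
move=> bF; rewrite (tfold_rho H (yrho s)) // (actE (yact s)) (oco_xi cM); last lin.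
by apply: eq_tfold => x y; rewrite !xiK.
Qed.

(** Three forms of the compatibility of action and coaction: solved for the
    coaction of [h m], free of the antipode, and solved for [h m_0 (x) m_1]. The
    first is the definition, the second is the one stable under the
    constructions below, and the third is the commutation rule of the double. *)
Definition yd_cond_skew : Prop :=
  forall (P : lmodType k) (F : M -> V -> P) h m, bilin F ->
    tfold F (rho (act h m)) =
    \tsum_(h1, h2 <- ocop H h) \tsum_(h21, h22 <- ocop H h2)
    \tsum_(m0, m1 <- rho m) F (act h21 m0) (b h22 ** m1 ** a (Sinv h1)).

Definition yd_cond_mul : Prop :=
  forall (P : lmodType k) (F : M -> V -> P) h m, bilin F ->
    \tsum_(h1, h2 <- ocop H h) \tsum_(m0, m1 <- rho (act h2 m)) F m0 (m1 ** a h1) =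
    \tsum_(h1, h2 <- ocop H h) \tsum_(m0, m1 <- rho m) F (act h1 m0) (b h2 ** m1).

Definition yd_cond_comm : Prop :=
  forall (P : lmodType k) (F : M -> V -> P) h m, bilin F ->
    \tsum_(m0, m1 <- rho m) F (act h m0) m1 =
    \tsum_(h1, h2 <- ocop H h) \tsum_(h21, h22 <- ocop H h2)
    \tsum_(m0, m1 <- rho (act h21 m)) F m0 (b (Sinv h22) ** m1 ** a h1).

(** One passes between the two by multiplying with [a h_1] on the right of the
    second leg or with [a (Sinv h_1)], and cancelling by [skew_mull] or
    [skew_mulr]. *)
Lemma yd_cond_skew_mul : yd_cond_skew <-> yd_cond_mul.
Proof.
split=> c P F h m bF.
- transitivity (\tsum_(x, q <- ocop H h) \tsum_(h1, p <- ocop H x)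
    \tsum_(q1, q2 <- ocop H q) \tsum_(m0, m1 <- rho m)
      F (act q1 m0) (b q2 ** m1 ** a (Sinv p ** h1))).
    rewrite -ocoassoc; last lin.
    apply: eq_tfold => h1 h2; rewrite c; last lin.
    apply: eq_tfold => p q; apply: eq_tfold => q1 q2; apply: eq_tfold => m0 m1.
    by rewrite autf_mul !omulA.
  rewrite -[RHS](@ocounit_l _ _ H _ (fun h => \tsum_(q1, q2 <- ocop H h)
    \tsum_(m0, m1 <- rho m) F (act q1 m0) (b q2 ** m1))); last lin.
  apply: eq_tfold => x q.
  rewrite (@skew_mull _ _ _ _ SK SinvK _ (fun z => \tsum_(q1, q2 <- ocop H q)
    \tsum_(m0, m1 <- rho m) F (act q1 m0) (b q2 ** m1 ** a z))); last lin.
  congr (_ *: _); apply: eq_tfold => q1 q2; apply: eq_tfold => m0 m1.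
  by rewrite autf_1 omul1r.
- transitivity (\tsum_(x, q2 <- ocop H h) \tsum_(p, q1 <- ocop H x)
    \tsum_(m0, m1 <- rho (act q2 m)) F m0 (m1 ** a (q1 ** Sinv p))).
    rewrite -[LHS](@ocounit_l _ _ H _ (fun h => tfold F (rho (act h m)))); last lin.
    apply: eq_tfold => x q2.
    rewrite (@skew_mulr _ _ _ _ SK SinvK _ (fun z =>
      \tsum_(m0, m1 <- rho (act q2 m)) F m0 (m1 ** a z))); last lin.
    congr (_ *: _); apply: eq_tfold => m0 m1.
    by rewrite autf_1 omul1r.
  rewrite -ocoassoc; last lin.
  apply: eq_tfold => p q.
  rewrite -(c _ (fun x y => F x (y ** a (Sinv p)))); last lin.
  apply: eq_tfold => q1 q2; apply: eq_tfold => m0 m1.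
  by rewrite autf_mul omulA.
Qed.

(** The same on the left of the second leg, with [b h_2] and [b (Sinv h_2)]. *)
Lemma yd_cond_mul_comm : yd_cond_mul <-> yd_cond_comm.
Proof.
split=> c P F h m bF.
- rewrite ocoassoc; last lin.
  transitivity (\tsum_(x1, y <- ocop H h) \tsum_(x2, h22 <- ocop H y)
    \tsum_(m0, m1 <- rho m) F (act x1 m0) (b (Sinv h22 ** x2) ** m1)).
    rewrite -[LHS](@ocounit_r _ _ H _ (fun h => \tsum_(m0, m1 <- rho m)
      F (act h m0) m1)); last lin.
    apply: eq_tfold => x1 y.
    rewrite (@skew_mull _ _ _ _ SK SinvK _ (fun z =>
      \tsum_(m0, m1 <- rho m) F (act x1 m0) (b z ** m1))); last lin.
    by congr (_ *: _); apply: eq_tfold => m0 m1; rewrite autf_1 omul1l.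
  rewrite ocoassoc; last lin.
  apply: eq_tfold => x h22.
  transitivity (\tsum_(h1, h21 <- ocop H x) \tsum_(m0, m1 <- rho m)
    F (act h1 m0) (b (Sinv h22) ** (b h21 ** m1))).
    by apply: eq_tfold => x1 x2; apply: eq_tfold => m0 m1; rewrite autf_mul omulA.
  rewrite -(c _ (fun m z => F m (b (Sinv h22) ** z))); last lin.
  by apply: eq_tfold => x1 x2; apply: eq_tfold => m0 m1; rewrite omulA.
- transitivity (\tsum_(x, h2 <- ocop H h) \tsum_(h1, y <- ocop H x)
    \tsum_(h21, h22 <- ocop H y) \tsum_(m0, m1 <- rho (act h21 m))
      F m0 (b (h2 ** Sinv h22) ** m1 ** a h1)); last first.
    apply: eq_tfold => x h2; rewrite (c _ (fun m z => F m (b h2 ** z))); last lin.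
    apply: eq_tfold => h1 y; apply: eq_tfold => h21 h22; apply: eq_tfold => m0 m1.
    by rewrite autf_mul !omulA.
  rewrite -ocoassoc; last lin.
  apply: eq_tfold => h1 z.
  rewrite -ocoassoc; last lin.
  rewrite -[LHS](@ocounit_r _ _ H _ (fun z => \tsum_(m0, m1 <- rho (act z m))
    F m0 (m1 ** a h1))); last lin.
  apply: eq_tfold => h21 w.
  rewrite (@skew_mulr _ _ _ _ SK SinvK _ (fun z =>
    \tsum_(m0, m1 <- rho (act h21 m)) F m0 (b z ** m1 ** a h1))); last lin.
  by congr (_ *: _); apply: eq_tfold => m0 m1; rewrite autf_1 omul1l.
Qed.

End Equivalence.

Lemma ydP (M : object) :
  is_YD Sinv M <-> is_oyd (al (ograde M)) (be (ograde M)) (ostr M).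
Proof.
set a := al _; set b := be _; set s := ostr M.
split=> [[/homModuleP mM /homComoduleP cM c]|[mM cM c]].
- split=> //; apply/(yd_cond_skew_mul a b mM cM) => P F h m bF.
  rewrite -tfold_rho_act // c -yd_rhsE // tfold_tfold //.
  apply: eq_tfold => h1 h2; rewrite tfold_tfold //.
  apply: eq_tfold => h21 h22; rewrite tfold_tfold //.
  by apply: eq_tfold => m0 m1; rewrite tfold_tens.
- have bt := @tens_bilin k M V.
  split; [exact/homModuleP | exact/homComoduleP | move=> h m].
  rewrite [LHS]tensorE tfold_rho_act // yd_rhsE //.
  by have /(yd_cond_skew_mul a b mM cM) -> := c.
Qed.

End Compatibility.

(** * Constructions on Yetter-Drinfeld modules *)

Section Constructions.
Variables (k : fieldType) (V : lmodType k) (H : homHopf V) (Sinv : V -> V).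
Hypotheses (SK : cancel (apode H) Sinv) (SinvK : cancel Sinv (apode H)).
Local Notation "a ** b" := (omul H a b) (at level 40, left associativity).
Local Notation G := (autPair H).
Local Notation object := (object G (ydStr V)).
Local Notation act M := (oact (yact (ostr M))).
Local Notation rho M := (oco H (yrho (ostr M))).
Local Notation oyd M := (is_oyd (al (ograde M)) (be (ograde M)) (ostr M)).

Lemma oyd_act_bilin (M : object) : oyd M -> bilin (yact (ostr M)).
Proof. by case=> /homModuleP [b _ _ _] _ _. Qed.
Lemma oyd_rho_linear (M : object) : oyd M -> linear (yrho (ostr M)).
Proof. by case=> _ /homComoduleP [b _ _ _] _. Qed.
Lemma oyd_oact_bilin (M : object) : oyd M -> bilin (act M).
Proof. by case=> [[]]. Qed.
Lemma oyd_oco_linear (M : object) : oyd M -> linear (rho M).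
Proof. by case=> _ []. Qed.

(** The condition at [f h], expanded by means of the compatibility of [f] with
    the coproduct. In the constructions below [f] collects the automorphisms by
    which [h] is twisted before it acts, powers of [xi] included. *)
Lemma oyd_cond_aut (M : object) (f : hopfAut H) (P : lmodType k)
    (F : M -> V -> P) h m : oyd M -> bilin F ->
  \tsum_(h1, h2 <- ocop H h) \tsum_(m0, m1 <- rho M (act M (f h2) m))
    F m0 (m1 ** al (ograde M) (f h1)) =
  \tsum_(h1, h2 <- ocop H h) \tsum_(m0, m1 <- rho M m)
    F (act M (f h1) m0) (be (ograde M) (f h2) ** m1).
Proof.
move=> yM bF; have l := oyd_oco_linear yM; have b := oyd_oact_bilin yM.
have := oyd_cond yM (f h) m bF; rewrite !ocop_aut //; lin.
Qed.

Section Tensor.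
Variables (M N : object) (yM : oyd M) (yN : oyd N).
Let lM := oyd_oco_linear yM. Let lN := oyd_oco_linear yN.
Let bM := oyd_oact_bilin yM. Let bN := oyd_oact_bilin yN.
Let lM' := oyd_rho_linear yM. Let lN' := oyd_rho_linear yN.
Let bM' := oyd_act_bilin yM. Let bN' := oyd_act_bilin yN.

Local Notation MN := (Object (ograde M * ograde N)%g (yd_tens M N)).
Local Notation c := (al (ograde N)).
Local Notation B := ((al (ograde N))^-1 * be (ograde M) * al (ograde N))%g.

(** The [xi] of the spaces cancel; the [xi^-1] in the action and the [xi] in the
    coaction come from untwisting the coproduct and the product of H. *)
Lemma yd_tens_act h (t : htens M N) :
  act MN h t = \tsum_(m, n <- t) \tsum_(h1, h2 <- ocop H h)
    tens (act M (c (xiV H h1)) m) (act N (B (xiV H h2)) n).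
Proof.
have lc := autf_linear c; have lB := autf_linear B; have ld := delta_lin H.
rewrite /oact /= linear_tfold; last by apply: tmap_linear; apply: xiV_lin.
apply: eq_tfold => m n; rewrite linear_tfold; last by apply: tmap_linear; apply: xiV_lin.
rewrite tfold_ocop; last lin.
apply: eq_tfold => h1 h2; rewrite tmap_tens ?xiK //; exact: xiV_lin.
Qed.

Lemma yd_tens_rho (P : lmodType k) (F : htens M N -> V -> P) (t : htens M N) :
  bilin F ->
  tfold F (rho MN t) = \tsum_(m, n <- t) \tsum_(m0, m1 <- rho M m)
    \tsum_(n0, n1 <- rho N n) F (tens m0 n0) (xi H (n1 ** m1)).
Proof.
move=> bF; have ba := amul_bilin (hopf_algP H).
have bF' : bilin (fun m h => F (xi (htens M N) m) (xi H h)).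
  by split; [move=> n|move=> m]; move=> a x y; rewrite ?xi_lin ?bF.1 ?bF.2.
rewrite tfold_oco // [yrho _]/= tfold_tfold //; apply: eq_tfold => m n.
rewrite tfold_tfold // (tfold_rho H (yrho (ostr M))); last lin.
apply: eq_tfold => m0 m1.
rewrite tfold_tfold // (tfold_rho H (yrho (ostr N))); last lin.
apply: eq_tfold => n0 n1.
rewrite tfold_tens // [xi _ _]/= tmap_tens; try exact: xi_lin.
by rewrite amulE -xiV_mul !xiVK.
Qed.

Lemma yd_tens_omod : is_omodule H (yact (ostr MN)).
Proof.
have e : act MN = fun h (t : htens M N) => \tsum_(m, n <- t) \tsum_(h1, h2 <- ocop H h)
    tens (act M (c (xiV H h1)) m) (act N (B (xiV H h2)) n).
  by apply: funext => h; apply: funext => t; apply: yd_tens_act.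
have bMN : bilin (act MN) by rewrite e; split=> [t|h]; lin.
split=> //.
- move=> x y; apply: linear_eq_tens; try lin.
  move=> m n; rewrite !yd_tens_act !tfold_tens; try lin.
  rewrite -/(omul H x y) ocop_mul; last lin.
  rewrite exchange_tfold [RHS]tfold_tfold; last lin.
  apply: eq_tfold => y1 y2; rewrite tfold_tens; last lin.
  apply: eq_tfold => x1 x2.
  by rewrite !xiV_mul !autf_mul !(oact_mul (oyd_mod yM)) !(oact_mul (oyd_mod yN)).
- move=> x; apply: linear_eq_tens; try lin.
  move=> m n; rewrite xi_tens !yd_tens_act !tfold_tens; try lin.
  rewrite ocop_xi ?linear_tfold; try lin.
  apply: eq_tfold => h1 h2.
  by rewrite xi_tens (oact_xi (oyd_mod yM)) (oact_xi (oyd_mod yN)) -!autf_xi !xiK !xiVK.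
- apply: linear_eq_tens; try lin.
  move=> m n; rewrite yd_tens_act tfold_tens ?ocop_1; try lin.
  by rewrite xiV_1 !autf_1 (oact_1 (oyd_mod yM)) (oact_1 (oyd_mod yN)).
Qed.

Lemma yd_tens_ocomod : is_ocomodule H (yrho (ostr MN)).
Proof.
have lt : linear (rho MN).
  have e (t : htens M N) : rho MN t = \tsum_(m, n <- t) \tsum_(m0, m1 <- rho M m)
    \tsum_(n0, n1 <- rho N n) tens (tens m0 n0 : htens M N) (xi H (n1 ** m1)).
    by rewrite [LHS]tensorE yd_tens_rho //; apply: tens_bilin.
  by rewrite (funext e); lin.
have cM := oyd_comod yM; have cN := oyd_comod yN.
split=> //.
- move=> P F m tF; move: m; apply: linear_eq_tens; try lin.
  move=> m n; rewrite !yd_tens_rho ?tfold_tens; try lin.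
  transitivity (\tsum_(m0, m1 <- rho M m) \tsum_(b1, b2 <- ocop H m1)
    \tsum_(n0, n1 <- rho N n) \tsum_(a1, a2 <- ocop H n1)
      F (tens m0 n0) (xi H (a1 ** b1)) (xi H (a2 ** b2))).
    apply: eq_tfold => m0 m1; rewrite [RHS]exchange_tfold.
    apply: eq_tfold => n0 n1; rewrite [RHS]exchange_tfold.
    by rewrite ocop_xi ?ocop_mul //; lin.
  rewrite (oco_coassoc cM); last lin.
  apply: eq_tfold => m0 m1.
  under eq_tfold => m00 m01.
    by rewrite (oco_coassoc cN); [over | lin].
  rewrite [LHS]exchange_tfold; apply: eq_tfold => n0 n1.
  by rewrite yd_tens_rho ?tfold_tens //; lin.
- move=> P F m lF; move: m; apply: linear_eq_tens; try lin.
  move=> m n; rewrite yd_tens_rho ?tfold_tens; try lin.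
  rewrite -[RHS](@oco_counit _ _ _ _ _ cM _ (fun m => F (tens m n))); last lin.
  apply: eq_tfold => m0 m1.
  rewrite -[F _ in RHS](@oco_counit _ _ _ _ _ cN _ (fun n => F (tens m0 n))); last lin.
  rewrite linear_tfold; last lin.
  apply: eq_tfold => n0 n1.
  by rewrite eps_xi eps_omul scalerA mulrC.
- move=> P F m bF; move: m; apply: linear_eq_tens; try lin.
  move=> m n; rewrite xi_tens !yd_tens_rho ?tfold_tens ?(oco_xi cM); try lin.
  apply: eq_tfold => m0 m1; rewrite (oco_xi cN); try lin.
  by apply: eq_tfold => n0 n1; rewrite xi_tens -xi_mul.
Qed.

(** The part of [h] that acts on M is moved through the coaction of M by the
    condition for M, twisted by [f], and then the part that acts on N by the
    condition for N, twisted by [g]; in between, coassociativity regroups the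
    coproduct of [h]. The two steps fit together since the factor [be M (f p)]
    left by the first is the factor [al N (g p)] needed by the second. *)
Lemma yd_tens_oyd : oyd MN.
Proof.
split=> [||P F h t bF]; [exact: yd_tens_omod | exact: yd_tens_ocomod |].
have lt := oco_linear yd_tens_ocomod; have bt := oact_bil yd_tens_omod.
move: t; apply: linear_eq_tens; try lin.
move=> m n.
pose f := (c * (xiAut H)^-1)%g; pose g := (B * (xiAut H)^-1)%g.
pose T m0 m1 n0 n1 : P := F (tens m0 n0) (xi H (n1 ** m1)).
transitivity (\tsum_(x, q <- ocop H h) \tsum_(h1, p <- ocop H x)
  \tsum_(m0, m1 <- rho M (act M (f p) m)) \tsum_(n0, n1 <- rho N (act N (g q) n))
    T m0 (m1 ** al (ograde M) (f h1)) n0 n1).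
  rewrite -ocoassoc; last by rewrite /T; lin.
  apply: eq_tfold => h1 h2; rewrite yd_tens_act tfold_tens ?linear_tfold; try lin.
  apply: eq_tfold => p q; rewrite yd_tens_rho ?tfold_tens; try lin.
  apply: eq_tfold => m0 m1; apply: eq_tfold => n0 n1.
  rewrite /T !xi_mul -!omulA; congr (F _ (_ ** (_ ** _))).
  by rewrite /f /= -autf_xi -autf_xi xiVK.
transitivity (\tsum_(x, q <- ocop H h) \tsum_(h1, p <- ocop H x)
  \tsum_(m0, m1 <- rho M m) \tsum_(n0, n1 <- rho N (act N (g q) n))
    T (act M (f h1) m0) (be (ograde M) (f p) ** m1) n0 n1).
  apply: eq_tfold => x q.
  apply: (@oyd_cond_aut M f _ (fun m0 m1 => \tsum_(n0, n1 <- rho N (act N (g q) n))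
    T m0 m1 n0 n1)) => //; rewrite /T; lin.
rewrite -ocoassoc; last by rewrite /T; lin.
transitivity (\tsum_(h1, x <- ocop H h) \tsum_(p, q <- ocop H x)
  \tsum_(m0, m1 <- rho M m) \tsum_(n0, n1 <- rho N n)
    T (act M (f h1) m0) m1 (act N (g p) n0) (be (ograde N) (g q) ** n1)).
  apply: eq_tfold => h1 x; rewrite exchange_tfold [RHS]exchange_tfold.
  apply: eq_tfold => m0 m1.
  rewrite -(@oyd_cond_aut N g _ (fun n0 n1 => T (act M (f h1) m0) m1 n0 n1)) //;
    last by rewrite /T; lin.
  apply: eq_tfold => p q; apply: eq_tfold => n0 n1.
  by rewrite /T /f /g /= omulA !autVK.
rewrite ocoassoc; last by rewrite /T; lin.
apply: eq_tfold => x q.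
rewrite yd_tens_rho ?tfold_tens; try lin.
rewrite exchange_tfold; apply: eq_tfold => m0 m1.
rewrite exchange_tfold; apply: eq_tfold => n0 n1.
rewrite yd_tens_act tfold_tens; try lin.
rewrite (@linear_tfold _ _ _ _ _ (fun u => F u _)); last lin.
apply: eq_tfold => h1 h2; rewrite /T; congr (F _ _).
by rewrite -omulA xi_mul /g /= -autf_xi -autV_xi -!autf_xi xiVK.
Qed.
End Tensor.

(** * Conjugates and the unit *)

Section Conj.
Variables (g : G) (N : object) (yN : oyd N).
Let lN := oyd_oco_linear yN. Let bN := oyd_oact_bilin yN.
Local Notation gN := (Object (g * ograde N * g^-1)%g (yd_conj g N)).
Local Notation A :=
  ((al (ograde N))^-1 * be g * al (ograde N) * (al g)^-1)%g.
Local Notation K := (al g * (be g)^-1)%g.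

Lemma yd_conj_act h n : act gN h n = act N (A h) n.
Proof. by []. Qed.

Lemma yd_conj_rho (P : lmodType k) (F : gN -> V -> P) n : bilin F ->
  tfold F (rho gN n) = \tsum_(n0, n1 <- rho N n) F n0 (K n1).
Proof.
move=> bF; have lr := oyd_rho_linear yN.
rewrite tfold_oco // [yrho _]/= tfold_tfold; last lin.
rewrite (tfold_rho H (yrho (ostr N))); last lin.
apply: eq_tfold => n0 n1; rewrite tfold_tens; last lin.
by rewrite xiVK autV_xiV autf_xiV xiVK.
Qed.

(** The condition for N twisted by [A], with [K] applied to its second leg: the
    products [K * al N * A] and [K * be N * A] are the two automorphisms of the
    conjugated grade. *)
Lemma yd_conj_oyd : oyd gN.
Proof.
have [[b mu ax a1] cN _] := yN; have [_ ca ce cx] := cN.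
have lg : linear (rho gN).
  have e (n : gN) : rho gN n = \tsum_(n0, n1 <- rho N n) tens (n0 : gN) (K n1).
    by rewrite [LHS]tensorE yd_conj_rho //; apply: tens_bilin.
  by rewrite (funext e); lin.
have bg : bilin (act gN).
  by split=> [x|h] a u v; rewrite !yd_conj_act ?autf_linear ?b.1 ?b.2.
split; [split|split|] => //.
- by move=> x y n; rewrite !yd_conj_act -/(omul H x y) autf_mul -mu.
- by move=> x n; rewrite !yd_conj_act ax autf_xi.
- by move=> n; rewrite yd_conj_act autf_1 a1.
- move=> P F n tF; rewrite !yd_conj_rho; try lin.
  under eq_tfold => n0 n1 do [rewrite ocop_aut; last lin].
  rewrite (ca _ (fun n x y => F n (K x) (K y))); last lin.
  by apply: eq_tfold => n0 n1; rewrite yd_conj_rho //; lin.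
- move=> P F n lF; rewrite yd_conj_rho; last lin.
  by rewrite -[RHS](ce _ F) //; apply: eq_tfold => n0 n1; rewrite autf_eps.
- move=> P F n bF; rewrite !yd_conj_rho ?cx; try lin.
  by apply: eq_tfold => n0 n1; rewrite autf_xi.
- move=> P F h n bF.
  transitivity (\tsum_(h1, h2 <- ocop H h) \tsum_(n0, n1 <- rho N (act N (A h2) n))
    F n0 (K (n1 ** al (ograde N) (A h1)))).
    apply: eq_tfold => h1 h2; rewrite yd_conj_rho ?yd_conj_act; try lin.
    apply: eq_tfold => n0 n1; rewrite autf_mul; congr (F _ (_ ** _)).
    by rewrite /= !(autK, autVK).
  rewrite (@oyd_cond_aut N A _ (fun x y => F x (K y))) //; last lin.
  apply: eq_tfold => h1 h2; rewrite yd_conj_rho ?yd_conj_act; try lin.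
  apply: eq_tfold => n0 n1; rewrite autf_mul; congr (F _ (_ ** _)).
  by rewrite /= !(autK, autVK).
Qed.

End Conj.

Section Unit.
Local Notation U1 := (Object 1%g (yd_unit H) : object).

Lemma yd_unit_act h (c : U1) : act U1 h c = eps H h *: (c : k^o).
Proof. by []. Qed.

Lemma yd_unit_rho (P : lmodType k) (F : U1 -> V -> P) (c : U1) : bilin F ->
  tfold F (rho U1 c) = F c (aone H).
Proof.
move=> bF; rewrite tfold_oco // [yrho _]/= tfold_tens; last lin.
by rewrite xi_1.
Qed.

Lemma yd_unit_oyd : oyd U1.
Proof.
have lg : linear (rho U1).
  have e (c : U1) : rho U1 c = tens (c : U1) (aone H).
    by rewrite [LHS]tensorE yd_unit_rho //; apply: tens_bilin.
  by rewrite (funext e); lin.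
have bu : bilin (act U1) by split=> [x|h]; rewrite /oact /=; lin.
split; [split|split|] => //.
- by move=> x y c; rewrite !yd_unit_act -/(omul H x y) eps_omul scalerA.
- by move=> x c; rewrite !yd_unit_act eps_xi.
- by move=> c; rewrite yd_unit_act eps_1 scale1r.
- by move=> P F c tF; rewrite !yd_unit_rho ?ocop_1; try lin.
- by move=> P F c lF; rewrite yd_unit_rho ?eps_1 ?scale1r //; lin.
- by move=> P F c bF; rewrite !yd_unit_rho ?xi_1 //; lin.
- move=> P F h c bF.
  have F1 a (x : U1) y : F (a *: (x : k^o)) y = a *: F x y.
    exact: (linearZE a x (bF.1 y)).
  transitivity (F c h).
    rewrite -[RHS](@ocounit_r _ _ H _ (F c)); last lin.
    apply: eq_tfold => h1 h2; rewrite yd_unit_act yd_unit_rho; last lin.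
    by rewrite F1 omul1l.
  rewrite -[LHS](@ocounit_l _ _ H _ (F c)); last lin.
  apply: eq_tfold => h1 h2; rewrite yd_unit_rho; last lin.
  by rewrite yd_unit_act F1 omul1r.
Qed.
End Unit.

(** * Morphisms of untwisted Yetter-Drinfeld modules *)

Local Notation YD := (MHYD H Sinv).

Record is_ohom (M N : object) (f : M -> N) : Prop := IsOHom {
  oh_lin : linear f;
  oh_xi : forall m, f (xi M m) = xi N (f m);
  oh_act : forall h m, f (act M h m) = act N h (f m);
  oh_rho : forall (P : lmodType k) (F : N -> V -> P) m, bilin F ->
    tfold F (rho N (f m)) = \tsum_(m0, m1 <- rho M m) F (f m0) m1 }.

Lemma ohom_xiV (M N : object) (f : M -> N) : (forall m, f (xi M m) = xi N (f m)) ->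
  forall m, f (xiV M m) = xiV N (f m).
Proof. by move=> fx m; apply: xi_injM; rewrite -fx !xiVK. Qed.

Lemma yd_homP (M N : object) (f : M -> N) : oyd M -> oyd N ->
  is_hom (C := YD) f <-> ograde M = ograde N /\ is_ohom f.
Proof.
move=> yM yN; have lM := oyd_rho_linear yM; have lN := oyd_rho_linear yN.
have loM := oyd_oco_linear yM; have loN := oyd_oco_linear yN.
split=> [[e lf fx [fa fr]]|[e [lf fx fa fr]]]; split=> //.
- split=> //; first by move=> h m; rewrite /oact ohom_xiV // fa.
  move=> P F m bF; rewrite !tfold_oco //; last lin.
  rewrite fr tfold_tfold; last lin.
  by apply: eq_tfold => m0 m1; rewrite tfold_tens ?fx //; lin.
- split=> [h m|m]; first by rewrite (actE (yact (ostr M)) h) (actE (yact (ostr N)) h) fx fa.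
  rewrite [LHS]tensorE (tfold_rho H (yrho (ostr N))); last lin.
  rewrite fr ?[RHS](tfold_rho H (yrho (ostr M))); try lin.
  by apply: eq_tfold => m0 m1; rewrite ohom_xiV.
Qed.

Lemma ohom_inv (M N : object) (f : M -> N) (g : N -> M) :
  is_ohom f -> cancel f g -> cancel g f -> oyd M -> oyd N -> is_ohom g.
Proof.
move=> [lf fx fa fr] fK gK yM yN; have fI := can_inj fK.
have lM := oyd_oco_linear yM; have lN := oyd_oco_linear yN.
have lg : linear g by move=> a x y; apply: fI; rewrite lf !gK.
split=> //.
- by move=> m; apply: fI; rewrite fx !gK.
- by move=> h m; apply: fI; rewrite fa !gK.
- move=> P F m bF; rewrite -[m in RHS]gK fr; last lin.
  by apply: eq_tfold => m0 m1; rewrite fK.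
Qed.

Lemma ohom_comp (M N P : object) (f : M -> N) (g : N -> P) :
  is_ohom f -> is_ohom g -> is_ohom (M := M) (N := P) (g \o f).
Proof.
move=> [lf fx fa fr] [lg gx ga gr]; split=> /=.
- by move=> a x y /=; rewrite lf lg.
- by move=> m; rewrite fx gx.
- by move=> h m; rewrite fa ga.
- by move=> Q F m bF; rewrite gr // fr //; lin.
Qed.

Lemma ohom_tmap (M M' N N' : object) (f : M -> M') (g : N -> N') :
  oyd M -> oyd N -> oyd M' -> oyd N' ->
  ograde M = ograde M' -> ograde N = ograde N' -> is_ohom f -> is_ohom g ->
  is_ohom (M := tens_obj (C := YD) M N) (N := tens_obj (C := YD) M' N') (tmap f g).
Proof.
move=> yM yN yM' yN' eM eN [lf fx fa fr] [lg gx ga gr].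
have yMN := yd_tens_oyd yM yN; have yMN' := yd_tens_oyd yM' yN'.
have bM := oyd_oact_bilin yM; have bN := oyd_oact_bilin yN.
have bM' := oyd_oact_bilin yM'; have bN' := oyd_oact_bilin yN'.
have lM := oyd_oco_linear yM; have lN := oyd_oco_linear yN.
have lM' := oyd_oco_linear yM'; have lN' := oyd_oco_linear yN'.
have l1 := oyd_oco_linear yMN; have l2 := oyd_oco_linear yMN'.
have b1 := oyd_oact_bilin yMN; have b2 := oyd_oact_bilin yMN'.
have lt : linear (tmap f g) by apply: tmap_linear.
split=> //.
- apply: linear_eq_tens; try lin.
  by move=> m n; rewrite !(tmap_tens, xi_tens) // fx gx.
- move=> h; apply: linear_eq_tens; try lin.
  move=> m n; rewrite tmap_tens // !yd_tens_act // !tfold_tens; try lin.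
  rewrite linear_tfold //; apply: eq_tfold => h1 h2.
  by rewrite tmap_tens // fa ga eM eN.
- move=> P F t bF; move: t; apply: linear_eq_tens; try lin.
  move=> m n; rewrite tmap_tens // !yd_tens_rho ?tfold_tens; try lin.
  rewrite fr; last lin.
  apply: eq_tfold => m0 m1; rewrite gr; last lin.
  by apply: eq_tfold => n0 n1; rewrite tmap_tens.
Qed.

Local Notation tens_obj := (@tens_obj k G YD).
Local Notation conj_obj := (@conj_obj k G YD).
Local Notation unit_obj := (@unit_obj k G YD).

Lemma tens_oyd (M N : object) : oyd M -> oyd N -> oyd (tens_obj M N).
Proof. exact: yd_tens_oyd. Qed.

Lemma tens_actE (M N : object) h m n : oyd M -> oyd N ->
  act (tens_obj M N) h (tens m n) = \tsum_(h1, h2 <- ocop H h)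
    tens (act M (al (ograde N) (xiV H h1)) m)
      (act N (autV (al (ograde N)) (be (ograde M) (al (ograde N) (xiV H h2)))) n).
Proof.
move=> yM yN; have bM := oyd_oact_bilin yM; have bN := oyd_oact_bilin yN.
by rewrite yd_tens_act // tfold_tens //; lin.
Qed.

Lemma tens_rhoE (M N : object) (P : lmodType k) (F : tens_obj M N -> V -> P) m n :
  oyd M -> oyd N -> bilin F ->
  tfold F (rho (tens_obj M N) (tens m n)) = \tsum_(m0, m1 <- rho M m)
    \tsum_(n0, n1 <- rho N n) F (tens m0 n0) (xi H (n1 ** m1)).
Proof.
move=> yM yN bF; have lM := oyd_oco_linear yM; have lN := oyd_oco_linear yN.
by rewrite yd_tens_rho // tfold_tens //; lin.
Qed.

(** Coassociativity for the action and associativity for the coaction; the [xi]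
    and [xi^-1] of the associator compensate those of [tens_actE] and
    [tens_rhoE], which are nested differently on the two sides. *)
Lemma ohom_assoc (U W X : object) : oyd U -> oyd W -> oyd X ->
  is_ohom (M := tens_obj (tens_obj U W) X) (N := tens_obj U (tens_obj W X))
    (@hassoc k U W X).
Proof.
move=> yU yW yX.
have yUW := tens_oyd yU yW; have yWX := tens_oyd yW yX.
have yL := tens_oyd yUW yX; have yR := tens_oyd yU yWX.
have bU := oyd_oact_bilin yU; have bW := oyd_oact_bilin yW; have bX := oyd_oact_bilin yX.
have lU := oyd_oco_linear yU; have lW := oyd_oco_linear yW; have lX := oyd_oco_linear yX.
have bUW := oyd_oact_bilin yUW; have bWX := oyd_oact_bilin yWX.
have lUW := oyd_oco_linear yUW; have lWX := oyd_oco_linear yWX.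
have bL := oyd_oact_bilin yL; have bR := oyd_oact_bilin yR.
have lL := oyd_oco_linear yL; have lR := oyd_oco_linear yR.
have la := @hassoc_linear k U W X.
split=> //.
- apply: linear_eq_tens3; try lin.
  by move=> u w x; rewrite !(xi_tens, hassocE) xiK xiVK.
- move=> h; apply: linear_eq_tens3; try lin.
  move=> u w x; rewrite hassocE !tens_actE // linear_tfold //.
  transitivity (\tsum_(h1, h2 <- ocop H h) \tsum_(h11, h12 <- ocop H h1)
    tens (act U (al (ograde W * ograde X)%g (xiV H h11)) (xi U u))
      (tens (act W (al (ograde X) (autV (al (ograde W * ograde X)%g)
                (be (ograde U) (al (ograde W * ograde X)%g (xiV H (xiV H h12)))))) w)
            (act X (autV (al (ograde X)) (be (ograde U * ograde W)%g
                (al (ograde X) (xiV H (xiV H h2))))) (xiV X x)))).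
    apply: eq_tfold => h1 h2; rewrite tens_actE // ocop_aut; last lin.
    rewrite ocop_xiV; last lin.
    rewrite (@linear_tfold _ _ _ _ _ (fun s => hassoc (tens s _))); last lin.
    apply: eq_tfold => h11 h12; rewrite hassocE.
    rewrite (oact_xi (oyd_mod yU)) (oact_xiV _ _ (oyd_mod yX)).
    by rewrite /= !(autf_xiV, autV_xiV) !autVK xiVK.
  rewrite -ocoassoc; last lin.
  apply: eq_tfold => h1 h2; rewrite tens_actE // linear_tfold; last lin.
  rewrite ocop_autV; last lin.
  do 2![rewrite ocop_aut; last lin].
  rewrite ocop_xiV; last lin.
  apply: eq_tfold => h21 h22.
  by rewrite /= !(autf_xiV, autV_xiV) !autVK.
- move=> P F t bF; move: t; apply: linear_eq_tens3; try lin.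
  move=> u w x; rewrite hassocE tens_rhoE // (tens_rhoE _ _ yUW yX); last lin.
  have cU := oyd_comod yU; have cX := oyd_comod yX.
  rewrite (oco_xi cU) ?(tens_rhoE _ _ yU yW); try lin.
  apply: eq_tfold => u0 u1; rewrite tens_rhoE //; last lin.
  apply: eq_tfold => w0 w1; rewrite (oco_xiV _ cX); last lin.
  apply: eq_tfold => x0 x1; rewrite hassocE; congr (F _ (xi H _)).
  by rewrite !xi_mul xiVK omulA.
Qed.

Lemma unit_oyd : oyd unit_obj.
Proof. exact: yd_unit_oyd. Qed.

Lemma ohom_lunit (U : object) : oyd U ->
  is_ohom (M := tens_obj unit_obj U) (N := U) (@hlunit k U).
Proof.
move=> yU; have y1 := unit_oyd; have yT := tens_oyd y1 yU.
have bU := oyd_oact_bilin yU; have lU := oyd_oco_linear yU.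
have bT := oyd_oact_bilin yT; have lT := oyd_oco_linear yT.
have ll := @hlunit_linear k U.
split=> //.
- apply: linear_eq_tens; try lin.
  by move=> c m; rewrite !(xi_tens, hlunitE) (linearZE _ _ (xi_lin U)).
- move=> h; apply: linear_eq_tens; try lin.
  move=> c m; rewrite hlunitE tens_actE // linear_tfold //.
  rewrite (linearZE _ _ (bU.2 _)).
  rewrite -[in RHS](@ocounit_l _ _ H _ (fun h => act U h (xi U m))) ?linear_tfold; try lin.
  apply: eq_tfold => h1 h2; rewrite hlunitE yd_unit_act autf_eps xiV_eps.
  rewrite (oact_xi (oyd_mod yU)) /= autK xiVK.
  by rewrite [_ *: (c : k^o)]mulrC scalerA.
- move=> P F t bF; move: t; apply: linear_eq_tens; try lin.
  move=> c m; rewrite hlunitE tens_rhoE //; last lin.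
  rewrite yd_unit_rho; last lin.
  rewrite (linearZE _ _ lU) (linearZE _ _ (tfold_linear bF)) (oco_xi (oyd_comod yU)) //.
  rewrite linear_tfold; last lin.
  apply: eq_tfold => m0 m1; rewrite hlunitE omul1r.
  by rewrite [in RHS](linearZE _ _ (bF.1 _)).
Qed.

Lemma ohom_runit (U : object) : oyd U ->
  is_ohom (M := tens_obj U unit_obj) (N := U) (@hrunit k U).
Proof.
move=> yU; have y1 := unit_oyd; have yT := tens_oyd yU y1.
have bU := oyd_oact_bilin yU; have lU := oyd_oco_linear yU.
have bT := oyd_oact_bilin yT; have lT := oyd_oco_linear yT.
have ll := @hrunit_linear k U.
split=> //.
- apply: linear_eq_tens; try lin.
  by move=> m c; rewrite !(xi_tens, hrunitE) (linearZE _ _ (xi_lin U)).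
- move=> h; apply: linear_eq_tens; try lin.
  move=> m c; rewrite hrunitE tens_actE // linear_tfold //.
  rewrite (linearZE _ _ (bU.2 _)).
  rewrite -[in RHS](@ocounit_r _ _ H _ (fun h => act U h (xi U m))) ?linear_tfold; try lin.
  apply: eq_tfold => h1 h2; rewrite hrunitE yd_unit_act /= autf_eps xiV_eps.
  rewrite (oact_xi (oyd_mod yU)) /= xiVK.
  by rewrite [_ *: (c : k^o)]mulrC scalerA.
- move=> P F t bF; move: t; apply: linear_eq_tens; try lin.
  move=> m c; rewrite hrunitE tens_rhoE //; last lin.
  rewrite (linearZE _ _ lU) (linearZE _ _ (tfold_linear bF)) (oco_xi (oyd_comod yU)) //.
  rewrite linear_tfold; last lin.
  apply: eq_tfold => m0 m1; rewrite yd_unit_rho ?hrunitE ?omul1l; try lin.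
  by rewrite [in RHS](linearZE _ _ (bF.1 _)).
Qed.

(** * The braiding *)

Local Notation br M N := (@sbraid k G YD M N).

Lemma conj_oyd g (N : object) : oyd N -> oyd (conj_obj g N).
Proof. exact: yd_conj_oyd. Qed.

Lemma conj_rhoE g (N : object) (P : lmodType k) (F : conj_obj g N -> V -> P) n :
  oyd N -> bilin F -> tfold F (rho (conj_obj g N) n) =
  \tsum_(n0, n1 <- rho N n) F n0 (al g (autV (be g) n1)).
Proof. by move=> yN bF; apply: yd_conj_rho. Qed.

Lemma braid_linear (M N : object) : oyd M -> oyd N -> linear (br M N).
Proof.
move=> yM yN; have bM := oyd_act_bilin yM; have lN := oyd_rho_linear yN.
rewrite /= /yd_braid; lin.
Qed.

(** The [xi] in the braiding cancel against those of untwisting. *)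
Lemma braidE (M N : object) m n : oyd M -> oyd N ->
  br M N (tens m n) =
  \tsum_(n0, n1 <- rho N n) tens n0 (act M (autV (be (ograde M)) n1) m).
Proof.
move=> yM yN; have bM := oyd_act_bilin yM; have lN := oyd_rho_linear yN.
rewrite /= /yd_braid tfold_tens; last lin.
rewrite (tfold_rho H (yrho (ostr N))); last lin.
apply: eq_tfold => n0 n1; rewrite xiVK (actE (yact (ostr M))).
by rewrite (oact_xi (oyd_mod yM)) xiVK /= autV_xiV xiVK.
Qed.

(** Linearity is the condition for N and colinearity the condition for M, the
    latter twisted by the inverse of [be M] that occurs in the braiding. *)
Lemma ohom_braid (M N : object) : oyd M -> oyd N ->
  is_ohom (M := tens_obj M N) (N := tens_obj (conj_obj (ograde M) N) M) (br M N).
Proof.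
move=> yM yN; have yC := conj_oyd (ograde M) yN.
have yL := tens_oyd yM yN; have yR := tens_oyd yC yM.
have bM := oyd_oact_bilin yM; have bN := oyd_oact_bilin yN; have bC := oyd_oact_bilin yC.
have lM := oyd_oco_linear yM; have lN := oyd_oco_linear yN; have lC := oyd_oco_linear yC.
have bL := oyd_oact_bilin yL; have bR := oyd_oact_bilin yR.
have lL := oyd_oco_linear yL; have lR := oyd_oco_linear yR.
have lb := braid_linear yM yN.
split=> //.
- apply: linear_eq_tens; try lin.
  move=> m n; rewrite xi_tens !braidE // (oco_xi (oyd_comod yN)) ?linear_tfold; try lin.
  apply: eq_tfold => n0 n1; rewrite xi_tens (oact_xi (oyd_mod yM)).
  by rewrite autV_xi.
- move=> h; apply: linear_eq_tens; try lin.
  move=> m n; rewrite braidE // tens_actE // linear_tfold // [RHS]linear_tfold; last lin.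
  pose g := ((al (ograde N))^-1 * be (ograde M) * al (ograde N) * (xiAut H)^-1)%g.
  transitivity (\tsum_(h1, h2 <- ocop H h) \tsum_(n0, n1 <- rho N (act N (g h2) n))
    tens n0 (act M (autV (be (ograde M)) (n1 ** al (ograde N) (g h1))) m)).
    apply: eq_tfold => h1 h2; rewrite braidE //.
    apply: eq_tfold => n0 n1; rewrite -(oact_mul (oyd_mod yM)) -/(omul H _ _).
    by rewrite autV_mul /= autVK autK.
  rewrite (@oyd_cond_aut N g _ (fun n0 n1 =>
    tens n0 (act M (autV (be (ograde M)) n1) m))) //; last lin.
  rewrite exchange_tfold; apply: eq_tfold => n0 n1.
  rewrite tens_actE //; apply: eq_tfold => h1 h2.
  rewrite -(oact_mul (oyd_mod yM)) -/(omul H _ _).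
  by rewrite autV_mul /= !(autK, autVK) /oact /= autK.
- move=> P F t bF; move: t; apply: linear_eq_tens; try lin.
  move=> m n; rewrite braidE // linear_tfold // tens_rhoE //; last lin.
  rewrite linear_tfold; last lin.
  transitivity (\tsum_(n0, n1 <- rho N n) \tsum_(n11, n12 <- ocop H n1)
    \tsum_(m0, m1 <- rho M (act M (autV (be (ograde M)) n12) m))
      F (tens n0 m0) (xi H (m1 ** al (ograde M) (autV (be (ograde M)) n11)))).
    rewrite (oco_coassoc (oyd_comod yN)); last lin.
    apply: eq_tfold => n0 n1; rewrite tens_rhoE // conj_rhoE //; lin.
  transitivity (\tsum_(n0, n1 <- rho N n) \tsum_(n11, n12 <- ocop H n1)
    \tsum_(m0, m1 <- rho M m)
      F (tens n0 (act M (autV (be (ograde M)) n11) m0)) (xi H (n12 ** m1))).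
    apply: eq_tfold => n0 n1.
    have := @oyd_cond_aut M (be (ograde M))^-1%g _
      (fun m0 m1 => F (tens n0 m0) (xi H m1)) n1 m yM.
    move=> /= ->; last lin.
    by apply: eq_tfold => h1 h2; rewrite autVK.
  rewrite (oco_coassoc (oyd_comod yN)); last lin.
  rewrite exchange_tfold; under eq_tfold => n0 n1 do rewrite exchange_tfold.
  apply: eq_tfold => n0 n1; apply: eq_tfold => m0 m1; rewrite braidE //.
  by rewrite (@linear_tfold _ _ _ _ _ (fun s => F s _)) //; lin.
Qed.

(** The coaction of N is undone by letting the antipode of its second leg act. *)
Definition braid_inv (M N : object) (t : htens N M) : htens M N :=
  \tsum_(n, m <- t) \tsum_(n0, n1 <- rho N n)
    tens (act M (autV (be (ograde M)) (apode H n1)) m) n0.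

Lemma braid_inv_linear (M N : object) : oyd M -> oyd N -> linear (@braid_inv M N).
Proof.
move=> yM yN; have bM := oyd_oact_bilin yM; have lN := oyd_oco_linear yN.
rewrite /braid_inv; lin.
Qed.

Lemma braid_invE (M N : object) m n : oyd M -> oyd N ->
  @braid_inv M N (tens n m) =
  \tsum_(n0, n1 <- rho N n) tens (act M (autV (be (ograde M)) (apode H n1)) m) n0.
Proof.
move=> yM yN; have bM := oyd_oact_bilin yM; have lN := oyd_oco_linear yN.
by rewrite /braid_inv tfold_tens //; lin.
Qed.

Lemma braidK (M N : object) : oyd M -> oyd N -> cancel (br M N) (@braid_inv M N).
Proof.
move=> yM yN; have bM := oyd_oact_bilin yM; have lN := oyd_oco_linear yN.
have li := braid_inv_linear yM yN; have lb := braid_linear yM yN.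
apply: linear_eq_tens; try lin.
move=> m n; rewrite braidE // linear_tfold //.
under eq_tfold => n0 n1 do rewrite braid_invE //.
rewrite -[RHS](@oco_counit _ _ _ _ _ (oyd_comod yN) _ (fun n => tens m n)); last lin.
rewrite -(oco_coassoc (oyd_comod yN) (F := fun n0 n1 n2 =>
  tens (act M (autV (be (ograde M)) (apode H n1))
    (act M (autV (be (ograde M)) n2) m)) n0)); last lin.
apply: eq_tfold => n0 n1.
rewrite -[m in RHS](oact_1 (oyd_mod yM)) -(autV_1 (be (ograde M))).
rewrite -(@apode_mull _ _ _ _ (fun x => tens (act M (autV (be (ograde M)) x) m) n0)); last lin.
by apply: eq_tfold => x y; rewrite -(oact_mul (oyd_mod yM)) autV_mul.
Qed.

Lemma braid_invK (M N : object) : oyd M -> oyd N -> cancel (@braid_inv M N) (br M N).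
Proof.
move=> yM yN; have bM := oyd_oact_bilin yM; have lN := oyd_oco_linear yN.
have li := braid_inv_linear yM yN; have lb := braid_linear yM yN.
apply: linear_eq_tens; try lin.
move=> n m; rewrite braid_invE // linear_tfold //.
under eq_tfold => n0 n1 do rewrite braidE //.
rewrite -[RHS](@oco_counit _ _ _ _ _ (oyd_comod yN) _ (fun n => tens n m)); last lin.
rewrite -(oco_coassoc (oyd_comod yN) (F := fun n0 n1 n2 =>
  tens n0 (act M (autV (be (ograde M)) n1)
    (act M (autV (be (ograde M)) (apode H n2)) m)))); last lin.
apply: eq_tfold => n0 n1.
rewrite -[m in RHS](oact_1 (oyd_mod yM)) -(autV_1 (be (ograde M))).
rewrite -(@apode_mulr _ _ _ _ (fun x => tens n0 (act M (autV (be (ograde M)) x) m))); last lin.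
by apply: eq_tfold => x y; rewrite -(oact_mul (oyd_mod yM)) autV_mul.
Qed.

Lemma braid_nat_yd (M M' N N' : object) (f : M -> M') (g : N -> N') t :
  oyd M -> oyd M' -> oyd N -> oyd N' -> ograde M = ograde M' ->
  is_ohom f -> is_ohom g ->
  tmap g f (br M N t) = br M' N' (tmap f g t).
Proof.
move=> yM yM' yN yN' eM [lf _ fa _] [lg _ _ gr].
have bM' := oyd_oact_bilin yM'.
have lb := braid_linear yM yN; have lb' := braid_linear yM' yN'.
move: t; apply: linear_eq_tens; try lin.
move=> m n; rewrite tmap_tens // !braidE // linear_tfold; last lin.
rewrite gr; last lin.
by apply: eq_tfold => n0 n1; rewrite tmap_tens // fa eM.
Qed.

(** Here the coaction of X is coassociative and the coproduct acts on [U (x) W];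
    the twist of [h1] in the tensor action is the one that conjugation by the
    grade of W introduces in the coaction of X. *)
Lemma braid_tobl_yd (U W X : object) t : oyd U -> oyd W -> oyd X ->
  br (tens_obj U W) X t =
  @hassoc k X U W (tmap (br U (conj_obj (ograde W) X)) id
    (@hassocV k U X W (tmap id (br W X) (@hassoc k U W X t)))).
Proof.
move=> yU yW yX; have yUW := tens_oyd yU yW; have yC := conj_oyd (ograde W) yX.
have bU := oyd_oact_bilin yU; have bW := oyd_oact_bilin yW; have lX := oyd_oco_linear yX.
have lb := braid_linear yUW yX; have lb1 := braid_linear yU yC.
have lb2 := braid_linear yW yX.
move: t; apply: linear_eq_tens3; try lin.
move=> u w x; rewrite hassocE braidE // tmap_tens // braidE //.
rewrite (oco_xiV _ (oyd_comod yX)); last lin.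
rewrite (@linear_tfold _ _ _ _ _ (fun s => hassoc (tmap (br U (conj_obj (ograde W) X)) id
  (hassocV (tens (xi U u) s))))); last lin.
transitivity (\tsum_(x0, x1 <- rho X x) \tsum_(h1, h2 <- ocop H x1)
  tens x0 (tens
    (act U (autV (be (ograde U)) (al (ograde W) (autV (be (ograde W)) (xiV H h1)))) u)
    (act W (autV (be (ograde W)) (xiV H h2)) w))).
  apply: eq_tfold => x0 x1; rewrite tens_actE // ocop_autV; last lin.
  rewrite linear_tfold; last lin.
  apply: eq_tfold => h1 h2.
  by rewrite /= !(autf_xiV, autV_xiV) ?(autK, autVK).
rewrite (oco_coassoc (oyd_comod yX)); last lin.
apply: eq_tfold => x0 x1.
rewrite hassocVE tmap_tens // xiK braidE // conj_rhoE //; last lin.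
rewrite (oco_xiV _ (oyd_comod yX)); last lin.
rewrite (@linear_tfold _ _ _ _ _ (fun s => hassoc (tens s _))); last lin.
apply: eq_tfold => x00 x01; rewrite hassocE xiVK xiK.
by rewrite autV_xiV autf_xiV.
Qed.

(** Here the coaction of [W (x) X] multiplies the two second legs, and the module
    axiom of U separates them. *)
Lemma braid_tobr_yd (U W X : object) t : oyd U -> oyd W -> oyd X ->
  br U (tens_obj W X) t =
  @hassocV k W X U (tmap id (br U X)
    (@hassoc k W U X (tmap (br U W) id (@hassocV k U W X t)))).
Proof.
move=> yU yW yX; have yWX := tens_oyd yW yX.
have bU := oyd_oact_bilin yU; have lW := oyd_oco_linear yW; have lX := oyd_oco_linear yX.
have lb := braid_linear yU yWX; have lb1 := braid_linear yU yW.
have lb2 := braid_linear yU yX.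
move: t; apply: linear_eq_tens3r; try lin.
move=> u w x; rewrite hassocVE braidE // tmap_tens // braidE //.
rewrite tens_rhoE //; last lin.
rewrite (@linear_tfold _ _ _ _ _ (fun s => hassocV (tmap id (br U X)
  (hassoc (tens s _))))); last lin.
apply: eq_tfold => w0 w1.
rewrite hassocE xiK tmap_tens // braidE //.
rewrite (@linear_tfold _ _ _ _ _ (fun s => hassocV (tens _ s))); last lin.
apply: eq_tfold => x0 x1.
rewrite hassocVE xiK -(oact_mul (oyd_mod yU)) -/(omul H _ _) (oact_xi (oyd_mod yU)).
by rewrite xiVK -autV_mul autV_xi.
Qed.

Lemma conj_braid_yd g (U W : object) t : oyd U -> oyd W ->
  br (conj_obj g U) (conj_obj g W) t = br U W t.
Proof.
move=> yU yW; have yC := conj_oyd g yU; have yD := conj_oyd g yW.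
have bU := oyd_oact_bilin yU; have bC := oyd_oact_bilin yC.
have lb := braid_linear yU yW; have lb1 := braid_linear yC yD.
move: t; apply: linear_eq_tens; try lin.
move=> u w; rewrite !braidE // conj_rhoE //; last lin.
apply: eq_tfold => w0 w1; rewrite /oact /=.
by rewrite !(autK, autVK).
Qed.

Lemma yd_well_defined : well_defined YD.
Proof.
split.
- by move=> U gU; split=> //; split=> // m; apply: tensorE.
- move=> U W X g f /(ydP SK SinvK) yU /(ydP SK SinvK) yW /(ydP SK SinvK) yX.
  move=> /(yd_homP _ yW yX) [e1 hg] /(yd_homP _ yU yW) [e2 hf].
  by apply/(yd_homP _ yU yX); split; [rewrite e2 | apply: ohom_comp].
- exact/(ydP SK SinvK)/unit_oyd.
- move=> U W /(ydP SK SinvK) yU /(ydP SK SinvK) yW.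
  by apply/(ydP SK SinvK); apply: tens_oyd.
- move=> U U' W W' f g /(ydP SK SinvK) yU /(ydP SK SinvK) yU'.
  move=> /(ydP SK SinvK) yW /(ydP SK SinvK) yW'.
  move=> /(yd_homP _ yU yU') [e1 hf] /(yd_homP _ yW yW') [e2 hg].
  apply/(yd_homP _ (tens_oyd yU yW) (tens_oyd yU' yW')).
  by split; [rewrite /= e1 e2 | apply: ohom_tmap].
- move=> U W X /(ydP SK SinvK) yU /(ydP SK SinvK) yW /(ydP SK SinvK) yX.
  apply/(yd_homP _ (tens_oyd (tens_oyd yU yW) yX) (tens_oyd yU (tens_oyd yW yX))).
  by split; [rewrite /= mulgA | apply: ohom_assoc].
- move=> U W X /(ydP SK SinvK) yU /(ydP SK SinvK) yW /(ydP SK SinvK) yX.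
  have yL := tens_oyd (tens_oyd yU yW) yX; have yR := tens_oyd yU (tens_oyd yW yX).
  apply/(yd_homP _ yR yL); split; first by rewrite /= mulgA.
  exact: (ohom_inv (ohom_assoc yU yW yX) (@hassocK _ _ _ _) (@hassocVK _ _ _ _) yL yR).
- move=> U /(ydP SK SinvK) yU; apply/(yd_homP _ (tens_oyd unit_oyd yU) yU).
  by split; [rewrite /= mul1g | apply: ohom_lunit].
- move=> U /(ydP SK SinvK) yU; apply/(yd_homP _ (tens_oyd yU unit_oyd) yU).
  by split; [rewrite /= mulg1 | apply: ohom_runit].
- by move=> g U /(ydP SK SinvK) yU; apply/(ydP SK SinvK); apply: conj_oyd.
- move=> g U W f _ _ [e lf fx [fa fr]]; split => //; first by rewrite /= e.
  split=> [h m|m]; first by rewrite /= fa e.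
  rewrite /= fr tfold_tfold ?[RHS]tfold_tfold; try lin.
  by apply: eq_tfold => m0 m1; rewrite !tfold_tens //; lin.
- move=> U W /(ydP SK SinvK) yU /(ydP SK SinvK) yW.
  apply/(yd_homP _ (tens_oyd yU yW) (tens_oyd (conj_oyd _ yW) yU)).
  by split; [rewrite /= mulgVK | apply: ohom_braid].
Qed.

Lemma ydStr_eq (M : homSpace k) (s t : ydStr V M) :
  (forall h m, yact s h m = yact t h m) -> (forall m, yrho s m = yrho t m) -> s = t.
Proof.
case: s t => a r [a' r'] /= ea er; congr YDStr; last exact: funext.
by apply: funext => h; apply: funext.
Qed.

Lemma yd_conj_tens g (U W : object) : oyd U -> oyd W ->
  yd_conj g (tens_obj U W) = yd_tens (conj_obj g U) (conj_obj g W).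
Proof.
move=> yU yW; have bU := oyd_act_bilin yU; have bW := oyd_act_bilin yW.
have lU := oyd_rho_linear yU; have lW := oyd_rho_linear yW; have ba := amul_bil H.
apply: ydStr_eq => [h t|t].
- apply: eq_tfold => m n; rewrite (aut_delta (autP _)) tfold_tmap; try lin.
  by apply: eq_tfold => h1 h2; rewrite /= !(autK, autVK).
- rewrite /= tfold_tfold; last lin.
  apply: eq_tfold => m n.
  rewrite tfold_tfold; last lin.
  rewrite [RHS]tfold_tfold; last lin.
  apply: eq_tfold => m0 m1.
  rewrite tfold_tfold ?tfold_tens ?tfold_tfold; try lin.
  apply: eq_tfold => n0 n1; rewrite !tfold_tens; try lin.
  by rewrite -!(aut_mul (autP _)) -(aut_mul (autP (be g)^-1%g)).
Qed.

Lemma yd_braided_structure : is_braided_structure YD.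
Proof.
split.
- move=> g U W /(ydP SK SinvK) yU /(ydP SK SinvK) yW; exact: yd_conj_tens.
- move=> g; apply: ydStr_eq => [h c|c] /=; first by rewrite !(autf_eps, autV_eps).
  by rewrite tfold_tens ?autV_1 ?autf_1 //; lin.
- move=> U gU; apply: ydStr_eq => [h c|c] /=; first by rewrite autK.
  exact/esym/tensorE.
- move=> g h U gU; apply: ydStr_eq => [x c|c] /=; first by rewrite !(autK, autVK).
  rewrite tfold_tfold; last lin.
  by apply: eq_tfold => m0 m1; rewrite tfold_tens ?(autK, autVK) //; lin.
- move=> U W f g /(ydP SK SinvK) yU /(ydP SK SinvK) yW.
  move=> /(yd_homP _ yU yW) [e hf] fK gK.
  by apply/(yd_homP _ yW yU); split; [rewrite e | apply: ohom_inv fK gK yU yW].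
- move=> U W /(ydP SK SinvK) yU /(ydP SK SinvK) yW.
  by exists (@braid_inv U W); [apply: braidK | apply: braid_invK].
- move=> U U' W W' f g t /(ydP SK SinvK) yU /(ydP SK SinvK) yU'.
  move=> /(ydP SK SinvK) yW /(ydP SK SinvK) yW'.
  move=> /(yd_homP _ yU yU') [e1 hf] /(yd_homP _ yW yW') [e2 hg].
  exact: braid_nat_yd.
- move=> U W X t /(ydP SK SinvK) yU /(ydP SK SinvK) yW /(ydP SK SinvK) yX.
  exact: braid_tobl_yd.
- move=> U W X t /(ydP SK SinvK) yU /(ydP SK SinvK) yW /(ydP SK SinvK) yX.
  exact: braid_tobr_yd.
- move=> g U W t /(ydP SK SinvK) yU /(ydP SK SinvK) yW; exact: conj_braid_yd.
Qed.

End Constructions.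

(** * Transport of a braided T-structure *)

Section Transport.
Variables (k : fieldType) (G : groupType) (C D : structured k G).
Variable Phi : forall {M : homSpace k}, str D M -> str C M.
Variable Psi : forall {M : homSpace k}, str C M -> str D M.

Definition Phi_obj (X : object G (str D)) : object G (str C) :=
  Object (ograde X) (Phi (ostr X)).
Definition Psi_obj (U : object G (str C)) : object G (str D) :=
  Object (ograde U) (Psi (ostr U)).

(** A bijection between the good structures of D and those of C on each space
    which preserves and reflects morphisms and respects all operations. Only
    [Phi] is required to respect the operations; for [Psi] this follows. *)
Record is_transport : Prop := IsTransport {
  tr_good : forall X, good X -> good (Phi_obj X);
  tr_goodV : forall U, good U -> good (Psi_obj U);
  tr_K : forall X : object G (str D), good X -> Psi (Phi (ostr X)) = ostr X;
  tr_VK : forall U : object G (str C), good U -> Phi (Psi (ostr U)) = ostr U;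
  tr_hom : forall (X Y : object G (str D)) (f : X -> Y), good X -> good Y ->
    is_hom f <-> is_hom (U := Phi_obj X) (V := Phi_obj Y) f;
  tr_unit : Phi (sunit D) = sunit C;
  tr_tens : forall X Y, good X -> good Y ->
    Phi (@stens _ _ D X Y) = stens (Phi_obj X) (Phi_obj Y);
  tr_conj : forall g X, good X -> Phi (@sconj _ _ D g X) = sconj g (Phi_obj X);
  tr_braid : forall (X Y : object G (str D)) (t : htens X Y), good X -> good Y ->
    @sbraid _ _ D X Y t = @sbraid _ _ C (Phi_obj X) (Phi_obj Y) t }.

Hypothesis tr : is_transport.

(** Allows a structure of C to be written as an image, after which each statement
    about C becomes the corresponding one about D through the lemmas [_corr].
    Keeping the equation [Phi s' = s] apart, instead of substituting it, lets
    these lemmas be applied to compound objects in turn. *)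
Lemma Phi_surj (M : homSpace k) (g : G) (s : str C M) : good (Object g s) ->
  exists2 s', good (Object g s') & Phi s' = s.
Proof. by move=> gU; exists (Psi s); [apply: (tr_goodV tr gU) | apply: (tr_VK tr gU)]. Qed.

Section Corresponding.
Variables (M N : homSpace k) (g h : G) (s : str C M) (t : str C N).
Variables (s' : str D M) (t' : str D N).
Hypotheses (gs : good (Object g s')) (gt : good (Object h t')).
Hypotheses (es : Phi s' = s) (et : Phi t' = t).

Lemma hom_corr (f : M -> N) :
  is_hom (U := Object g s) (V := Object h t) f <->
  is_hom (U := Object g s') (V := Object h t') f.
Proof. by rewrite -es -et; symmetry; apply: (tr_hom tr). Qed.

Lemma good_corr : good (Object g s).
Proof. by rewrite -es; apply: (tr_good tr gs). Qed.

Lemma tens_corr : Phi (@stens _ _ D (Object g s') (Object h t')) =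
  @stens _ _ C (Object g s) (Object h t).
Proof. by rewrite (tr_tens tr gs gt) /Phi_obj /= es et. Qed.

Lemma conj_corr x : Phi (@sconj _ _ D x (Object g s')) = @sconj _ _ C x (Object g s).
Proof. by rewrite (tr_conj tr _ gs) /Phi_obj /= es. Qed.

Lemma braid_corr (z : htens M N) :
  @sbraid _ _ C (Object g s) (Object h t) z =
  @sbraid _ _ D (Object g s') (Object h t') z.
Proof. by rewrite -es -et; symmetry; apply: (tr_braid tr _ gs gt). Qed.
End Corresponding.

Hypothesis wdD : well_defined D.

Lemma transport_well_defined : well_defined C.
Proof.
have gu := wd_unit wdD; have eu := tr_unit tr.
have gT (X Y : object G (str D)) : good X -> good Y -> good (tens_obj X Y).
  by apply: wd_tens.
have gC g (X : object G (str D)) : good X -> good (conj_obj g X) by apply: wd_conj.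
split.
- move=> [a M s] /Phi_surj [s' gs es].
  by apply/(hom_corr gs gs es es); apply: (wd_id wdD gs).
- move=> [a M s] [b N t] [c P r] g f.
  move=> /Phi_surj [s' gs es] /Phi_surj [t' gt et] /Phi_surj [r' gr er].
  move=> /(hom_corr gt gr et er) hg /(hom_corr gs gt es et) hf.
  by apply/(hom_corr gs gr es er); apply: (wd_comp wdD gs gt gr hg hf).
- exact: (good_corr gu eu).
- move=> [a M s] [b N t] /Phi_surj [s' gs es] /Phi_surj [t' gt et].
  exact: (good_corr (gT _ _ gs gt) (tens_corr gs gt es et)).
- move=> [a M s] [a1 M1 s1] [b N t] [b1 N1 t1] f g.
  move=> /Phi_surj [s' gs es] /Phi_surj [s1' gs1 es1].
  move=> /Phi_surj [t' gt et] /Phi_surj [t1' gt1 et1].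
  move=> /(hom_corr gs gs1 es es1) hf /(hom_corr gt gt1 et et1) hg.
  apply/(hom_corr (gT _ _ gs gt) (gT _ _ gs1 gt1)
    (tens_corr gs gt es et) (tens_corr gs1 gt1 es1 et1)).
  exact: (wd_tmap wdD gs gs1 gt gt1 hf hg).
- move=> [a M s] [b N t] [c P r].
  move=> /Phi_surj [s' gs es] /Phi_surj [t' gt et] /Phi_surj [r' gr er].
  apply/(hom_corr (gT _ _ (gT _ _ gs gt) gr) (gT _ _ gs (gT _ _ gt gr))
    (tens_corr (gT _ _ gs gt) gr (tens_corr gs gt es et) er)
    (tens_corr gs (gT _ _ gt gr) es (tens_corr gt gr et er))).
  exact: (wd_assoc wdD gs gt gr).
- move=> [a M s] [b N t] [c P r].
  move=> /Phi_surj [s' gs es] /Phi_surj [t' gt et] /Phi_surj [r' gr er].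
  apply/(hom_corr (gT _ _ gs (gT _ _ gt gr)) (gT _ _ (gT _ _ gs gt) gr)
    (tens_corr gs (gT _ _ gt gr) es (tens_corr gt gr et er))
    (tens_corr (gT _ _ gs gt) gr (tens_corr gs gt es et) er)).
  exact: (wd_assocV wdD gs gt gr).
- move=> [a M s] /Phi_surj [s' gs es].
  apply/(hom_corr (gT _ _ gu gs) gs (tens_corr gu gs eu es) es).
  exact: (wd_lunit wdD gs).
- move=> [a M s] /Phi_surj [s' gs es].
  apply/(hom_corr (gT _ _ gs gu) gs (tens_corr gs gu es eu) es).
  exact: (wd_runit wdD gs).
- move=> g [a M s] /Phi_surj [s' gs es].
  exact: (good_corr (gC g _ gs) (conj_corr gs es g)).
- move=> g [a M s] [b N t] f /Phi_surj [s' gs es] /Phi_surj [t' gt et].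
  move=> /(hom_corr gs gt es et) hf.
  apply/(hom_corr (gC g _ gs) (gC g _ gt) (conj_corr gs es g) (conj_corr gt et g)).
  exact: (wd_conj_hom wdD g gs gt hf).
- move=> [a M s] [b N t] /Phi_surj [s' gs es] /Phi_surj [t' gt et].
  rewrite (funext (braid_corr gs gt es et)).
  apply/(hom_corr (gT _ _ gs gt) (gT _ _ (gC a _ gt) gs) (tens_corr gs gt es et)
    (tens_corr (gC a _ gt) gs (conj_corr gt et a) es)).
  exact: (wd_braid wdD gs gt).
Qed.

Lemma transport_braided_structure :
  is_braided_structure D -> is_braided_structure C.
Proof.
move=> bs; have gu := wd_unit wdD; have eu := tr_unit tr.
have gT (X Y : object G (str D)) : good X -> good Y -> good (tens_obj X Y).
  by apply: wd_tens.
have gC g (X : object G (str D)) : good X -> good (conj_obj g X) by apply: wd_conj.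
split.
- move=> g [a M s] [b N t] /Phi_surj [s' gs es] /Phi_surj [t' gt et].
  apply: (etrans (esym (conj_corr (gT _ _ gs gt) (tens_corr gs gt es et) g))).
  apply: (etrans (congr1 Phi (bs_conj_tens bs g gs gt))).
  exact: (tens_corr (gC g _ gs) (gC g _ gt) (conj_corr gs es g) (conj_corr gt et g)).
- move=> g; apply: (etrans (esym (conj_corr gu eu g))).
  exact: (etrans (congr1 Phi (bs_conj_unit bs g)) eu).
- move=> [a M s] /Phi_surj [s' gs es]; apply: (etrans (esym (conj_corr gs es _))).
  exact: (etrans (congr1 Phi (bs_conj_1 bs gs)) es).
- move=> g h [a M s] /Phi_surj [s' gs es]; apply: (etrans (esym (conj_corr gs es _))).
  apply: (etrans (congr1 Phi (bs_conj_M bs g h gs))).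
  exact: (conj_corr (gC h _ gs) (conj_corr gs es h) g).
- move=> [a M s] [b N t] f g /Phi_surj [s' gs es] /Phi_surj [t' gt et].
  move=> /(hom_corr gs gt es et) hf fK gK; apply/(hom_corr gt gs et es).
  exact: (bs_hom_inv bs gs gt hf fK gK).
- move=> [a M s] [b N t] /Phi_surj [s' gs es] /Phi_surj [t' gt et].
  have [c cK Kc] := bs_braid_inv bs gs gt.
  by rewrite (funext (braid_corr gs gt es et)); exists c.
- move=> [a M s] [a1 M1 s1] [b N t] [b1 N1 t1] f g z.
  move=> /Phi_surj [s' gs es] /Phi_surj [s1' gs1 es1].
  move=> /Phi_surj [t' gt et] /Phi_surj [t1' gt1 et1].
  move=> /(hom_corr gs gs1 es es1) hf /(hom_corr gt gt1 et et1) hg.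
  rewrite (braid_corr gs gt es et) (braid_corr gs1 gt1 es1 et1).
  exact: (@bs_braid_nat _ _ _ bs (Object a s') (Object a1 s1') (Object b t')
    (Object b1 t1') f g z gs gs1 gt gt1 hf hg).
- move=> [a M s] [b N t] [c P r] z.
  move=> /Phi_surj [s' gs es] /Phi_surj [t' gt et] /Phi_surj [r' gr er].
  have e1 := funext (braid_corr gs (gC b _ gr) es (conj_corr gr er b)).
  have e2 := funext (braid_corr gt gr et er).
  have e3 := braid_corr (gT _ _ gs gt) gr (tens_corr gs gt es et) er.
  apply: (etrans (e3 z)); apply: (etrans (@bs_braid_tobl _ _ _ bs (Object a s') (Object b t')
    (Object c r') z gs gt gr)).
  by rewrite -e2 -e1.
- move=> [a M s] [b N t] [c P r] z.
  move=> /Phi_surj [s' gs es] /Phi_surj [t' gt et] /Phi_surj [r' gr er].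
  have e1 := funext (braid_corr gs gt es et).
  have e2 := funext (braid_corr gs gr es er).
  have e3 := braid_corr gs (gT _ _ gt gr) es (tens_corr gt gr et er).
  apply: (etrans (e3 z)); apply: (etrans (@bs_braid_tobr _ _ _ bs (Object a s') (Object b t')
    (Object c r') z gs gt gr)).
  by rewrite -e2 -e1.
- move=> g [a M s] [b N t] z /Phi_surj [s' gs es] /Phi_surj [t' gt et].
  apply: (etrans (braid_corr (gC g _ gs) (gC g _ gt)
    (conj_corr gs es g) (conj_corr gt et g) z)).
  rewrite (braid_corr gs gt es et); exact: (@bs_conj_braid _ _ _ bs g (Object a s') (Object b t')
    z gs gt).
Qed.

Section Isomorphism.
Variable wdC : well_defined C.

Lemma Psi_eq (g : G) (M : homSpace k) (s : str C M) (s' : str D M) :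
  good (Object g s') -> Phi s' = s -> Psi s = s'.
Proof. by move=> gs <-; apply: (tr_K tr gs). Qed.

Lemma Psi_good (U : sob C) : good (Psi_obj (sval U)).
Proof. exact: tr_goodV (svalP U). Qed.

Lemma Psi_VK (U : sob C) : Phi (Psi (ostr (sval U))) = ostr (sval U).
Proof. exact: tr_VK (svalP U). Qed.

Definition Psi_sob (U : sob C) : sob D := exist _ (Psi_obj (sval U)) (Psi_good U).

Lemma Psi_is_hom (U V : sob C) (f : shom U V) :
  is_hom (U := sval (Psi_sob U)) (V := sval (Psi_sob V)) (sval f).
Proof.
apply/(hom_corr (Psi_good U) (Psi_good V) (Psi_VK U) (Psi_VK V)).
by case: U V f => [[a M s] p] [[b N t] q] [f Hf].
Qed.

Definition Psi_shom (U V : sob C) (f : shom U V) : shom (Psi_sob U) (Psi_sob V) :=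
  exist _ (sval f) (Psi_is_hom f).

Definition Psi_functor : tfunctor (tcat_of wdC) (tcat_of wdD).
Proof.
apply: (@TFunctor _ (tcat_of wdC) (tcat_of wdD) Psi_sob Psi_shom).
- by move=> U; apply: shom_eq.
- by move=> U V W f g; apply: shom_eq.
Defined.

Definition Phi_sob (X : sob D) : sob C :=
  exist _ (Phi_obj (sval X)) (tr_good tr (svalP X)).

Definition Phi_shom (X Y : sob D) (f : shom X Y) : shom (Phi_sob X) (Phi_sob Y) :=
  exist _ (sval f) (proj1 (tr_hom tr (sval f) (svalP X) (svalP Y)) (svalP f)).

Definition Phi_functor : tfunctor (tcat_of wdD) (tcat_of wdC).
Proof.
apply: (@TFunctor _ (tcat_of wdD) (tcat_of wdC) Phi_sob Phi_shom).
- by move=> U; apply: shom_eq.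
- by move=> U V W f g; apply: shom_eq.
Defined.

Lemma Psi_tens (U V : sob C) : Psi (@stens _ _ C (sval U) (sval V)) =
  @stens _ _ D (Psi_obj (sval U)) (Psi_obj (sval V)).
Proof.
case: U V => [[a M s] p] [[b N t] q] /=.
have [gs gt] := (tr_goodV tr p, tr_goodV tr q).
exact: (Psi_eq (wd_tens wdD gs gt) (tens_corr gs gt (tr_VK tr p) (tr_VK tr q))).
Qed.

Lemma Psi_conj g (U : sob C) :
  Psi (@sconj _ _ C g (sval U)) = @sconj _ _ D g (Psi_obj (sval U)).
Proof.
case: U => [[a M s] p] /=; have gs := tr_goodV tr p.
exact: (Psi_eq (wd_conj wdD g gs) (conj_corr gs (tr_VK tr p) g)).
Qed.

Lemma Psi_unit : Psi (sunit C) = sunit D.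
Proof. exact: (Psi_eq (wd_unit wdD) (tr_unit tr)). Qed.

Lemma Psi_tens3l (U V W : sob C) :
  Psi (@stens _ _ C (tens_obj (sval U) (sval V)) (sval W)) =
  @stens _ _ D (tens_obj (Psi_obj (sval U)) (Psi_obj (sval V))) (Psi_obj (sval W)).
Proof.
apply: (etrans (Psi_tens (tob (t := tcat_of wdC) U V) W)).
exact: (@stens_congl _ _ D (htens (sval U) (sval V)) _ _ _ _ (Psi_obj (sval W)) erefl
  (Psi_tens U V)).
Qed.

Lemma Psi_tens3r (U V W : sob C) :
  Psi (@stens _ _ C (sval U) (tens_obj (sval V) (sval W))) =
  @stens _ _ D (Psi_obj (sval U)) (tens_obj (Psi_obj (sval V)) (Psi_obj (sval W))).
Proof.
apply: (etrans (Psi_tens U (tob (t := tcat_of wdC) V W))).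
exact: (@stens_congr _ _ D (htens (sval V) (sval W)) _ _ _ _ (Psi_obj (sval U)) erefl
  (Psi_tens V W)).
Qed.

Lemma Psi_tens_unitl (U : sob C) :
  Psi (@stens _ _ C (unit_obj C) (sval U)) = @stens _ _ D (unit_obj D) (Psi_obj (sval U)).
Proof.
apply: (etrans (Psi_tens (unit_ob (tcat_of wdC)) U)).
exact: (@stens_congl _ _ D (hunit k) _ _ _ _ (Psi_obj (sval U)) erefl Psi_unit).
Qed.

Lemma Psi_tens_unitr (U : sob C) :
  Psi (@stens _ _ C (sval U) (unit_obj C)) = @stens _ _ D (Psi_obj (sval U)) (unit_obj D).
Proof.
apply: (etrans (Psi_tens U (unit_ob (tcat_of wdC)))).
exact: (@stens_congr _ _ D (hunit k) _ _ _ _ (Psi_obj (sval U)) erefl Psi_unit).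
Qed.

Lemma Psi_tens_conj g (U V : sob C) :
  Psi (@stens _ _ C (conj_obj g (sval V)) (sval U)) =
  @stens _ _ D (conj_obj g (Psi_obj (sval V))) (Psi_obj (sval U)).
Proof.
apply: (etrans (Psi_tens (cob (t := tcat_of wdC) g V) U)).
exact: (@stens_congl _ _ D (sval V) _ _ _ _ (Psi_obj (sval U)) erefl (Psi_conj g V)).
Qed.

Lemma Psi_preserves : preserves_braidedT Psi_functor.
Proof.
split.
- by [].
- by move=> U V; apply: sob_eq => //; apply: Psi_tens.
- by move=> U U' V V' f g; apply: arr_eq => //; apply: Psi_tens.
- by apply: sob_eq => //; apply: Psi_unit.
- by move=> U V W; apply: arr_eq => //; [apply: Psi_tens3l | apply: Psi_tens3r].
- by move=> U; apply: arr_eq => //; apply: Psi_tens_unitl.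
- by move=> U; apply: arr_eq => //; apply: Psi_tens_unitr.
- by move=> g U; apply: sob_eq => //; apply: (Psi_conj g U).
- by move=> g U V f; apply: arr_eq => //; [apply: (Psi_conj g U) | apply: (Psi_conj g V)].
- move=> U V; apply: arr_eq => //; [exact: Psi_tens | exact: Psi_tens_conj |].
  case: U V => [[a M s] p] [[b N t] q] z.
  exact: (braid_corr (tr_goodV tr p) (tr_goodV tr q) (tr_VK tr p) (tr_VK tr q) z).
Qed.

Theorem transport_isomorphic : braidedT_isomorphic (tcat_of wdC) (tcat_of wdD).
Proof.
exists Psi_functor, Phi_functor; split; last exact: Psi_preserves.
split.
- by move=> [[a M s] p]; apply: sob_eq => //; apply: (tr_VK tr p).
- by move=> [[a M s] p]; apply: sob_eq => //; apply: (tr_K tr p).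
- move=> [[a M s] p] [[b N t] q] [f Hf].
  by apply: arr_eq => //; [apply: (tr_VK tr p) | apply: (tr_VK tr q)].
- move=> [[a M s] p] [[b N t] q] [f Hf].
  by apply: arr_eq => //; [apply: (tr_K tr p) | apply: (tr_K tr q)].
Qed.

End Isomorphism.
End Transport.

(** * The dual of a finite-dimensional Hopf algebra *)

Lemma lin_lfun_arg (k : fieldType) (V : vectType k) (Q : lmodType k)
    (f : 'Hom(V, k^o)) (E : Q -> V) :
  linear E -> linear ((fun x => f (E x)) : Q -> k^o).
Proof. by move=> lE c x y; rewrite lE linearP. Qed.

Lemma lin_lfun_fun (k : fieldType) (V : vectType k) (Q : lmodType k)
    (E : Q -> 'Hom(V, k^o)) v :
  linear E -> linear ((fun x => E x v) : Q -> k^o).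
Proof. by move=> lE c x y; rewrite lE add_lfunE scale_lfunE. Qed.

Ltac lin_ext ::=
  lazymatch goal with
  | |- GRing.linear_for _ (fun lin_var => eps _ _) => apply: lin_eps; lin
  | |- GRing.linear_for _ (fun lin_var => fun_of_lfun (@?E lin_var) (@?F lin_var)) =>
      lazymatch E with
      | (fun _ => ?f) => apply: lin_lfun_arg; lin
      | _ => apply: lin_lfun_fun; lin
      end
  end.

Section Dual.
Variables (k : fieldType) (V : vectType k) (H : homHopf V) (Sinv : V -> V).
Hypotheses (SK : cancel (apode H) Sinv) (SinvK : cancel Sinv (apode H)).
Local Notation "a ** b" := (omul H a b) (at level 40, left associativity).
Local Notation G := (autPair H).
Local Notation dual := 'Hom(V, k^o).
Local Notation eb := (@ebase k V).
Local Notation ed := (@edual k V).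

Lemma edualE i v : ed i v = coord (vbasis {:V}) i v.
Proof. by rewrite linfunE // => c x y; rewrite linearD linearZ. Qed.

(** The canonical element of H* (x) H, contracted with a vector. *)
Lemma dual_basisV (P : lmodType k) (F : V -> P) v : linear F ->
  \sum_i (ed i v : k) *: F (eb i) = F v.
Proof.
move=> lF; rewrite [in RHS](coord_vbasis (memvf v)) linear_sumE //.
by apply: eq_bigr => i _; rewrite edualE linearZE.
Qed.

(** Contraction of the canonical element with a functional. *)
Lemma dual_basisD (P : lmodType k) (F : dual -> P) (f : dual) : linear F ->
  \sum_i (f (eb i) : k) *: F (ed i) = F f.
Proof.
move=> lF; under eq_bigr => i _ do rewrite -linearZE //.
rewrite -linear_sumE //; congr (F _); apply/lfunP => v.
rewrite sum_lfunE -[in RHS](@dual_basisV _ (fun v => f v : k^o)); last lin.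
by apply: eq_bigr => i _; rewrite scale_lfunE /GRing.scale /= mulrC.
Qed.

Lemma depsE h : (deps H : dual) h = eps H h.
Proof. by rewrite linfunE //; lin. Qed.

Lemma dcompxE (f : dual) (u : V -> V) x : linear u -> dcomp f u x = f (u x).
Proof. by move=> lu; rewrite dcompE. Qed.

Lemma harplE h (f : dual) x : harpl H h f x = f (xiV H x ** h).
Proof.
rewrite /harpl (@linear_tfold _ _ _ _ _ (fun phi : dual => (phi x : k^o))); last lin.
transitivity (\tsum_(f1, f2 <- dual_delta H f)
  ((f1 : dual) (xiV H (xiV H x)) * (f2 : dual) (xiV H h) : k^o)).
  apply: eq_tfold => f1 f2; rewrite scale_lfunE dcompxE; last lin.
  by rewrite /GRing.scale /= mulrC.
by rewrite dual_deltaE amulE -xiV_mul xiVK.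
Qed.

Lemma harprE (f : dual) h x : harpr H f h x = f (h ** xiV H x).
Proof.
rewrite /harpr (@linear_tfold _ _ _ _ _ (fun phi : dual => (phi x : k^o))); last lin.
transitivity (\tsum_(f1, f2 <- dual_delta H f)
  ((f1 : dual) (xiV H h) * (f2 : dual) (xiV H (xiV H x)) : k^o)).
  apply: eq_tfold => f1 f2; rewrite scale_lfunE dcompxE; last lin.
  by rewrite /GRing.scale.
by rewrite dual_deltaE amulE -xiV_mul xiVK.
Qed.

Lemma harpl_bilin : bilin (harpl H).
Proof.
split=> [f|h] c x y; apply/lfunP => z; rewrite [RHS]add_lfunE [X in _ = X + _]scale_lfunE.
  rewrite (harplE (c *: x + y) f z) (harplE x f z) (harplE y f z).
  by apply: (lin_lfun_arg f (E := fun h => xiV H z ** h)); lin.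
apply: (etrans (harplE _ _ _)); rewrite [LHS]add_lfunE [X in X + _]scale_lfunE.
by congr (_ *: _ + _); apply/esym/harplE.
Qed.

Lemma harpr_bilin : bilin (harpr H).
Proof.
split=> [h|f] c x y; apply/lfunP => z; rewrite [RHS]add_lfunE [X in _ = X + _]scale_lfunE.
  apply: (etrans (harprE _ _ _)); rewrite [LHS]add_lfunE [X in X + _]scale_lfunE.
  by congr (_ *: _ + _); apply/esym/harprE.
rewrite (harprE f (c *: x + y) z) (harprE f x z) (harprE f y z).
by apply: (lin_lfun_arg f (E := fun h => h ** xiV H z)); lin.
Qed.

Lemma dual_mul_bilin : bilin (dual_mul H).
Proof.
split=> [g|f] c x y; apply/lfunP => z; rewrite add_lfunE scale_lfunE !dual_mulE.
  by apply: (lin_tfold_l (F := fun x : dual => fun a b => (x a * g b : k^o))); lin.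
by apply: (lin_tfold_l (F := fun x : dual => fun a b => (f a * x b : k^o))); lin.
Qed.

#[local] Hint Resolve harpl_bilin harpr_bilin dual_mul_bilin : lindb.

(** The functional y |-> f(y_1) g(a y_2 b) in untwisted terms: the product of f with
    g translated on both sides, the only combination of dual operations that the
    product of the double and its action require. *)
Definition odm (f : dual) (a : V) (g : dual) (b : V) : dual :=
  linfun ((fun y => \tsum_(y1, y2 <- ocop H y) (f y1 * g (a ** y2 ** b) : k^o)) : V -> k^o).

Lemma odmE f a g b y :
  odm f a g b y = \tsum_(y1, y2 <- ocop H y) (f y1 * g (a ** y2 ** b) : k^o).
Proof. by rewrite linfunE //; lin. Qed.

Section OdmLinear.
Variables (Q : lmodType k) (E : Q -> dual) (E' : Q -> V) (f g : dual) (a b : V).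

Lemma lin_odm1 : linear E -> linear (fun x => odm (E x) a g b).
Proof.
move=> lE c x y; apply/lfunP => z.
rewrite [RHS]add_lfunE [X in _ = X + _]scale_lfunE !odmE; move: c x y.
by apply: (lin_tfold_l (F := fun x y1 y2 => (E x y1 * g (a ** y2 ** b) : k^o))); lin.
Qed.

Lemma lin_odm2 : linear E' -> linear (fun x => odm f (E' x) g b).
Proof.
move=> lE c x y; apply/lfunP => z.
rewrite [RHS]add_lfunE [X in _ = X + _]scale_lfunE !odmE; move: c x y.
by apply: (lin_tfold_l (F := fun x y1 y2 => (f y1 * g (E' x ** y2 ** b) : k^o))); lin.
Qed.

Lemma lin_odm3 : linear E -> linear (fun x => odm f a (E x) b).
Proof.
move=> lE c x y; apply/lfunP => z.
rewrite [RHS]add_lfunE [X in _ = X + _]scale_lfunE !odmE; move: c x y.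
by apply: (lin_tfold_l (F := fun x y1 y2 => (f y1 * E x (a ** y2 ** b) : k^o))); lin.
Qed.

Lemma lin_odm4 : linear E' -> linear (fun x => odm f a g (E' x)).
Proof.
move=> lE c x y; apply/lfunP => z.
rewrite [RHS]add_lfunE [X in _ = X + _]scale_lfunE !odmE; move: c x y.
by apply: (lin_tfold_l (F := fun x y1 y2 => (f y1 * g (a ** y2 ** E' x) : k^o))); lin.
Qed.
End OdmLinear.

Lemma lin_dcomp (Q : lmodType k) (E : Q -> dual) (u : V -> V) :
  linear u -> linear E -> linear (fun x => dcomp (E x) u).
Proof. by move=> lu lE c x y; rewrite lE dcomp_linear. Qed.

Ltac lin_ext ::=
  lazymatch goal with
  | |- GRing.linear_for _ (fun lin_var => eps _ _) => apply: lin_eps; lin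
  | |- GRing.linear_for _ (fun lin_var => dcomp _ _) => apply: lin_dcomp; lin
  | |- GRing.linear_for _ (fun lin_var =>
         odm (@?f lin_var) (@?a lin_var) (@?g lin_var) (@?b lin_var)) =>
      lazymatch f with
      | (fun _ => ?f') => lazymatch a with
        | (fun _ => ?a') => lazymatch b with
          | (fun _ => ?b') => apply: lin_odm3; lin
          | _ => apply: lin_odm4; lin
          end
        | _ => apply: lin_odm2; lin
        end
      | _ => apply: lin_odm1; lin
      end
  | |- GRing.linear_for _ (fun lin_var => fun_of_lfun (@?E lin_var) (@?F lin_var)) =>
      lazymatch E with
      | (fun _ => ?f) => apply: lin_lfun_arg; lin
      | _ => apply: lin_lfun_fun; lin
      end
  end.

Lemma mhd_mul_bilin (p : G) : bilin (mhd_mul Sinv p).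
Proof.
have lS := skew_linear SK SinvK; have ba := amul_bil H.
rewrite /mhd_mul; lin.
Qed.

(** The powers of [xi] in the product of the double match those in the two
    translations of functionals. *)
Lemma odm_dcomp (f g : dual) a b :
  dcomp (dual_mul H f (harpl H b (harpr H (dcomp g (fun z => xi H (xi H z))) a))) (xi H) =
  odm f (xi H (xi H a)) g (xi H b).
Proof.
apply/lfunP => y; rewrite dcompxE; last lin.
rewrite dual_mulE odmE tfold_delta ?ocop_xi; try lin.
apply: eq_tfold => y1 y2; rewrite xiK harplE harprE dcompxE; last lin.
by rewrite xi_mul xiVK !xi_mul !xiVK !xiK omulA.
Qed.

(** Untwisted, the double is a Drinfeld double whose commutation rule is twisted
    by the two automorphisms of the grade. *)
Lemma mhd_omulE (p : G) (f g : dual) (h l : V) :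
  xiV (MHD Sinv p) (mhd_mul Sinv p (tens f h) (tens g l)) =
  \tsum_(h1, h2 <- ocop H h) \tsum_(h21, h22 <- ocop H h2)
    tens (odm f (Sinv (be p h22)) g (al p h1)) (h21 ** l).
Proof.
have lS := skew_linear SK SinvK; have ba := amul_bil H.
rewrite /mhd_mul tfold_tens; last lin.
rewrite tfold_tens; last lin.
have lx : linear (xiV (MHD Sinv p)) by apply: xiV_lin.
rewrite linear_tfold // tfold_ocop; last lin.
apply: eq_tfold => h1 h2; rewrite linear_tfold // ocop_xi ?tfold_ocop; try lin.
apply: eq_tfold => h21 h22; rewrite /= tmap_tens; try lin.
  by rewrite odm_dcomp !autf_xi -!(skew_aut SK SinvK (xiAut H)).
Qed.

(** * Representations of the double as Yetter-Drinfeld modules *)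

Local Notation object := (object G (ydStr V)).
Local Notation robject := (Defs.object G (repStr V)).
Local Notation act M := (oact (yact (ostr M))).
Local Notation rho M := (oco H (yrho (ostr M))).
Local Notation oyd M := (is_oyd (al (ograde M)) (be (ograde M)) (ostr M)).
Local Notation one := (aone H).

(** The outer [xi] twists the action back: untwisted, [f >< h] sends [u] to
    [f((h u)_1) (h u)_0]. *)
Definition rep_of (M : homSpace k) (s : ydStr V M) : repStr V M :=
  fun x u => xi M (\tsum_(f, h <- x) \tsum_(u0, u1 <- oco H (yrho s) (oact (yact s) h u))
    (((f : dual) u1 : k) *: u0)).

(** The powers of [xi^-1] twist back both the action of [e^i] and the coaction, so
    that the untwisted coaction is [u |-> (e^i . u) (x) e_i]. *)
Definition yd_of (M : homSpace k) (r : repStr V M) : ydStr V M :=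
  @YDStr k V M (fun h u => r (tens (deps H) h) u)
    (fun u => \sum_i tens (xiV M (xiV M (r (tens (ed i) one) u))) (xiV H (eb i))).

Section RepOf.
Variables (M : object) (yM : oyd M).
Let bM := oyd_oact_bilin yM. Let lM := oyd_oco_linear yM.
Local Notation R := (Object (ograde M) (rep_of (ostr M)) : robject).

Lemma rep_of_act x u : oact (ostr R) x u =
  \tsum_(f, h <- x) \tsum_(u0, u1 <- rho M (act M h u)) (((f : dual) u1 : k) *: u0).
Proof. by rewrite /oact /= xiK. Qed.

Lemma rep_of_actE f h u : oact (ostr R) (tens f h) u =
  \tsum_(u0, u1 <- rho M (act M h u)) (((f : dual) u1 : k) *: u0).
Proof. by rewrite rep_of_act tfold_tens //; lin. Qed.

Lemma rep_of_bilin : bilin (oact (ostr R)).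
Proof.
have e : oact (ostr R) = fun x u =>
  \tsum_(f, h <- x) \tsum_(u0, u1 <- rho M (act M h u)) (((f : dual) u1 : k) *: u0).
  by apply: funext => x; apply: funext => u; rewrite rep_of_act.
by rewrite e; lin.
Qed.

(** Acting twice evaluates [g] on [v_1] and [f] on the coaction of [h v_0], where
    [v_0 (x) v_1] is the coaction of [l u]. The third form of the compatibility
    condition moves [h] under this coaction, and coassociativity then merges
    the two evaluations into that of the product in the double. *)
Lemma rep_of_omod : is_omodule (MHD Sinv (ograde M)) (ostr R).
Proof.
have lS := skew_linear SK SinvK; have bR := rep_of_bilin.
have cM := oyd_comod yM; have aM := oyd_mod yM.
have ycond : yd_cond_comm Sinv (al (ograde M)) (be (ograde M)) (ostr M).
  by apply/(yd_cond_mul_comm SK SinvK _ _ aM cM) => P F h m; apply: oyd_cond.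
have bm : bilin (amul (MHD Sinv (ograde M))) by apply: mhd_mul_bilin.
have lxi := xi_lin (MHD Sinv (ograde M)); have lxiV := xiV_lin (MHD Sinv (ograde M)).
split=> //.
- move=> x y u; move: x; apply: linear_eq_tens; try lin.
  move=> f h; move: y; apply: linear_eq_tens; try lin.
  move=> g l; rewrite mhd_omulE.
  rewrite (@linear_tfold _ _ _ _ _ (fun x => oact (ostr R) x u)); last lin.
  pose K h w := \tsum_(u0, u1 <- rho M (act M h w)) ((f u1 : k) *: u0).
  have lK h' : linear (K h') by rewrite /K; lin.
  transitivity (\tsum_(v0, v1 <- rho M (act M l u)) ((g v1 : k) *: K h v0)); last first.
    rewrite !rep_of_actE -/(K h _) linear_tfold //.
    by apply: eq_tfold => v0 v1; rewrite (linearZE _ _ (lK h)).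
  transitivity (\tsum_(v0, v1 <- rho M (act M l u)) \tsum_(u0, u1 <- rho M (act M h v0))
    ((g v1 * f u1 : k) *: u0)); last first.
    apply: eq_tfold => v0 v1; rewrite /K (@linear_tfold _ _ _ _ _ (fun x => (g v1 : k) *: x)); last lin.
    by apply: eq_tfold => u0 u1; rewrite scalerA.
  rewrite (ycond _ (fun v0 v1 => \tsum_(u0, u1 <- rho M v0) ((g v1 * f u1 : k) *: u0)));
    last lin.
  apply: eq_tfold => h1 h2.
  rewrite (@linear_tfold _ _ _ _ _ (fun x => oact (ostr R) x u)); last lin.
  apply: eq_tfold => h21 h22; rewrite rep_of_actE -(oact_mul aM).
  rewrite -(oco_coassoc cM (F := fun u0 u1 u2 =>
    (g (be (ograde M) (Sinv h22) ** u2 ** al (ograde M) h1) * f u1 : k) *: u0)); last lin.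
  apply: eq_tfold => u0 u1; rewrite odmE.
  rewrite (@linear_tfold _ _ _ _ _ (fun c : k^o => (c : k) *: u0)); last lin.
  by apply: eq_tfold => y1 y2; rewrite mulrC (skew_aut SK SinvK).
- move=> x u; move: x; apply: linear_eq_tens; try lin.
  move=> f h; rewrite rep_of_actE.
  have -> : xi (MHD Sinv (ograde M)) (tens f h) = tens (dcomp f (xiV H)) (xi H h).
    by apply: tmap_tens; [exact/dcomp_linear/xiV_lin | exact: xi_lin].
  rewrite rep_of_actE -(oact_xi aM) (oco_xi cM); last lin.
  rewrite linear_tfold; last lin.
  apply: eq_tfold => u0 u1; rewrite (linearZE _ _ (xi_lin M)) dcompxE ?xiK //.
  exact: xiV_lin.
- move=> u; rewrite rep_of_actE (oact_1 aM).
  rewrite -[RHS](oco_counit cM _ (@lin_id k M)).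
  by apply: eq_tfold => u0 u1; rewrite depsE.
Qed.
End RepOf.

Lemma skew_eps h : eps H (Sinv h) = eps H h.
Proof.
have eS y : eps H (apode H y) = eps H y.
  have lS := apode_lin H.
  transitivity (\tsum_(y1, y2 <- ocop H y) (eps H (apode H y1 ** y2) : k^o)).
    rewrite -[LHS](@ocounit_r _ _ H _ (fun y => eps H (apode H y) : k^o)); last lin.
    by apply: (@eq_tfold k V V k^o) => y1 y2; rewrite eps_omul mulrC.
  rewrite (@apode_mull _ _ _ k^o (fun y => eps H y : k^o)); last lin.
  by rewrite eps_1 /GRing.scale /= mulr1.
by rewrite -[in RHS](SinvK h) eS.
Qed.

Lemma skew_1 : Sinv one = one.
Proof. by apply: (can_inj SK); rewrite SinvK apode_1. Qed.

Lemma odm_deps_l a (g : dual) b y : odm (deps H) a g b y = g (a ** y ** b).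
Proof.
rewrite odmE -[RHS](@ocounit_l _ _ H _ (fun y => g (a ** y ** b) : k^o)); last lin.
by apply: eq_tfold => y1 y2; rewrite depsE.
Qed.

Lemma odm_deps_r (f : dual) : odm f one (deps H) one = f.
Proof.
apply/lfunP => y.
rewrite odmE -[RHS](@ocounit_r _ _ H _ (fun y => f y : k^o)); last lin.
apply: eq_tfold => y1 y2; rewrite depsE !eps_omul eps_1 mulr1 mul1r.
by rewrite /GRing.scale /= mulrC.
Qed.

Lemma odm_deps_deps a b : odm (deps H) a (deps H) b = (eps H a * eps H b) *: deps H.
Proof.
apply/lfunP => y; rewrite odm_deps_l scale_lfunE !depsE !eps_omul /GRing.scale /=.
by rewrite mulrAC.
Qed.

Section YdOf.
Variables (R : robject) (mR : is_omodule (MHD Sinv (ograde R)) (ostr R)).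
Local Notation D f h u := (oact (ostr R) (tens f h) u).
Local Notation M := (Object (ograde R) (yd_of (ostr R)) : object).
Let bR := oact_bil mR.

Lemma double_act f h g l u : D f h (D g l u) =
  \tsum_(h1, h2 <- ocop H h) \tsum_(h21, h22 <- ocop H h2)
    D (odm f (Sinv (be (ograde R) h22)) g (al (ograde R) h1)) (h21 ** l) u.
Proof.
rewrite -(oact_mul mR) mhd_omulE.
rewrite (@linear_tfold _ _ _ _ _ (fun x => oact (ostr R) x u)); last lin.
apply: eq_tfold => h1 h2.
by rewrite (@linear_tfold _ _ _ _ _ (fun x => oact (ostr R) x u)); last lin.
Qed.

Lemma double_act_dual f g l u : D f one (D g l u) = D (odm f one g one) l u.
Proof.
have lS := skew_linear SK SinvK.
rewrite double_act !ocop_1; try lin.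
by rewrite !autf_1 skew_1 omul1l.
Qed.

(** The elements [f >< h] factor through H* and H, which act separately. *)
Lemma double_act_alg f h u : D f one (D (deps H) h u) = D f h u.
Proof. by rewrite double_act_dual odm_deps_r. Qed.

Lemma yd_of_act h u : act M h u = D (deps H) h u.
Proof. by []. Qed.

Lemma yd_of_rho (P : lmodType k) (F : M -> V -> P) u : bilin F ->
  tfold F (rho M u) = \sum_i F (D (ed i) one u) (eb i).
Proof.
move=> bF; rewrite tfold_oco // [yrho _]/= linear_sumE; last by apply: tfold_linear; lin.
apply: eq_bigr => i _; rewrite tfold_tens; last lin.
by rewrite !xiVK.
Qed.

Lemma yd_of_omod : is_omodule H (yact (ostr M)).
Proof.
have lS := skew_linear SK SinvK.
have l1 u : linear (fun h => D (deps H) h u) by lin.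
have l2 h : linear (fun u => D (deps H) h u) by lin.
have bM : bilin (act M) by split=> [u|h]; [apply: l1 | apply: l2].
split=> //.
- move=> h l u; rewrite !yd_of_act double_act -/(omul H h l).
  transitivity (\tsum_(h1, h2 <- ocop H h) \tsum_(h21, h22 <- ocop H h2)
    (eps H h1 *: (eps H h22 *: D (deps H) (h21 ** l) u))).
    rewrite -[h in LHS](@ocounit_l _ _ H _ id) //.
    rewrite (@linear_tfold _ _ _ _ _ (fun h => D (deps H) (h ** l) u)); last lin.
    apply: eq_tfold => h1 h2.
    rewrite (linearZE _ _ (_ : linear (fun h => D (deps H) (h ** l) u))); last lin.
    rewrite -[h2 in LHS](@ocounit_r _ _ H _ id) //.
    rewrite (@linear_tfold _ _ _ _ _ (fun h => eps H h1 *: D (deps H) (h ** l) u)); last lin.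
    apply: eq_tfold => h21 h22.
    by rewrite (linearZE _ _ (_ : linear (fun h => D (deps H) (h ** l) u))); last lin.
  apply: eq_tfold => h1 h2; apply: eq_tfold => h21 h22.
  rewrite odm_deps_deps skew_eps !autf_eps.
  rewrite (linearZE _ _ (_ : linear (fun f => D f (h21 ** l) u))); last lin.
  by rewrite scalerA mulrC.
- move=> h u; rewrite !yd_of_act (oact_xi mR); congr (oact _ _ _).
  rewrite /= tmap_tens; [|exact/dcomp_linear/xiV_lin | exact: xi_lin].
  by congr tens; apply/lfunP => y; rewrite dcompxE ?depsE ?xiV_eps //; apply: xiV_lin.
- by move=> u; rewrite yd_of_act; apply: (oact_1 mR).
Qed.
(** The canonical element is invariant under [xi]. *)
Lemma canonical_bilin (P : lmodType k) (F : dual -> V -> P) : bilin F ->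
  \sum_i F (dcomp (ed i) (xiV H)) (xi H (eb i)) = \sum_i F (ed i) (eb i).
Proof.
move=> bF.
transitivity (\sum_i \sum_j ((ed j (xi H (eb i)) : k) *:
    F (dcomp (ed i) (xiV H)) (eb j))).
  by apply: eq_bigr => i _; rewrite (@dual_basisV _ (F _)) //; lin.
rewrite exchange_big; apply: eq_bigr => j _ /=.
transitivity (\sum_i ((dcomp (ed j) (xi H) (eb i) : k) *:
    F (dcomp (ed i) (xiV H)) (eb j))).
  by apply: eq_bigr => i _; rewrite dcompxE //; lin.
rewrite (@dual_basisD _ (fun f => F (dcomp f (xiV H)) (eb j))); last lin.
by congr (F _ _); apply/lfunP => y; rewrite !dcompxE ?xiVK //; lin.
Qed.

(** The coproduct of H, applied to the second leg of the canonical element, is the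
    product of H* on the first. *)
Lemma canonical_cop (P : lmodType k) (F : dual -> V -> V -> P) : trilin F ->
  \sum_i \tsum_(a, b <- ocop H (eb i)) F (ed i) a b =
  \sum_i \sum_j F (odm (ed j) one (ed i) one) (eb j) (eb i).
Proof.
move=> tF.
transitivity (\sum_i \sum_l \sum_j ((odm (ed j) one (ed l) one (eb i) : k) *:
    F (ed i) (eb j) (eb l))).
  apply: eq_bigr => i _.
  transitivity (\tsum_(a, b <- ocop H (eb i)) \sum_l \sum_j
    ((ed j a * ed l b : k) *: F (ed i) (eb j) (eb l))).
    apply: eq_tfold => a b; rewrite -(@dual_basisV _ (F (ed i) a)); last lin.
    apply: eq_bigr => l _.
    rewrite -(@dual_basisV _ (fun a => F (ed i) a (eb l)) a); last lin.
    rewrite scaler_sumr; apply: eq_bigr => j _; by rewrite scalerA mulrC.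
  rewrite /tfold /sum_pairs exchange_big; apply: eq_bigr => l _ /=.
  rewrite exchange_big; apply: eq_bigr => j _ /=.
  rewrite -scaler_suml; congr (_ *: _); rewrite odmE /tfold /sum_pairs.
  by apply: eq_bigr => p _; rewrite omul1l omul1r.
rewrite exchange_big; apply: eq_bigr => l _ /=.
rewrite exchange_big; apply: eq_bigr => j _ /=.
by rewrite (@dual_basisD _ (fun f => F f (eb j) (eb l))); last lin.
Qed.

(** Translation in H, applied to the second leg of the canonical element, is the
    transposed translation on the first. *)
Lemma canonical_mul (P : lmodType k) (F : dual -> V -> P) a b : bilin F ->
  \sum_i F (ed i) (a ** eb i ** b) = \sum_i F (odm (deps H) a (ed i) b) (eb i).
Proof.
move=> bF.
transitivity (\sum_i \sum_j ((odm (deps H) a (ed j) b (eb i) : k) *: F (ed i) (eb j))).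
  apply: eq_bigr => i _; rewrite -(@dual_basisV _ (F (ed i))); last lin.
  by apply: eq_bigr => j _; rewrite odm_deps_l.
rewrite exchange_big; apply: eq_bigr => j _ /=.
by rewrite (@dual_basisD _ (fun f => F f (eb j))); last lin.
Qed.

Lemma yd_of_ocomod : is_ocomodule H (yrho (ostr M)).
Proof.
have lr : linear (rho M).
  have e (u : M) : rho M u = \sum_i tens (D (ed i) one u : M) (eb i).
    by rewrite [LHS]tensorE yd_of_rho //; apply: tens_bilin.
  by rewrite (funext e); lin.
split=> //.
- move=> P F u tF; rewrite !yd_of_rho; try lin.
  rewrite (@canonical_cop _ (fun f a b => F (D f one u) a b)); last lin.
  apply: eq_bigr => i _; rewrite yd_of_rho; last lin.
  by apply: eq_bigr => j _; rewrite double_act_dual.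
- move=> P F u lF; rewrite yd_of_rho; last lin.
  under eq_bigr => i _ do rewrite -depsE.
  rewrite (@dual_basisD _ (fun f => F (D f one u))); last lin.
  by rewrite (oact_1 mR).
- move=> P F u bF; rewrite !yd_of_rho; try lin.
  rewrite -(@canonical_bilin _ (fun f x => F (D f one (xi M u)) x)); last lin.
  apply: eq_bigr => i _; congr (F _ _); rewrite (oact_xi mR); congr (oact _ _ _).
  rewrite /= tmap_tens ?xi_1 //; [exact/dcomp_linear/xiV_lin | exact: xi_lin].
Qed.

(** The third form of the condition is the action of the double on
    [(e^i >< 1) ((eps >< h) u)] expanded by its product, the translations of
    [e^i] being moved to [e_i]. *)
Lemma yd_of_oyd : oyd M.
Proof.
have lS := skew_linear SK SinvK; have mM := yd_of_omod; have cM := yd_of_ocomod.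
split=> //; apply/(yd_cond_mul_comm SK SinvK _ _ mM cM) => P F h u bF.
rewrite yd_of_rho; last by have bM := oact_bil mM; lin.
transitivity (\tsum_(h1, h2 <- ocop H h) \tsum_(h21, h22 <- ocop H h2)
  \sum_i F (D (odm (deps H) (Sinv (be (ograde R) h22)) (ed i) (al (ograde R) h1)) h21 u)
    (eb i)).
  transitivity (\sum_i \tsum_(h1, h2 <- ocop H h) \tsum_(h21, h22 <- ocop H h2)
    F (D (odm (deps H) (Sinv (be (ograde R) h22)) (ed i) (al (ograde R) h1)) h21 u)
      (eb i)); last first.
    rewrite /tfold /sum_pairs exchange_big; apply: eq_bigr => p _ /=.
    by rewrite exchange_big.
  apply: eq_bigr => i _; rewrite yd_of_act double_act.
  rewrite (@linear_tfold _ _ _ _ _ (fun v => F v (eb i))); last lin.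
  apply: eq_tfold => h1 h2; rewrite (@linear_tfold _ _ _ _ _ (fun v => F v (eb i))); last lin.
  by apply: eq_tfold => h21 h22; rewrite omul1r.
apply: eq_tfold => h1 h2; apply: eq_tfold => h21 h22.
rewrite yd_of_rho; last lin.
rewrite -(@canonical_mul _ (fun f x => F (D f h21 u) x)); last lin.
by apply: eq_bigr => i _; rewrite yd_of_act double_act_alg (skew_aut SK SinvK).
Qed.
End YdOf.
Lemma yd_of_K (R : robject) : is_omodule (MHD Sinv (ograde R)) (ostr R) ->
  rep_of (yd_of (ostr R)) = ostr R.
Proof.
move=> mR; have bR := oact_bil mR.
apply: funext => x; apply: funext => u; rewrite [RHS]actE /rep_of; congr (xi R _).
rewrite [in RHS](tensorE x).
rewrite (@linear_tfold _ _ _ _ _ (fun x => oact (ostr R) x u)); last lin.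
apply: eq_tfold => f h.
rewrite (yd_of_rho (F := fun (u0 : R) u1 => ((f : dual) u1 : k) *: u0)); last lin.
rewrite -[RHS](@dual_basisD _ (fun f => oact (ostr R) (tens f h) u)); last lin.
by apply: eq_bigr => i _; rewrite -[in RHS](double_act_alg mR).
Qed.

Section RepOfK.
Variables (M : object) (yM : oyd M).
Let bM := oyd_oact_bilin yM. Let lM := oyd_oco_linear yM.
Local Notation R := (Object (ograde M) (rep_of (ostr M)) : robject).

Lemma rep_of_deps h u : oact (ostr R) (tens (deps H) h) u = act M h u.
Proof.
rewrite rep_of_actE // -[RHS](oco_counit (oyd_comod yM) _ (@lin_id k M)).
by apply: eq_tfold => u0 u1; rewrite depsE.
Qed.

(** Expanding the second leg of the coaction in the basis recovers it from the
    action of H*. *)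
Lemma rep_of_rho (P : lmodType k) (F : M -> V -> P) u : bilin F ->
  tfold F (rho M u) = \sum_i F (oact (ostr R) (tens (ed i) one) u) (eb i).
Proof.
move=> bF.
transitivity (\sum_i \tsum_(u0, u1 <- rho M u) ((ed i u1 : k) *: F u0 (eb i))).
  rewrite /tfold /sum_pairs exchange_big; apply: eq_bigr => p _ /=.
  by rewrite (@dual_basisV _ (F p.1)); last lin.
apply: eq_bigr => i _; rewrite rep_of_actE // (oact_1 (oyd_mod yM)).
rewrite (@linear_tfold _ _ _ _ _ (fun u => F u (eb i))); last lin.
apply: eq_tfold => u0 u1.
by rewrite (linearZE _ _ (_ : linear (fun u => F u (eb i)))) //; lin.
Qed.

Lemma rep_of_K : yd_of (rep_of (ostr M)) = ostr M.
Proof.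
apply: ydStr_eq => [h u|u].
- by rewrite [RHS]actE -rep_of_deps /oact xiVK.
- rewrite [RHS]tensorE (tfold_rho H (yrho (ostr M))); last exact: tens_bilin.
  rewrite (rep_of_rho (F := fun u0 u1 => tens (xiV M u0) (xiV H u1))) //; lin.
Qed.
End RepOfK.

Local Notation YD := (MHYD H Sinv).
Local Notation Rep := (RepMHD H Sinv).
Local Notation RO M := (Object (ograde M) (rep_of (ostr M)) : robject).

Lemma rep_of_hom (M N : object) (f : M -> N) : oyd M -> oyd N ->
  is_hom (C := YD) f <-> is_hom (C := Rep) (U := RO M) (V := RO N) f.
Proof.
move=> yM yN; have bM := oyd_oact_bilin yM; have bN := oyd_oact_bilin yN.
have lM := oyd_oco_linear yM; have lN := oyd_oco_linear yN.
split=> [/(yd_homP Sinv _ yM yN) [e [lf fx fa fr]]|[e lf fx fr]].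
- split=> // x u; rewrite /= /rep_of fx; congr (xi N _).
  rewrite linear_tfold //; apply: eq_tfold => phi h.
  rewrite -fa fr ?linear_tfold //; last lin.
  by apply: eq_tfold => u0 u1; rewrite (linearZE _ _ lf).
- apply/(yd_homP Sinv _ yM yN); split=> //.
  have fr' x u : f (oact (ostr (RO M)) x u) = oact (ostr (RO N)) x (f u).
    by rewrite /oact (ohom_xiV fx) fr.
  split=> //; first by move=> h u; rewrite -!rep_of_deps.
  move=> P F u bF; rewrite (rep_of_rho yN) // (rep_of_rho yM); last lin.
  by apply: eq_bigr => i _; rewrite fr'.
Qed.

Lemma rep_of_unit : rep_of (yd_unit H) = @rep_unit k V H.
Proof.
apply: funext => x; apply: funext => c; rewrite /rep_unit /mhd_eps.
rewrite (@linear_tfold _ _ _ _ _ (fun a : k^o => (a : k) *: (c : k^o))); last lin.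
apply: eq_tfold => f h.
apply: (etrans (yd_unit_rho (F := fun (u0 : hunit k) u1 => (f u1 : k) *: u0) _ _)).
  by have lf := @lin_lfun_arg k V V f id (@lin_id k V); lin.
by rewrite yd_unit_act scalerA mulrC.
Qed.

Lemma rep_of_actbil (M : object) : oyd M -> bilin (rep_of (ostr M)).
Proof.
by move=> /rep_of_omod /homModuleP [].
Qed.

Lemma rep_ofE (M : object) f h u : oyd M -> rep_of (ostr M) (tens f h) u =
  \tsum_(u0, u1 <- rho M (act M h u)) ((f u1 : k) *: xi M u0).
Proof.
move=> yM; rewrite (actE (rep_of (ostr M))) (rep_of_actE yM) linear_tfold; last exact: xi_lin.
by apply: eq_tfold => u0 u1; rewrite (linearZE _ _ (xi_lin M)).
Qed.

Lemma dual_delta_linear : linear (@dual_delta k V H).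
Proof. rewrite /dual_delta; lin. Qed.

(** A functional evaluated on the product [n1 ** m1] splits by the coproduct of
    H*, with the factors in the opposite order, as in the coproduct of the
    double. *)
Lemma rep_of_tens (M N : object) : oyd M -> oyd N ->
  rep_of (yd_tens M N) = @rep_tens k V H (RO M) (RO N).
Proof.
move=> yM yN; have yT := yd_tens_oyd yM yN.
have bT := rep_of_actbil yT; have bM' := rep_of_actbil yM.
have bN' := rep_of_actbil yN; have ld := dual_delta_linear.
have bM := oyd_oact_bilin yM; have bN := oyd_oact_bilin yN.
have lM := oyd_oco_linear yM; have lN := oyd_oco_linear yN; have lT := oyd_oco_linear yT.
apply: funext => x; apply: funext => t; rewrite /rep_tens /mhd_delta.
move: t; apply: linear_eq_tens; try lin.
move=> m n; rewrite [RHS]tfold_tens; last lin.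
move: x; apply: linear_eq_tens; try lin.
move=> f h; rewrite tfold_tens; last lin.
rewrite tfold_tfold; last lin.
set c := al (ograde N); pose B x := autV c (be (ograde M) (c x)).
transitivity (\tsum_(f1, f2 <- dual_delta H f) \tsum_(h1, h2 <- ocop H h)
  \tsum_(m0, m1 <- rho M (act M (c (xiV H h1)) m))
  \tsum_(n0, n1 <- rho N (act N (B (xiV H h2)) n))
    (((f1 : dual) n1 * (f2 : dual) m1 : k) *: tens (xi M m0) (xi N n0))); last first.
  apply: eq_tfold => f1 f2; rewrite tfold_tfold; last lin.
  rewrite tfold_delta; last lin.
  apply: eq_tfold => h1 h2; rewrite tfold_tens; last lin.
  rewrite /= (rep_ofE _ _ _ yM) (rep_ofE _ _ _ yN).
  have [tl tr] := tens_bilin M N.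
  rewrite (@linear_tfold _ _ _ _ _ (fun s => tens s _)) //.
  apply: eq_tfold => m0 m1; rewrite (@linear_tfold _ _ _ _ _ (fun s => tens _ s)) //.
  apply: eq_tfold => n0 n1.
  by rewrite (linearZE _ _ (tr _)) (linearZE _ _ (tl _)) scalerA.
rewrite (rep_ofE _ _ _ yT) (yd_tens_act yM yN) tfold_tens; last lin.
rewrite (@linear_tfold _ _ _ _ _ (fun s => tfold _ (oco H (yrho (yd_tens M N)) s)));
  last by apply: lin_tfold_r; lin.
rewrite [RHS]exchange_tfold; apply: eq_tfold => h1 h2.
rewrite yd_tens_rho ?tfold_tens //; try lin.
rewrite [RHS]exchange_tfold; apply: eq_tfold => m0 m1.
rewrite [RHS]exchange_tfold; apply: eq_tfold => n0 n1.
rewrite -amulE -dual_deltaE xi_tens.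
by rewrite (@linear_tfold _ _ _ _ _ (fun a : k^o => (a : k) *: tens (xi M m0) (xi N n0))); last lin.
Qed.

Lemma rep_of_conj g (M : object) : oyd M ->
  rep_of (yd_conj g M) = @rep_conj k V H g (RO M).
Proof.
move=> yM; have bM := oyd_oact_bilin yM; have lM := oyd_oco_linear yM.
apply: funext => x; apply: funext => u; rewrite /rep_conj /mhd_conjV.
apply: (congr1 (xi M)); rewrite tfold_tmap; first last.
- exact: autf_linear.
- exact/dcomp_linear/autf_linear.
- by lin.
apply: eq_tfold => f h.
apply: (etrans (yd_conj_rho (g := g) yM (F := fun (u0 : M) u1 => ((f : dual) u1 : k) *: u0) _ _));
  first lin.
by apply: eq_tfold => u0 u1; rewrite dcompxE //; apply: autf_linear.
Qed.

(** [rep_of_rho] turns the coaction in the braiding into the sum over dual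
    bases. *)
Lemma rep_of_braid (M N : object) (t : htens M N) : oyd M -> oyd N ->
  yd_braid t = @rep_braid k V H (RO M) (RO N) t.
Proof.
move=> yM yN; have bM := rep_of_actbil yM; have bN := rep_of_actbil yN.
have aM := oyd_act_bilin yM; have lN := oyd_rho_linear yN; have lb := braid_linear (Sinv := Sinv) yM yN.
rewrite /rep_braid; move: t; apply: linear_eq_tens => //; try lin.
move=> m n; apply: (etrans (braidE (Sinv := Sinv) _ _ yM yN)).
rewrite tfold_tens; last lin.
have oM := oyd_oact_bilin yM.
rewrite (rep_of_rho yN (F := fun n0 n1 => tens n0 (act M (autV (be (ograde M)) n1) m)));
  last lin.
apply: eq_bigr => i _; congr tens.
- rewrite [RHS]/= (actE (rep_of (ostr N))) (oact_xi (rep_of_omod yN)) xiVK.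
  rewrite /= tmap_tens ?xi_1; [|exact/dcomp_linear/xiV_lin|exact: xi_lin].
  by congr (oact _ (tens _ _) _); apply/lfunP => y; rewrite !dcompxE ?xiVK //; lin.
- rewrite [RHS]/= (actE (rep_of (ostr M))) rep_of_deps // (oact_xi (oyd_mod yM)) xiVK.
  by rewrite autV_xiV xiVK.
Qed.

Lemma rep_transport :
  @is_transport k G Rep YD (@rep_of) (@yd_of).
Proof.
split.
- by move=> X /(ydP SK SinvK) yX; apply/homModuleP; apply: rep_of_omod.
- by move=> U /homModuleP mU; apply/(ydP SK SinvK); apply: yd_of_oyd.
- by move=> X /(ydP SK SinvK) yX; apply: rep_of_K.
- by move=> U /homModuleP mU; apply: yd_of_K.
- by move=> X Y f /(ydP SK SinvK) yX /(ydP SK SinvK) yY; apply: rep_of_hom.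
- exact: rep_of_unit.
- by move=> X Y /(ydP SK SinvK) yX /(ydP SK SinvK) yY; apply: rep_of_tens.
- by move=> g X /(ydP SK SinvK) yX; apply: rep_of_conj.
- by move=> X Y t /(ydP SK SinvK) yX /(ydP SK SinvK) yY; apply: rep_of_braid.
Qed.

End Dual.

Theorem theorem3p5 (k : fieldType) (V : vectType k) (H : homHopf V) (Sinv : V -> V)
    (SK : cancel (apode H) Sinv) (SinvK : cancel Sinv (apode H)) :
  exists (wdRep : well_defined (RepMHD H Sinv)) (wdYD : well_defined (MHYD H Sinv)),
    [/\ is_braidedT (tcat_of wdRep),
        is_braidedT (tcat_of wdYD)
      & braidedT_isomorphic (tcat_of wdRep) (tcat_of wdYD)].
Proof.
have tr := rep_transport SK SinvK; have wdYD := yd_well_defined SK SinvK.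
have bsYD := yd_braided_structure SK SinvK.
have wdRep := transport_well_defined tr wdYD.
exists wdRep, wdYD; split.
- exact/tcat_braidedT/(transport_braided_structure tr wdYD bsYD).
- exact/tcat_braidedT/bsYD.
- exact: (transport_isomorphic tr).
Qed.
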